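(* Let $X_{\mathcal A}$ be the blow-up of $\mathbb{P}^2=\mathbb{P}^2_{\mathbb C}$ at the 31 singular points of the icosahedral line configuration $\mathcal A$, let $H$ be the pullback of the class of a line, and for $k\in\{2,3,5\}$ let $E_k$ be the sum of the exceptional divisors over the points of $\mathcal A$ of multiplicity $k$. Then the divisor class $D=40H-5E_5-7E_3-8E_2$ on $X_{\mathcal A}$ is nef. Consequently, if $I_{\mathcal A}\subseteq \mathbb{C}[x,y,z]$ denotes the homogeneous (radical) ideal of the 31 singular points of $\mathcal A$, its Waldschmidt constant is $$\widehat{\alpha}(I_{\mathcal A})=\frac{11}{2}.$$
   Context: Let $\omega=\frac{1+\sqrt5}{2}$ and let $G\subset \mathrm{GL}(3,\mathbb{C})$ be the group generated by $$\begin{pmatrix}-1&0&0\\0&1&0\\0&0&1\end{pmatrix},\quad \begin{pmatrix}1&0&0\\0&-1&0\\0&0&1\end{pmatrix},\quad \frac{-1}{2}\begin{pmatrix}\omega-1&\omega&1\\ \omega&-1&\omega-1\\ 1&\omega-1&-\omega\end{pmatrix}.$$ $G\cong A_5\times\mathbb{Z}_2$ has order 120 and is the full symmetry group of a regular icosahedron. It contains exactly 15 pseudoreflections (elements fixing a plane pointwise); the projectivizations in $\mathbb{P}^2$ of the 15 fixed planes (the mirror planes of the icosahedron) are the 15 lines of the icosahedral line configuration $\mathcal A$. The points lying on at least two of these lines are the 31 singular points of $\mathcal A$: 6 quintuple points (on exactly 5 lines), 10 triple points (on exactly 3 lines) and 15 double points (on exactly 2 lines). For the homogeneous radical ideal $I=\bigcap_i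 I_{p_i}$ of a finite set of points $p_i\in\mathbb{P}^2$, the $m$-th symbolic power is $I^{(m)}=\bigcap_i I_{p_i}^m$; $\alpha(J)$ denotes the least positive integer $t$ with $J_t\neq 0$ for a homogeneous ideal $J$; and the Waldschmidt constant is $\widehat\alpha(I)=\lim_{m\to\infty}\alpha(I^{(m)})/m$. *)

(* Defs.v *)
From HB Require Import structures.
From mathcomp Require Import all_boot all_order all_algebra.
From mathcomp Require Import finmap.
From mathcomp Require Import boolp classical_sets functions cardinality.
From mathcomp Require Import reals.
From mathcomp.real_closed Require Import complex.
From mathcomp.multinomials Require Import mpoly.

Set Implicit Arguments.
Unset Strict Implicit.
Unset Printing Implicit Defensive.

Import Order.TTheory GRing.Theory Num.Theory.

Local Open Scope classical_set_scope.
Local Open Scope card_scope.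
Local Open Scope ring_scope.

Section ProjectivePlane.
Variable K : closedFieldType.

(* A point of P^2 is a line through the origin of K^3, a line of P^2 is a
   plane through the origin of K^3, and incidence is inclusion of subspaces. *)
Definition proj_point : choiceType := {p : {vspace 'cV[K]_3} | \dim p == 1%N}.
Definition proj_line : choiceType := {l : {vspace 'cV[K]_3} | \dim l == 2%N}.
Definition on_line (p : proj_point) (l : proj_line) : Prop := (val p <= val l)%VS.

Local Notation Pol := {mpoly K[3]}.

(* The homogeneous ideal I_p: since K is infinite, the polynomials vanishing on
   the whole line p of K^3 are those whose homogeneous components all vanish
   at the point p. *)
Definition point_ideal (p : proj_point) : set Pol :=
  [set f | forall v : 'cV[K]_3, v \in val p -> f.@[fun i => v i 0] = 0].

Fixpoint ideal_exp (J : set Pol) (m : nat) : set Pol :=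
  if m is m'.+1 then
    [set f | exists2 s : seq (Pol * Pol),
       (forall gh, gh \in s -> J gh.1 /\ ideal_exp J m' gh.2)
       & f = \sum_(gh <- s) gh.1 * gh.2]
  else setT.

(* The m-th symbolic power of the radical ideal \bigcap_(p in Z) I_p of Z. *)
Definition symbolic_power (Z : set proj_point) (m : nat) : set Pol :=
  \bigcap_(p in Z) ideal_exp (point_ideal p) m.

Definition has_form_of_degree (J : set Pol) (t : nat) : Prop :=
  exists f : Pol, [/\ f != 0, f \is t.-homog & J f].

(* alpha J is 0 when J has no nonzero form of positive degree. *)
Definition alpha (J : set Pol) : nat :=
  xget 0%N [set t | [/\ (0 < t)%N, has_form_of_degree J t &
    forall u, (0 < u)%N -> has_form_of_degree J u -> (t <= u)%N]].

Record plane_curve := PlaneCurve {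
  curve_eq : Pol;
  curve_deg : nat;
  curve_homog : curve_eq \is curve_deg.-homog;
  curve_neq0 : curve_eq != 0;
  curve_nonunit : curve_eq \isn't a GRing.unit;
  curve_irreducible : forall g h : Pol,
    curve_eq = g * h -> g \is a GRing.unit \/ h \is a GRing.unit }.

(* The order of vanishing at p: as I_p ^ m is I_p-primary, a form lies in it
   if and only if its germ at p lies in the m-th power of the maximal ideal
   of the local ring of P^2 at p. *)
Definition multiplicity (C : plane_curve) (p : proj_point) : nat :=
  xget 0%N [set m | ideal_exp (point_ideal p) m (curve_eq C) /\
                    ~ ideal_exp (point_ideal p) m.+1 (curve_eq C)].

Section BlowUp.
Variable Z : {fset proj_point}.

(* The Picard group of the blow-up of P^2 at the points of Z, free on the
   pullback H of the class of a line and on the exceptional divisors E_p: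
   the pair (d, a) stands for d H + \sum_p a_p E_p. *)
Definition Pic : zmodType := (int * {ffun Z -> int})%type.

Definition hyperplane : Pic := (1, 0).
Definition exceptional (p : Z) : Pic := (0, [ffun q => (q == p)%:R]).

(* H.H = 1, H.E_p = 0 and E_p.E_q = - delta_pq. *)
Definition intersection (D1 D2 : Pic) : int :=
  D1.1 * D2.1 - \sum_(p : Z) D1.2 p * D2.2 p.

(* An irreducible curve on the blow-up is either one of the E_p or the strict
   transform of an irreducible plane curve C, which is of class
   (deg C) H - \sum_p (mult_p C) E_p. *)
Inductive blowup_curve :=
  | ExceptionalCurve of Z
  | StrictTransform of plane_curve.

Definition curve_class (C : blowup_curve) : Pic :=
  match C with
  | ExceptionalCurve p => exceptional p
  | StrictTransform C0 =>
      hyperplane *+ curve_deg C0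
      - \sum_(p : Z) exceptional p *+ multiplicity C0 (val p)
  end.

Definition nef (D : Pic) : Prop :=
  forall C : blowup_curve, 0 <= intersection D (curve_class C).

End BlowUp.
End ProjectivePlane.

Inductive generated_subgroup (K : fieldType) (n : nat) (X : set 'M[K]_n) :
    'M[K]_n -> Prop :=
  | GeneratedGen g : X g -> generated_subgroup X g
  | GeneratedOne : generated_subgroup X 1%:M
  | GeneratedMul g h : generated_subgroup X g -> generated_subgroup X h ->
      generated_subgroup X (g *m h)
  | GeneratedInv g : generated_subgroup X g -> generated_subgroup X (invmx g).

Section Icosahedral.
Variable R : realType.
Local Notation C := R[i].

Definition omega : C := (((1 + Num.sqrt 5) / 2 : R)%:C)%C.

Definition mx3 (rows : seq (seq C)) : 'M[C]_3 :=
  \matrix_(i < 3, j < 3) (nth [::] rows i)`_j.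

Definition icosahedral_generators : set 'M[C]_3 :=
  [set mx3 [:: [:: -1; 0; 0];
               [::  0; 1; 0];
               [::  0; 0; 1]];
       mx3 [:: [::  1;  0; 0];
               [::  0; -1; 0];
               [::  0;  0; 1]];
       (-1 / 2) *: mx3 [:: [:: omega - 1; omega;     1        ];
                           [:: omega;     -1;        omega - 1];
                           [:: 1;         omega - 1; - omega  ]]].

Definition icosahedral_group : set 'M[C]_3 :=
  generated_subgroup icosahedral_generators.

(* The lines are the projectivized fixed planes of the pseudoreflections; the
   fixed space of g having dimension exactly 2 excludes the identity. *)
Definition icosahedral_lines : set (proj_line C) :=
  [set l | exists2 g, icosahedral_group g &
             val l = fixedSpace (linfun (mulmx g : 'cV[C]_3 -> 'cV[C]_3))].

Definition lines_through (p : proj_point C) : set (proj_line C) :=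
  [set l | icosahedral_lines l /\ on_line p l].

Definition singular_points : set (proj_point C) :=
  [set p | exists l1 l2, [/\ lines_through p l1, lines_through p l2 & l1 != l2]].

(* fset_set is only meaningful on finite sets; there are 31 singular points. *)
Definition singular_fset : {fset proj_point C} := fset_set singular_points.

Local Notation X := singular_fset.

Definition exceptional_sum (k : nat) : Pic X :=
  \sum_(p : X | lines_through (val p) #= `I_k) exceptional p.

Definition divisor_D : Pic X :=
  hyperplane X *+ 40 - exceptional_sum 5 *+ 5 - exceptional_sum 3 *+ 7
  - exceptional_sum 2 *+ 8.

End Icosahedral.

(* Main.v *)
(* Let Q, f, g be the icosahedral invariants of degrees 2, 6, 10. Suitable polynomials P30, C30
   and F80 in Q, f, g have degrees 30, 30, 80 and prescribed orders at the 31 points, such that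
   both F80^3 and P30^2 f^5 C30^5 are of degree 240 and of orders 30, 42, 48 at the quintuple,
   triple and double points: they are sections of 6 D. Eliminating, these two forms have only
   finitely many common zeros in the plane. A general member of the pencil they span therefore
   has no component in common with a given form h of degree e, and Bezout's theorem yields \sum_p c_p mult_p(h) <= 40 e with c_p = 5, 7, 8. This is the
   nefness of D, and applied to forms of order at least m at all the points, where
   \sum_p c_p = 220, it gives alpha(I^(m)) >= 11 m / 2. Conversely, P30 F80 has degree 110 and
   order 20 at each of the points, so that alpha(I^(m)) <= 110 (m / 20 + 1).

   The points and lines are identified by computing in Z[w] (w the golden ratio): an explicit
   list of 120 matrices is stable under the generators, and besides the identity and 15
   reflections each of them fixes at most a line. *)
Require Import Defs.
From Stdlib Require Import BinPos BinInt.
From HB Require Import structures.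
From mathcomp Require Import all_boot all_order perm all_algebra.
From mathcomp Require Import finmap.
From mathcomp Require Import boolp classical_sets functions cardinality reals.
From mathcomp.real_closed Require Import complex.
From mathcomp.multinomials Require Import mpoly.
From mathcomp Require Import topology normedtype.
From mathcomp Require Import ring zify ssrZ.

Set Implicit Arguments.
Unset Strict Implicit.
Unset Printing Implicit Defensive.

Import Order.TTheory GRing.Theory Num.Theory.
Import numFieldNormedType.Exports.

Local Open Scope classical_set_scope.
Local Open Scope ring_scope.

(** * Powers of the ideal of a point *)

(** D has self-intersection 1600 - 6 * 25 - 10 * 49 - 15 * 64 = 0, so nefness has no slack; it is
    witnessed by two sections of a multiple of D without common component. Invariant theory supplies
    them. The map (Q : f : g) from the plane to a weighted projective plane has finite fibres, and
    there the curves of P30 and C30 are rational: finiteness of the base locus becomes the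
    nonvanishing of F80 along two explicit parametrizations. The orders at the points come from the
    same source. The mirrors through a k-fold point generate a dihedral group of order 2 k, whose
    local invariants have degrees 2 and k; rewriting a form in two combinations of Q, f, g of these
    orders lets its order be read off the exponents. Bezout's inequality is proved by projection
    from a general point: the resultant is a polynomial in one variable, of degree at most the
    product of the two degrees, and divisible by (X - x_p)^(m_p n_p) for each point p. *)

Section PowersOfIdeals.
Variables (K : closedFieldType) (J : set {mpoly K[3]}).
Hypothesis J_mull : forall a f, J f -> J (a * f).

Lemma ideal_exp0 m : ideal_exp J m 0.
Proof. by case: m => [|m] //=; exists [::]; rewrite ?big_nil. Qed.

Lemma ideal_expD m f g : ideal_exp J m f -> ideal_exp J m g -> ideal_exp J m (f + g).
Proof.
case: m => [|m] //= [s Js ->] [t Jt ->]; exists (s ++ t); last by rewrite big_cat.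
by move=> gh; rewrite mem_cat => /orP[/Js|/Jt].
Qed.

Lemma ideal_exp_sum m (I : Type) (r : seq I) (P : pred I) F :
  (forall i, P i -> ideal_exp J m (F i)) -> ideal_exp J m (\sum_(i <- r | P i) F i).
Proof. by move=> JF; elim/big_ind: _; [exact: ideal_exp0|exact: ideal_expD|]. Qed.

Lemma ideal_expMl m a f : ideal_exp J m f -> ideal_exp J m (a * f).
Proof.
case: m => [|m] //= [s Js ->]; exists [seq (a * gh.1, gh.2) | gh <- s].
  by move=> _ /mapP[gh /Js[Jg Jh] ->]; split => //=; apply: J_mull.
by rewrite big_map mulr_sumr; apply: eq_bigr => gh _ /=; rewrite mulrA.
Qed.

Lemma ideal_expS m f g : J f -> ideal_exp J m g -> ideal_exp J m.+1 (f * g).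
Proof.
move=> Jf Jg; exists [:: (f, g)]; last by rewrite big_seq1.
by move=> gh; rewrite inE => /eqP ->.
Qed.

Lemma ideal_expM m n f g :
  ideal_exp J m f -> ideal_exp J n g -> ideal_exp J (m + n) (f * g).
Proof.
elim: m f => [|m IHm] f; first by move=> _; apply: ideal_expMl.
move=> [s Js ->] Jg; rewrite mulr_suml big_seq; apply: ideal_exp_sum => gh /Js[Jgh1 Jgh2].
by rewrite -mulrA addSn; apply/ideal_expS/IHm.
Qed.

Lemma ideal_expX m k f : ideal_exp J m f -> ideal_exp J (m * k) (f ^+ k).
Proof. by move=> Jf; elim: k => [|k IHk]; rewrite ?muln0 // exprS mulnS; apply: ideal_expM. Qed.

Lemma ideal_exp_leq m n f : (m <= n)%N -> ideal_exp J n f -> ideal_exp J m f.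
Proof.
move/subnK <-; elim: (n - m)%N f => // k IHk _ [s Js ->]; apply: IHk.
rewrite big_seq; apply: ideal_exp_sum => gh /Js[_ Jgh2]; exact: ideal_expMl.
Qed.

End PowersOfIdeals.

Section MpolyMorphisms.
Variables (R : comNzRingType) (n : nat) (A : comNzRingType).

Lemma mpoly_rmorphE (phi : {rmorphism {mpoly R[n]} -> A}) f :
  phi f = \sum_(m <- msupp f) phi (f@_m)%:MP * \prod_i phi 'X_i ^+ m i.
Proof.
rewrite {1}[f]mpolyE rmorph_sum; apply: eq_bigr => m _.
rewrite -mul_mpolyC rmorphM mpolyXE_id rmorph_prod /=.
by congr (_ * _); apply: eq_bigr => i _; rewrite rmorphXn.
Qed.

(** All identities between substitutions below (expansions, charts, evaluations, specializations)
    are reduced by this lemma to constants and variables. *)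
Lemma eq_mpoly_rmorph (phi psi : {rmorphism {mpoly R[n]} -> A}) :
  (forall c, phi c%:MP = psi c%:MP) -> (forall i, phi 'X_i = psi 'X_i) -> phi =1 psi.
Proof.
move=> eqC eqX f; rewrite !mpoly_rmorphE; apply: eq_bigr => m _; rewrite eqC.
by congr (_ * _); apply: eq_bigr => i _; rewrite eqX.
Qed.

End MpolyMorphisms.

Section PointIdeal.
Variables (K : closedFieldType) (p : proj_point K).
Local Notation Pol := {mpoly K[3]}.
Implicit Types f g : Pol.

Lemma point_idealMl a f : point_ideal p f -> point_ideal p (a * f).
Proof. by move=> pf v pv; rewrite mevalM pf ?mulr0. Qed.

Definition point_vec : 'cV[K]_3 := vpick (val p).

Lemma point_vec_neq0 : point_vec != 0.
Proof. by rewrite vpick0 -dimv_eq0 (eqP (valP p)). Qed.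

Lemma point_line : val p = <[point_vec]>%VS.
Proof.
apply/eqP; rewrite eq_sym eqEdim -memvE memv_pick dim_vline point_vec_neq0.
by rewrite (eqP (valP p)).
Qed.

(* Writing X = l p + w with l a linear form such that l(p) = 1, so that the
   coordinates of w lie in I_p, this expands f(l p + T w) in powers of T. *)
Definition pencil_var (j i : 'I_3) : {poly Pol} :=
  let l : Pol := (point_vec j 0)^-1 *: 'X_j in
  (point_vec i 0 *: l)%:P + ('X_i - point_vec i 0 *: l) *: 'X.

Definition pencil_expansion (j : 'I_3) : Pol -> {poly Pol} :=
  mmap (polyC \o @mpolyC 3 K) (pencil_var j).

HB.instance Definition _ j := GRing.RMorphism.on (pencil_expansion j).

Variable j : 'I_3.
Hypothesis pj : point_vec j 0 != 0.

Lemma pencil_expansionX i : pencil_expansion j 'X_i = pencil_var j i.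
Proof. by rewrite /pencil_expansion mmapX mmap1U. Qed.

Lemma pencil_expansionC c : pencil_expansion j c%:MP = c%:MP%:P.
Proof. by rewrite /pencil_expansion mmapC. Qed.

Lemma pencil_expansion1 f : (pencil_expansion j f).[1] = f.
Proof.
pose phi := horner_eval (1 : Pol) \o pencil_expansion j.
rewrite -[RHS]/((idfun : {rmorphism Pol -> Pol}) f).
apply: (@eq_mpoly_rmorph _ _ _ phi idfun) => [c|i] /=.
  by rewrite /horner_eval pencil_expansionC hornerC.
rewrite /horner_eval pencil_expansionX /pencil_var hornerD hornerZ hornerX hornerC.
by rewrite mulr1 addrC subrK.
Qed.

(** Polynomials in T whose coefficient of T^k lies in I_p^k for all k form a ring containing the
    constants. The image of a variable is of this kind because its T-coefficient is a linear form
    vanishing at p. *)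
Lemma pencil_expansion_coef f k : ideal_exp (point_ideal p) k (pencil_expansion j f)`_k.
Proof.
have Jl := point_idealMl.
pose graded (q : {poly Pol}) := forall k, ideal_exp (point_ideal p) k q`_k.
have gradedD q r : graded q -> graded r -> graded (q + r).
  by move=> Gq Gr i; rewrite coefD; apply: ideal_expD.
have gradedM q r : graded q -> graded r -> graded (q * r).
  move=> Gq Gr i; rewrite coefM; apply: ideal_exp_sum => a _.
  by have := ideal_expM Jl (Gq a) (Gr (i - a)%N); rewrite subnKC // -ltnS.
have gradedC c : graded c%:P.
  by move=> [|i] //; rewrite coefC; apply: ideal_exp0.
have gradedX i : graded (pencil_var j i).
  case=> [|[|a]] //; last first.
    rewrite coefD coefC coefZ coefX mulr0 addr0; exact: ideal_exp0.
  rewrite coefD coefC coefZ coefX mulr1 add0r -[_ - _]mulr1.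
  apply: ideal_expS => // v; rewrite point_line => /vlineP[c ->].
  by rewrite mevalB !mevalZ !mevalXU !mxE [c * point_vec j 0]mulrC mulKf // mulrC subrr.
suff: graded (pencil_expansion j f) by apply.
rewrite mpoly_rmorphE; apply: (big_rec graded) => [|m q _ Gq]; first exact: (gradedC 0).
apply: (gradedD) => //; apply: (gradedM) => /=; first by rewrite pencil_expansionC.
apply: (big_rec graded) => [|i r _ Gr]; first exact: gradedC.
apply: (gradedM) => //; rewrite pencil_expansionX.
by elim: (m i) => [|a IHa]; [exact: gradedC | rewrite exprS; exact: gradedM].
Qed.

(** Evaluation at T = 1 gives f back as the sum of the coefficients, and divisibility by T^m leaves
    only those of index at least m. Membership in a power of I_p thus becomes divisibility by a
    power of one variable. *)
Lemma ideal_exp_pencil f m :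
  (exists q, pencil_expansion j f = 'X^m * q) -> ideal_exp (point_ideal p) m f.
Proof.
have Jl := point_idealMl.
move=> [q fq]; rewrite -[f]pencil_expansion1 horner_coef.
apply: ideal_exp_sum => -[i lti] _ /=; rewrite expr1n mulr1 {lti}.
case: (leqP m i) => [le_mi|lt_im].
  exact/(ideal_exp_leq Jl le_mi)/pencil_expansion_coef.
by rewrite fq coefXnM lt_im; apply: ideal_exp0.
Qed.

End PointIdeal.

(** * Bezout's inequality with multiplicities *)

Section WeightedDeterminants.
Variables (R : idomainType) (n : nat).
Implicit Types (M : 'M[{poly R}]_n) (r c : 'I_n -> nat).

Lemma sum_perm_weights r c (s : 'S_n) :
  (\sum_i r i - \sum_i c i <= \sum_i (r i - c (s i)))%N.
Proof.
have -> : (\sum_i c i = \sum_i c (s i))%N by apply: reindex_inj; exact: perm_inj.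
rewrite leq_subLR -big_split /=.
by apply: leq_sum => i _; rewrite -leq_subLR.
Qed.

(** Each Leibniz term takes one entry from every row and column, so its exponents add up to at least
    the difference of the weight sums, whatever the permutation. Subtraction is truncated: an entry
    with c j above r i carries no condition. *)
Lemma det_weight_dvd (t : {poly R}) M r c :
  (forall i j, exists q, M i j = t ^+ (r i - c j) * q) ->
  exists q, \det M = t ^+ (\sum_i r i - \sum_i c i) * q.
Proof.
move=> tM; pose P (k : nat) (q : {poly R}) := exists q', q = t ^+ k * q'.
have P_le k l q : (k <= l)%N -> P l q -> P k q.
  by move=> /subnKC <- [q' ->]; exists (t ^+ (l - k) * q'); rewrite exprD mulrA.
change (P (\sum_i r i - \sum_i c i)%N (\det M)); apply: (big_ind (P _)) => [|q1 q2 [q1' ->] [q2' ->]|s _].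
- by exists 0; rewrite mulr0.
- by exists (q1' + q2'); rewrite mulrDr.
apply: P_le (sum_perm_weights r c s) _.
suff [q ->] : P (\sum_i (r i - c (s i)))%N (\prod_i M i (s i)).
  by exists ((-1) ^+ s * q); rewrite mulrCA.
apply: (big_ind2 P) => [|k1 q1 k2 q2 [q1' ->] [q2' ->]|i _].
- by exists 1; rewrite mulr1.
- by exists (q1' * q2'); rewrite exprD mulrACA.
exact: tM.
Qed.

Lemma det_weight_size M r c :
  (forall i j, M i j = 0 \/ (size (M i j) + c j <= (r i).+1)%N) ->
  (size (\det M) <= (\sum_i r i - \sum_i c i).+1)%N.
Proof.
move=> szM; apply: (big_ind (fun q : {poly R} => (size q <= _)%N)) => [|q1 q2 h1 h2|s _].
- by rewrite size_poly0.
- by rewrite (leq_trans (size_polyD _ _)) // geq_max h1.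
rewrite -signr_odd; case: (odd _); rewrite ?expr0 ?expr1 ?mul1r ?mulN1r ?size_polyN.
all: have [/existsP[i /eqP Mi0]|/existsPn Mn0] := boolP [exists i, M i (s i) == 0];
  first by rewrite (bigD1 i) //= Mi0 mul0r size_poly0.
all: rewrite size_prod => [|i _]; last exact: Mn0.
all: rewrite cardE size_enum_ord; set S := (\sum_i size _)%N.
all: have le1 i : (size (M i (s i)) + c (s i) <= (r i).+1)%N
  by case: (szM i (s i)) => // /eqP; rewrite (negPf (Mn0 i)).
all: have : (S + \sum_i c (s i) <= \sum_i r i + n)%N by
  rewrite -[X in (_ <= _ + X)%N](card_ord n) -sum1_card -!big_split /=;
  apply: leq_sum => i _; rewrite addn1.
all: have -> : (\sum_i c i = \sum_i c (s i))%N by apply: reindex_inj; exact: perm_inj.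
all: lia.
Qed.

End WeightedDeterminants.

Section Sylvester.
Variable R : comNzRingType.
Implicit Types f g : {poly R}.

(* The matrix of (u, v) |-> u f + v g, for size u <= d and size v <= e. *)
Definition sylvester (d e : nat) f g : 'M[R]_(d + e) :=
  col_mx (\matrix_(i < d, j < d + e) (f * 'X^i)`_j)
         (\matrix_(i < e, j < d + e) (g * 'X^i)`_j).

Definition shift_mx (z : R) n : 'M[R]_n := \matrix_(i < n, j < n) (('X + z%:P) ^+ i)`_j.

Lemma det_shift_mx z n : \det (shift_mx z n) = 1.
Proof.
rewrite det_trig => [|].
  apply: big1 => i _; rewrite mxE -[X in _ + X]opprK -polyCN.
  have /monicP := monic_exp i (monicXsubC (- z)).
  by rewrite /lead_coef size_exp_XsubC.
apply/is_trig_mxP => i j lt_ij; rewrite mxE nth_default //.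
by rewrite -[X in _ + X]opprK -polyCN size_exp_XsubC.
Qed.

Lemma row_shift_mx z n f (j : 'I_n) : (size f <= n)%N ->
  \sum_(k < n) f`_k * shift_mx z n k j = (f \Po ('X + z%:P))`_j.
Proof.
move=> sz_f; rewrite -[f in RHS](coefK f) poly_def raddf_sum /= coef_sum.
rewrite -(big_mkord xpredT (fun k => (f`_k *: 'X^k \Po ('X + z%:P))`_j)).
rewrite (big_nat_widen _ _ _ _ _ sz_f) big_mkord [RHS]big_mkcond /=.
apply: eq_bigr => k _; rewrite mxE comp_polyZ comp_Xn_poly coefZ.
by case: ltnP => // sz_k; rewrite nth_default ?mul0r.
Qed.

(** Translation of the variable is unipotent on the monomial basis, and it carries f X^i to the
    translate of f times (X + z)^i; the two Sylvester matrices therefore differ by factors of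
    determinant 1. This lets each point be moved to Z = 0 before orders are read off. *)
Lemma det_sylvester_shift d e f g z : (size f <= e.+1)%N -> (size g <= d.+1)%N ->
  \det (sylvester d e (f \Po ('X + z%:P)) (g \Po ('X + z%:P))) = \det (sylvester d e f g).
Proof.
move=> sz_f sz_g; set fz := f \Po _; set gz := g \Po _.
suff: sylvester d e f g *m shift_mx z (d + e) =
      block_mx (shift_mx z d) 0 0 (shift_mx z e) *m sylvester d e fz gz.
  move/(congr1 determinant); rewrite !det_mulmx det_ublock !det_shift_mx.
  by rewrite !mulr1 mul1r => ->.
have szM (h : {poly R}) k : (size (h * 'X^k)%R <= size h + k)%N.
  by rewrite (leq_trans (size_polyMleq _ _)) // size_polyXn addnS.
have shiftM (h : {poly R}) m (i : 'I_m) (j : 'I_(d + e)) :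
    \sum_(k < m) shift_mx z m i k * ((h \Po ('X + z%:P)) * 'X^k)`_j =
    ((h * 'X^i) \Po ('X + z%:P))`_j.
  have sz_i : (size (('X + z%:P) ^+ i)%R <= m)%N.
    by rewrite -[X in _ + X]opprK -polyCN size_exp_XsubC.
  rewrite comp_polyM comp_Xn_poly -[('X + z%:P) ^+ i]coefK poly_def mulr_sumr coef_sum.
  rewrite -(big_mkord xpredT (fun k => (_ * (_`_k *: 'X^k))`_j)).
  rewrite (big_nat_widen _ _ _ _ _ sz_i) big_mkord [RHS]big_mkcond /=.
  apply: eq_bigr => k _; rewrite mxE -scalerAr coefZ.
  case: ltnP => // sz_k; suff -> : (('X + z%:P) ^+ i : {poly R})`_k = 0 by rewrite mul0r.
  exact: nth_default.
rewrite /sylvester mul_col_mx mul_block_col !mul0mx addr0 add0r.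
congr col_mx; apply/matrixP => i j; rewrite !mxE.
- under eq_bigr do rewrite mxE; rewrite row_shift_mx; last first.
    by rewrite (leq_trans (szM _ _)) // (leq_trans (leq_add sz_f (leqnn _))) // addSnnS addnC leq_add2r.
  by rewrite -shiftM; apply: eq_bigr => k _; rewrite !mxE.
under eq_bigr do rewrite mxE; rewrite row_shift_mx; last first.
  by rewrite (leq_trans (szM _ _)) // (leq_trans (leq_add sz_g (leqnn _))) // addSnnS leq_add2l.
by rewrite -shiftM; apply: eq_bigr => k _; rewrite !mxE.
Qed.

End Sylvester.

Lemma map_sylvester (R S : comNzRingType) (phi : {rmorphism R -> S}) d e f g :
  map_mx phi (sylvester d e f g) = sylvester d e (map_poly phi f) (map_poly phi g).
Proof.
rewrite /sylvester map_col_mx; congr col_mx; apply/matrixP => i j.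
  by rewrite !mxE -coef_map rmorphM /= map_polyXn.
by rewrite !mxE -coef_map rmorphM /= map_polyXn.
Qed.

(** A row vector in the kernel is a relation a f + b g = 0 with b of size at most e; coprimality
    makes f divide b, and the exact size e + 1 of f forces b = 0, hence a = 0. *)
Lemma det_sylvester_neq0 (F : fieldType) d e (f g : {poly F}) :
  size f = e.+1 -> (size g <= d.+1)%N -> coprimep f g -> \det (sylvester d e f g) != 0.
Proof.
move=> sz_f sz_g cop_fg; apply/negP => /det0P[v nz_v].
pose a : {poly F} := rVpoly (lsubmx v); pose b : {poly F} := rVpoly (rsubmx v).
rewrite -[v]hsubmxK mul_row_col => v0.
have coefE k (u : 'rV[F]_k) (h : {poly F}) (j : 'I_(d + e)) :
    (u *m \matrix_(i < k, j < d + e) (h * 'X^i)`_j) 0 j = (rVpoly u * h)`_j.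
  rewrite mxE /rVpoly poly_def mulr_suml coef_sum; apply: eq_bigr => i _.
  by rewrite mxE valK -scalerAl coefZ mulrC [h * _]mulrC mulrC.
have ab0 : a * f + b * g = 0.
  apply/polyP => j; rewrite coef0; case: (ltnP j (d + e)) => [lt_j|le_j]; last first.
    rewrite nth_default // (leq_trans (size_polyD _ _)) // geq_max.
    have sza : (size a <= d)%N by exact: size_poly.
    have szb : (size b <= e)%N by exact: size_poly.
    rewrite !(leq_trans (size_polyMleq _ _)) //; lia.
  have /rowP/(_ (Ordinal lt_j)) := v0; rewrite mxE [RHS]mxE !coefE => v0j.
  by rewrite coefD; apply: v0j.
have b0 : b = 0.
  apply/eqP; rewrite -[_ == _]negbK; apply/negP => nz_b.
  have : f %| b.
    by rewrite -(Gauss_dvdpl _ cop_fg) -[b * g](addKr (a * f)) ab0 addr0 -mulNr dvdp_mull.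
  move/(dvdp_leq nz_b); rewrite sz_f; apply/negP; rewrite -leqNgt; exact: size_poly.
have a0 : a = 0.
  move/eqP: ab0; rewrite b0 mul0r addr0 mulf_eq0 => /orP[/eqP //|/eqP f0].
  by rewrite f0 size_poly0 in sz_f.
case/negP: nz_v; rewrite -[v]hsubmxK -[lsubmx v]rVpolyK -[rsubmx v]rVpolyK -/a -/b a0 b0.
by rewrite !linear0 row_mx0.
Qed.

(** * Restriction of forms to affine planes, and intersection numbers by projection *)

Section Charts.
Variables (K : fieldType) (o : 'cV[K]_3).
Implicit Types (f : {mpoly K[3]}) (al : 'I_3 -> {poly K}) (q r : {poly {poly K}}).

Definition chart_var al i : {poly {poly K}} := (al i)%:P + (o i 0)%:P *: 'X.

(* The restriction of f to the affine plane al + Z o, where the coordinates of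
   al are polynomials in X; the outer variable is Z. *)
Definition chart al : {mpoly K[3]} -> {poly {poly K}} :=
  mmap (polyC \o polyC) (chart_var al).

HB.instance Definition _ al := GRing.RMorphism.on (chart al).

Lemma chartX al i : chart al 'X_i = chart_var al i.
Proof. by rewrite /chart mmapX mmap1U. Qed.

Lemma chartC al c : chart al c%:MP = c%:P%:P.
Proof. by rewrite /chart mmapC. Qed.

Lemma chart_shift al (z : {poly K}) f :
  chart al f \Po ('X + z%:P) = chart (fun i => al i + z * (o i 0)%:P) f.
Proof.
pose phi := comp_poly ('X + z%:P) \o chart al.
apply: (@eq_mpoly_rmorph _ _ _ phi (chart _)) => [c|i] /=.
  by rewrite !chartC comp_polyC.
rewrite !chartX /chart_var comp_polyD comp_polyZ comp_polyC comp_polyX.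
by rewrite polyCD polyCM -!mul_polyC; ring.
Qed.

Lemma horner_chart al f z x :
  (chart al f).[z].[x] = f.@[fun i => (al i).[x] + z.[x] * o i 0].
Proof.
pose phi := horner_eval x \o horner_eval z \o chart al.
apply: (@eq_mpoly_rmorph _ _ _ phi (meval _)) => [c|i] /=.
  by rewrite chartC mevalC /horner_eval !hornerC.
rewrite chartX mevalXU /horner_eval /chart_var !(hornerD, hornerZ, hornerC, hornerX).
by rewrite hornerM hornerC mulrC.
Qed.

(** Total degree at most e in the two variables, coefficient by coefficient. A zero coefficient is a
    separate case, since the inequality alone would fail for i > e + 1. *)
Definition has_tdegree (e : nat) q :=
  forall i, q`_i = 0 \/ (size (q`_i)%R + i <= e.+1)%N.

Lemma has_tdegreeD e q r : has_tdegree e q -> has_tdegree e r -> has_tdegree e (q + r).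
Proof.
move=> qe re i; rewrite coefD.
case: (qe i) => [->|qi]; first by rewrite add0r.
case: (re i) => [->|ri]; first by rewrite addr0; right.
by right; rewrite (leq_trans (leq_add (size_polyD _ _) (leqnn i))) // addn_maxl geq_max qi.
Qed.

Lemma has_tdegreeM d e q r : has_tdegree d q -> has_tdegree e r -> has_tdegree (d + e) (q * r).
Proof.
move=> qd re i; rewrite coefM.
apply: (big_ind (fun c : {poly K} => c = 0 \/ (size c + i <= (d + e).+1)%N)) => [|c1 c2|j _]; first by left.
  move=> [->|c1i]; first by rewrite add0r.
  move=> [->|c2i]; first by rewrite addr0; right.
  by right; rewrite (leq_trans (leq_add (size_polyD _ _) (leqnn i))) // addn_maxl geq_max c1i.
case: (qd j) => [->|qj]; first by rewrite mul0r; left.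
case: (re (i - j)%N) => [->|rj]; first by rewrite mulr0; left.
have [->|] := eqVneq q`_j 0; first by rewrite mul0r; left.
rewrite -size_poly_gt0 => q_gt0; right.
rewrite (leq_trans (leq_add (size_polyMleq _ _) (leqnn i))) //; have := ltn_ord j; lia.
Qed.

Definition has_lead (e : nat) (c : K) q := (size q <= e.+1)%N /\ q`_e = c%:P.

Lemma has_leadM d e b c q r :
  has_lead d b q -> has_lead e c r -> has_lead (d + e) (b * c) (q * r).
Proof.
move=> [szq qd] [szr re]; split.
  by rewrite (leq_trans (size_polyMleq _ _)) //; lia.
rewrite coefM (bigD1 (inord d)) //= big1 => [|i].
  by rewrite addr0 inordK ?ltnS ?leq_addr // addKn qd re polyCM.
rewrite -val_eqE /= inordK ?ltnS ?leq_addr // => ni.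
have [lt_id|le_di] := ltnP i d.
  by rewrite [r`_ _]nth_default ?mulr0 // (leq_trans szr) //; lia.
by rewrite nth_default ?mul0r // (leq_trans szq) //; lia.
Qed.

Lemma has_leadX d k b q : has_lead d b q -> has_lead (d * k) (b ^+ k) (q ^+ k).
Proof.
move=> qd; elim: k => [|k IHk]; last by rewrite mulnS !exprS; apply: has_leadM.
by rewrite muln0 !expr0; split; rewrite ?size_poly1 // coef1.
Qed.

Lemma has_lead_var al i : has_lead 1 (o i 0) (chart_var al i).
Proof.
split; last by rewrite coefD coefC coefZ coefX add0r mulr1.
rewrite (leq_trans (size_polyD _ _)) // geq_max (leq_trans (size_polyC_leq1 _)) //.
by rewrite (leq_trans (size_scale_leq _ _)) // size_polyX.
Qed.

(** The top power of Z only sees the direction o: its coefficient is the constant f(o). When o lies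
    off the curve, the chart keeps full degree in Z for every value of X. *)
Lemma has_lead_chart al e f : f \is e.-homog -> has_lead e f.@[fun i => o i 0] (chart al f).
Proof.
move/dhomogP => fe; rewrite mevalE mpoly_rmorphE.
rewrite big_seq_cond [X in has_lead _ _ X]big_seq_cond.
apply: (big_ind2 (has_lead e)) => [|c1 q1 c2 q2 [sz1 e1] [sz2 e2]|m].
- by split; rewrite ?size_poly0 // coef0.
- by split; rewrite ?(leq_trans (size_polyD _ _)) ?geq_max ?sz1 // coefD e1 e2 polyCD.
rewrite andbT => /fe mf_e; rewrite -[e]add0n; apply: has_leadM.
  by rewrite /= chartC; split; rewrite ?coefC // (leq_trans (size_polyC_leq1 _)).
have -> : e = (m ord0 + (m (lift ord0 ord0) + (m (lift ord0 (lift ord0 ord0)) + 0)))%N.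
  by rewrite -mf_e /mdeg /= mdegE !big_ord_recl big_ord0.
rewrite !big_ord_recl !big_ord0 /= !chartX.
do 3?[apply: has_leadM; first by rewrite -[X in has_lead X]mul1n; apply/has_leadX/has_lead_var].
by split; rewrite ?size_poly1 // coef1.
Qed.

Lemma size_chart al e f : f \is e.-homog -> (size (chart al f) <= e.+1)%N.
Proof. by case/(has_lead_chart al). Qed.

Variables (a b : 'cV[K]_3).
Let al i : {poly K} := (b i 0)%:P + a i 0 *: 'X.

Lemma has_tdegree_chart e f : f \is e.-homog -> has_tdegree e (chart al f).
Proof.
have deg0 (c : {poly K}) : (size c <= 1)%N -> has_tdegree 0 c%:P.
  move=> szc [|i]; rewrite coefC; [right | by left].
  by rewrite addn0.
have degX d k q : has_tdegree d q -> has_tdegree (d * k) (q ^+ k).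
  move=> qd; elim: k => [|k IHk]; last by rewrite mulnS exprS; apply: has_tdegreeM.
  by rewrite muln0 expr0; apply: deg0; rewrite size_poly1.
have deg_var i : has_tdegree 1 (chart_var al i).
  move=> [|[|j]]; rewrite coefD coefC coefZ coefX.
  - right; rewrite mulr0 addr0 addn0 (leq_trans (size_polyD _ _)) // geq_max.
    rewrite (leq_trans (size_polyC_leq1 _)) // (leq_trans (size_scale_leq _ _)) //.
    by rewrite size_polyX.
  - by right; rewrite add0r mulr1 addn1 ltnS size_polyC_leq1.
  by left; rewrite mulr0 addr0.
move/dhomogP => fe; rewrite mpoly_rmorphE big_seq_cond.
apply: (big_ind (has_tdegree e)) => [i| |m]; [by left; rewrite coef0| |].
  by move=> q r; apply: has_tdegreeD.
rewrite andbT => /fe mf_e; rewrite -[e]add0n; apply: has_tdegreeM.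
  by rewrite /= chartC; apply: deg0; apply: size_polyC_leq1.
have -> : e = (m ord0 + (m (lift ord0 ord0) + (m (lift ord0 (lift ord0 ord0)) + 0)))%N.
  by rewrite -mf_e /mdeg /= mdegE !big_ord_recl big_ord0.
rewrite !big_ord_recl !big_ord0 /= !chartX.
do 3?[apply: has_tdegreeM; first by rewrite -[X in has_tdegree X]mul1n; apply: degX].
by apply: deg0; rewrite size_poly1.
Qed.

End Charts.

Section ChartOrder.
Variables (K : closedFieldType) (o a b : 'cV[K]_3) (p : proj_point K) (x z : K).
Hypothesis p_xz : (b + x *: a + z *: o) \in val p.
Let al i : {poly K} := (b i 0)%:P + a i 0 *: 'X.
Implicit Types (f : {mpoly K[3]}) (q r : {poly {poly K}}).

(* Membership in the m-th power of the ideal (X - x, Z), Z being the outer variable. *)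
Definition has_order m q := forall i, exists c, q`_i = ('X - x%:P) ^+ (m - i) * c.

Lemma has_order_sum m (I : eqType) (s : seq I) (F : I -> {poly {poly K}}) :
  (forall i, i \in s -> has_order m (F i)) -> has_order m (\sum_(i <- s) F i).
Proof.
move=> sF; rewrite big_seq; apply: (big_ind (has_order m)) => // [i|q r qm rm i].
  by exists 0; rewrite coef0 mulr0.
by have [[c qc] [d rd]] := (qm i, rm i); exists (c + d); rewrite coefD qc rd mulrDr.
Qed.

Lemma has_orderM m n q r : has_order m q -> has_order n r -> has_order (m + n) (q * r).
Proof.
move=> qm rn i; rewrite coefM.
apply: (big_ind (fun c : {poly K} => exists d, c = _ ^+ (m + n - i) * d)) => [|c1 c2|j _].
- by exists 0; rewrite mulr0.
- by move=> [d1 ->] [d2 ->]; exists (d1 + d2); rewrite mulrDr.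
have [[c ->] [d ->]] := (qm j, rn (i - j)%N).
have le_ji : (j <= i)%N by rewrite -ltnS.
have : (m + n - i <= (m - j) + (n - (i - j)))%N by lia.
move/subnKC => Ek; exists (('X - x%:P) ^+ (m - j + (n - (i - j)) - (m + n - i)) * (c * d)).
by rewrite mulrACA [RHS]mulrA -!exprD Ek.
Qed.

(** Translating Z by z places p at X = x, Z = 0, so an element of I_p has a constant coefficient
    divisible by X - x; orders add under products. *)
Lemma has_order_chart m f : ideal_exp (point_ideal p) m f ->
  has_order m (chart o al f \Po ('X + z%:P%:P)).
Proof.
elim: m f => [|m IHm] f; first by move=> _ i; eexists; rewrite sub0n expr0 mul1r.
move=> [s Js ->]; pose phi : {rmorphism _ -> _} := comp_poly ('X + z%:P%:P) \o chart o al.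
change (has_order m.+1 (phi (\sum_(gh <- s) gh.1 * gh.2))); rewrite rmorph_sum.
apply: has_order_sum => gh gh_s; have [Jg /IHm Jh] := Js gh gh_s; rewrite rmorphM -add1n.
apply: has_orderM; last exact: Jh.
move=> [|i]; last by eexists; rewrite expr0 mul1r.
have /factor_theorem[c E] : root ((chart o al gh.1 \Po ('X + z%:P%:P))`_0) x.
  apply/eqP; rewrite -horner_coef0 horner_comp !hornerE horner_chart hornerC.
  rewrite -(Jg _ p_xz); apply: meval_eq => i; rewrite !mxE /al !(hornerD, hornerZ, hornerC, hornerX).
  by rewrite [x * _]mulrC.
by exists c; rewrite E mulrC.
Qed.

(** The coefficient of Z^e is the nonzero constant f(o), while order m makes it divisible by (X -
    x)^(m - e). *)
Lemma has_order_leq m e f : f \is e.-homog -> f.@[fun i => o i 0] != 0 ->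
  ideal_exp (point_ideal p) m f -> (m <= e)%N.
Proof.
move=> fe fo /has_order_chart/(_ e)[c]; rewrite chart_shift.
have [_ ->] := has_lead_chart o (fun i => al i + z%:P * (o i 0)%:P) fe.
move/(congr1 (horner^~ x)); rewrite hornerC hornerM horner_exp !hornerE subrr.
by rewrite expr0n subn_eq0; case: leqP => // _ /eqP; rewrite mul0r (negPf fo).
Qed.

End ChartOrder.

Lemma sum_minn k n : (n <= k)%N ->
  (\sum_(i < k) minn i n = \sum_(i < n) i + (k - n) * n)%N.
Proof.
move=> /subnKC <-; rewrite addKn big_split_ord /=; congr (_ + _)%N.
  by apply: eq_bigr => i _; apply/minn_idPl/ltnW.
rewrite -[X in (X * _)%N]card_ord -sum_nat_const.
by apply: eq_bigr => i _; apply/minn_idPr/leq_addr.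
Qed.

Section Bezout.
Variables (K : closedFieldType) (o a b : 'cV[K]_3) (f g : {mpoly K[3]}) (d e : nat).
Hypotheses (f_homog : f \is e.-homog) (g_homog : g \is d.-homog).
Hypotheses (f_o : f.@[fun i => o i 0] != 0) (g_o : g.@[fun i => o i 0] != 0).
Let al i : {poly K} := (b i 0)%:P + a i 0 *: 'X.
Let resultant : {poly K} := \det (sylvester d e (chart o al f) (chart o al g)).

Lemma size_resultant_chart : (size resultant <= (e * d).+1)%N.
Proof.
have [szf szg] := (size_chart o al f_homog, size_chart o al g_homog).
(* The coefficient of Z^j in f Z^k has degree at most e + k - j in X, and likewise for g with d.
   Summing these row weights and subtracting the column weights j gives e d. *)
pose r (k : 'I_(d + e)) := (match fintype.split k with inl i => e + i | inr i => d + i end)%N.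
apply: (leq_trans (det_weight_size (r := r) (c := fun j => val j) _)) => [i j|].
  have degX (h : {mpoly K[3]}) k l : h \is k.-homog ->
      ((chart o al h * 'X^l)`_j = 0 \/ (size ((chart o al h * 'X^l)`_j)%R + j <= (k + l).+1)%N).
    move=> hk; rewrite coefMXn; case: ltnP => [_|le_lj]; first by left.
    case: (has_tdegree_chart o a b hk (j - l)%N) => [->|szh]; [by left | right].
    by move: szh; rewrite -/al; set s := size _; lia.
  by rewrite /r mxE; case: (fintype.split i) => k; rewrite mxE; apply: degX.
rewrite ltnS /r !big_split_ord /=.
under eq_bigr do rewrite (unsplitK (inl _)).
under [X in (_ + X - _)%N]eq_bigr do rewrite (unsplitK (inr _)).
rewrite !big_split /= !sum_nat_const !card_ord; lia.
Qed.

Lemma resultant_chart_dvd (p : proj_point K) x z m n :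
  (b + x *: a + z *: o) \in val p ->
  ideal_exp (point_ideal p) m f -> ideal_exp (point_ideal p) n g ->
  ('X - x%:P) ^+ (m * n) %| resultant.
Proof.
move=> p_xz fm gn.
have [szf szg] := (size_chart o al f_homog, size_chart o al g_homog).
rewrite /resultant -(det_sylvester_shift z%:P szf szg).
have [m_e n_d] := (has_order_leq p_xz f_homog f_o fm, has_order_leq p_xz g_homog g_o gn).
(* The exponents m - (j - k) and n - (j - k) are truncated at 0. Uncapped weights would give only m
   n - (e - m)(d - n); with the caps the difference of the sums is exactly m n, given that m <= e
   and n <= d. *)
pose r (k : 'I_(d + e)) :=
  (match fintype.split k with inl i => m + minn i n | inr i => n + minn i m end)%N.
have [|q ->] := @det_weight_dvd _ _ ('X - x%:P) (sylvester d e
    (chart o al f \Po ('X + z%:P%:P)) (chart o al g \Po ('X + z%:P%:P))) r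
    (fun j => minn j (m + n)).
  have ordX (h : {mpoly K[3]}) k l (i j : nat) : ideal_exp (point_ideal p) k h ->
      exists q, ((chart o al h \Po ('X + z%:P%:P)) * 'X^i)`_j =
        ('X - x%:P) ^+ (k + minn i l - minn j (k + l)) * q.
    move=> hk; rewrite coefMXn; case: ltnP => [_|le_ij]; first by exists 0; rewrite mulr0.
    have [c ->] := has_order_chart p_xz hk (j - i)%N.
    have : (k + minn i l - minn j (k + l) <= k - (j - i))%N by lia.
    move/subnKC => Ek; eexists; rewrite -Ek exprD -mulrA; reflexivity.
  move=> i j; rewrite /r mxE; case: (fintype.split i) => k; rewrite mxE; first exact: ordX.
  by rewrite [(m + n)%N]addnC; apply: ordX.
suff <- : (m * n)%N = (\sum_i r i - \sum_(i < d + e) minn i (m + n))%N by rewrite dvdp_mulr.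
rewrite /r big_split_ord /=.
under eq_bigr do rewrite (unsplitK (inl _)).
under [X in (_ + X - _)%N]eq_bigr do rewrite (unsplitK (inr _)).
rewrite !big_split /= !sum_nat_const !card_ord !sum_minn //; last by rewrite addnC leq_add.
rewrite big_split_ord big_split /= sum_nat_const card_ord.
move: (\sum_(i < m) i)%N (\sum_(i < n) i)%N (subnKC m_e) (subnKC n_d) => S T.
move: (e - m)%N (d - n)%N => e' d' <- <-.
have -> : (n + d' + (m + e') - (m + n) = d' + e')%N by lia.
nia.
Qed.

(** At X = x0 the leading coefficient f(o) persists, so the specialized determinant is that of two
    polynomials, the first of full degree; without common root they are coprime. *)
Lemma resultant_chart_neq0 (x0 : K) :
  (forall z, let v i := b i 0 + a i 0 * x0 + z * o i 0 in f.@[v] = 0 -> g.@[v] != 0) ->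
  resultant != 0.
Proof.
move=> no_root; apply/eqP => /(congr1 (horner^~ x0)); rewrite horner0 => /eqP.
have -> : resultant.[x0] = \det (map_mx (horner_eval x0) (sylvester d e (chart o al f) (chart o al g))).
  by rewrite det_map_mx.
rewrite map_sylvester; set f0 := map_poly _ _; set g0 := map_poly _ _.
have horner0 h z : (map_poly (horner_eval x0) (chart o al h)).[z] =
    h.@[fun i => b i 0 + a i 0 * x0 + z * o i 0].
  rewrite -[z in LHS](hornerC z x0) -/(horner_eval x0 z%:P) horner_map /= /horner_eval horner_chart.
  by apply: meval_eq => i; rewrite /al !(hornerD, hornerZ, hornerC, hornerX).
have [szf [szg le]] := (size_chart o al f_homog, has_lead_chart o al f_homog).
apply/negP; apply: det_sylvester_neq0.
- apply/eqP; rewrite eqn_leq (leq_trans (size_poly _ _)) //= ltnNge.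
  apply/negP => /leq_sizeP/(_ e (leqnn e)); rewrite coef_map /= le /horner_eval hornerC => /eqP.
  by rewrite (negPf f_o).
- by rewrite (leq_trans (size_poly _ _)) // size_chart.
apply/Pdiv.ClosedField.coprimepP => z; rewrite /root horner0 => /eqP fz.
by rewrite horner0; apply: no_root.
Qed.

(** The abscissae x_i are distinct, so the factors (X - x_i)^(m_i n_i) of the resultant are coprime
    and their product divides it. One line X = x0 without common zeros is enough to show that the
    resultant is not zero. *)
Theorem bezout (I : finType) (p : I -> proj_point K) (x z : I -> K) (m n : I -> nat) (x0 : K) :
  injective x -> (forall i, (b + x i *: a + z i *: o) \in val (p i)) ->
  (forall i, ideal_exp (point_ideal (p i)) (m i) f) ->
  (forall i, ideal_exp (point_ideal (p i)) (n i) g) ->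
  (forall z, let v i := b i 0 + a i 0 * x0 + z * o i 0 in f.@[v] = 0 -> g.@[v] != 0) ->
  (\sum_i m i * n i <= e * d)%N.
Proof.
move=> inj_x p_xz fm gn /resultant_chart_neq0 nz_res.
rewrite -ltnS (leq_trans _ size_resultant_chart) //.
suff /(dvdp_leq nz_res) : \prod_i ('X - (x i)%:P) ^+ (m i * n i) %| resultant.
  rewrite size_prod => [|i _]; last by rewrite expf_neq0 // polyXsubC_eq0.
  under eq_bigr do rewrite size_exp_XsubC -addn1.
  by rewrite big_split /= sum1_card subSn ?addnK ?leq_addl.
have res_dvd i := resultant_chart_dvd (p_xz i) (fm i) (gn i).
rewrite -big_enum; have := enum_uniq I; elim: (enum I) => [|i s IHs]; first by rewrite big_nil dvd1p.
rewrite big_cons /= => /andP[s'i /IHs s_dvd]; rewrite Gauss_dvdp ?res_dvd //.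
apply: coprimep_expl; rewrite coprimep_sym coprimep_XsubC /root horner_prod prodf_seq_neq0.
apply/allP => k s_k; rewrite horner_exp hornerXsubC expf_neq0 // subr_eq0.
by apply: contraNneq s'i => /inj_x ->.
Qed.
End Bezout.

Section NonVanishing.
Variable K : numFieldType.

Lemma exists_nat_not_root (R : idomainType) (P : {poly R}) :
  injective (fun n => n%:R : R) -> P != 0 -> exists n : nat, P.[n%:R] != 0.
Proof.
move=> inj_nat nz_P; pose rs : seq R := [seq n%:R | n <- iota 0 (size P)].
have /allPn[_ /mapP[n _ ->] Pn] : ~~ all (root P) rs; last by exists n.
apply/negP => /(max_poly_roots nz_P); rewrite /rs map_inj_uniq // iota_uniq.
by rewrite size_map size_iota ltnn => /(_ isT).
Qed.

Definition mpoly_set (i : 'I_3) (c : K) : {mpoly K[3]} -> {mpoly K[3]} :=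
  mmap (@mpolyC 3 K) (fun k => if k == i then c%:MP else 'X_k).

HB.instance Definition _ i c := GRing.RMorphism.on (mpoly_set i c).

Lemma mpoly_setX i c k : mpoly_set i c 'X_k = if k == i then c%:MP else 'X_k.
Proof. by rewrite /mpoly_set mmapX mmap1U. Qed.

Lemma mpoly_setC i c a : mpoly_set i c a%:MP = a%:MP.
Proof. by rewrite /mpoly_set mmapC. Qed.

Lemma mpoly_set_neq0 i (f : {mpoly K[3]}) : f != 0 -> exists c, mpoly_set i c f != 0.
Proof.
move=> nz_f; pose vars k : {poly {mpoly K[3]}} := if k == i then 'X else ('X_k)%:P.
pose phi : {rmorphism _ -> _} := mmap (polyC \o @mpolyC 3 K) vars.
have phiX k : phi 'X_k = vars k by rewrite /phi /= mmapX mmap1U.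
have phiC a : phi a%:MP = (a%:MP)%:P by rewrite /phi /= mmapC.
have nz_phi : phi f != 0.
  apply: contra_neq nz_f => phi0; rewrite -[f]/(idfun f) -(horner0 'X_i) -phi0.
  apply: (@eq_mpoly_rmorph _ _ _ idfun (horner_eval 'X_i \o phi)) => [a|k] /=.
    by rewrite /horner_eval phiC hornerC.
  by rewrite /horner_eval phiX /vars; case: eqP => [->|_]; rewrite ?hornerX ?hornerC.
have [|n] := @exists_nat_not_root _ (phi f) _ nz_phi.
  move=> m n; rewrite -!mpolyC_nat => /(congr1 (mcoeff 0%MM)); rewrite !mpolyCK => /eqP.
  by rewrite eqr_nat => /eqP.
rewrite -mpolyC_nat => nz; exists n%:R; apply: contra_neq nz => <-.
apply: (@eq_mpoly_rmorph _ _ _ (horner_eval (n%:R)%:MP \o phi) (mpoly_set i n%:R)) => [a|k] /=.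
  by rewrite mpoly_setC /horner_eval phiC hornerC.
by rewrite mpoly_setX /horner_eval phiX /vars; case: eqP => _; rewrite ?hornerX ?hornerC.
Qed.

Lemma mpoly_nonroot (f : {mpoly K[3]}) : f != 0 -> exists v : 'cV[K]_3, f.@[fun i => v i 0] != 0.
Proof.
pose j1 : 'I_3 := lift ord0 ord0; pose j2 : 'I_3 := lift ord0 (lift ord0 ord0).
move=> /(mpoly_set_neq0 ord0)[a] /(mpoly_set_neq0 j1)[b] /(mpoly_set_neq0 j2)[c] nz.
exists (\col_i [:: a; b; c]`_i); apply: contra_neq nz => f0.
suff -> : mpoly_set j2 c (mpoly_set j1 b (mpoly_set ord0 a f)) =
          (f.@[fun i => (\col_i [:: a; b; c]`_i : 'cV_3) i 0])%:MP by rewrite f0.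
pose phi := mpoly_set j2 c \o mpoly_set j1 b \o mpoly_set ord0 a.
apply: (@eq_mpoly_rmorph _ _ _ phi (@mpolyC 3 K \o meval _)) => [d|i] /=.
  by rewrite mevalC !mpoly_setC.
by rewrite mevalXU mxE; case: i => [[|[|[|//]]] lti] /=;
  rewrite ?(mpoly_setX, mpoly_setC) /=.
Qed.

End NonVanishing.

(** * Vectors in dimension three and general position *)

Section CrossProduct.
Variable F : fieldType.
Implicit Types u v w : 'cV[F]_3.

Definition vec3 (x y z : F) : 'cV[F]_3 := \col_i [:: x; y; z]`_i.
Definition dot u v := \sum_i u i 0 * v i 0.
Definition cross u v := let c (w : 'cV[F]_3) k := w (inord k) 0 in
  vec3 (c u 1 * c v 2 - c u 2 * c v 1) (c u 2 * c v 0 - c u 0 * c v 2)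
       (c u 0 * c v 1 - c u 1 * c v 0).
Definition det3 u v w := dot (cross u v) w.

Lemma vec3P u : exists x y z, u = vec3 x y z.
Proof.
exists (u (inord 0) 0), (u (inord 1) 0), (u (inord 2) 0).
by apply/colP => -[[|[|[|//]]] lti]; rewrite mxE /=; congr (u _ 0); apply: val_inj; rewrite /= inordK.
Qed.

Lemma vec3_inord x y z k : (k < 3)%N -> vec3 x y z (inord k) 0 = [:: x; y; z]`_k.
Proof. by move=> ltk; rewrite mxE inordK. Qed.

Lemma dot_vec3 x y z x' y' z' : dot (vec3 x y z) (vec3 x' y' z') = x * x' + y * y' + z * z'.
Proof. by rewrite /dot !big_ord_recl big_ord0 !mxE /= addr0 addrA. Qed.

Lemma cross_vec3 x y z x' y' z' : cross (vec3 x y z) (vec3 x' y' z') =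
  vec3 (y * z' - z * y') (z * x' - x * z') (x * y' - y * x').
Proof. by rewrite /cross !vec3_inord. Qed.

Lemma scale_vec3 c x y z : c *: vec3 x y z = vec3 (c * x) (c * y) (c * z).
Proof. by apply/colP => -[[|[|[|//]]] lti]; rewrite !mxE. Qed.

Lemma add_vec3 x y z x' y' z' : vec3 x y z + vec3 x' y' z' = vec3 (x + x') (y + y') (z + z').
Proof. by apply/colP => -[[|[|[|//]]] lti]; rewrite !mxE. Qed.

Lemma sub_vec3 x y z x' y' z' : vec3 x y z - vec3 x' y' z' = vec3 (x - x') (y - y') (z - z').
Proof. by apply/colP => -[[|[|[|//]]] lti]; rewrite !mxE. Qed.

Lemma vec3_inj x y z x' y' z' : vec3 x y z = vec3 x' y' z' -> [/\ x = x', y = y' & z = z'].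
Proof.
move=> e; split; [have := congr1 (fun u : 'cV_3 => u (inord 0) 0) e |
  have := congr1 (fun u : 'cV_3 => u (inord 1) 0) e |
  have := congr1 (fun u : 'cV_3 => u (inord 2) 0) e]; by rewrite /= !vec3_inord.
Qed.

Lemma vec3_0 : 0 = vec3 0 0 0.
Proof. by apply/colP => -[[|[|[|//]]] lti]; rewrite !mxE. Qed.

Lemma dotZr c u v : dot u (c *: v) = c * dot u v.
Proof. by rewrite /dot mulr_sumr; apply: eq_bigr => i _; rewrite mxE mulrCA. Qed.

Lemma dotC u v : dot u v = dot v u.
Proof. by apply: eq_bigr => i _; rewrite mulrC. Qed.

Lemma cross0_scale u v : u != 0 -> cross u v = 0 -> exists c, v = c *: u.
Proof.
have [x [y [z ->]]] := vec3P u; have [x' [y' [z' ->]]] := vec3P v.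
rewrite cross_vec3 vec3_0 => nz /vec3_inj[/subr0_eq e1 /subr0_eq e2 /subr0_eq e3].
have [x0|nz_x] := eqVneq x 0; last first.
  by exists (x' / x); rewrite scale_vec3; congr vec3; rewrite -[LHS](mulKf nz_x) ?e3 -?e2; ring.
have [y0|nz_y] := eqVneq y 0; last first.
  by exists (y' / y); rewrite scale_vec3; congr vec3; rewrite -[LHS](mulKf nz_y) -?e3 ?e1; ring.
have [z0|nz_z] := eqVneq z 0; first by rewrite x0 y0 z0 eqxx in nz.
by exists (z' / z); rewrite scale_vec3; congr vec3; rewrite -[LHS](mulKf nz_z) ?e2 -?e1; ring.
Qed.

Lemma cross_ne0 u v : u != 0 -> (forall c, v != c *: u) -> cross u v != 0.
Proof. by move=> nz_u uv; apply/eqP => /(cross0_scale nz_u)[c /eqP]; rewrite (negPf (uv c)). Qed.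

(** Cramer's rule without division; it yields the coordinates of a point in a frame containing the
    centre of projection o. *)
Lemma cramer3 a o b u :
  det3 a o b *: u = det3 u o b *: a + det3 a u b *: o + det3 a o u *: b.
Proof.
have [a0 [a1 [a2 ->]]] := vec3P a; have [o0 [o1 [o2 ->]]] := vec3P o.
have [b0 [b1 [b2 ->]]] := vec3P b; have [u0 [u1 [u2 ->]]] := vec3P u.
by rewrite /det3 !cross_vec3 !dot_vec3 !scale_vec3 !add_vec3; congr vec3; ring.
Qed.

Lemma crossN u v : cross u v = - cross v u.
Proof.
have [x [y [z ->]]] := vec3P u; have [x' [y' [z' ->]]] := vec3P v.
by rewrite !cross_vec3 -scaleN1r scale_vec3; congr vec3; ring.
Qed.

Lemma dot_crossl u v : dot (cross u v) u = 0.
Proof.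
have [x [y [z ->]]] := vec3P u; have [x' [y' [z' ->]]] := vec3P v.
by rewrite cross_vec3 dot_vec3; ring.
Qed.

Lemma det3_line u v c : det3 u v (u + c *: v) = 0.
Proof.
have [x [y [z ->]]] := vec3P u; have [x' [y' [z' ->]]] := vec3P v.
by rewrite /det3 cross_vec3 scale_vec3 add_vec3 dot_vec3; ring.
Qed.

Lemma det3_swap u v w : det3 u v w = - det3 v u w.
Proof.
have [x [y [z ->]]] := vec3P u; have [x' [y' [z' ->]]] := vec3P v.
have [s [t [r ->]]] := vec3P w.
by rewrite /det3 !cross_vec3 !dot_vec3; ring.
Qed.

Lemma det3_rot u v w : det3 u v w = det3 v w u.
Proof.
have [x [y [z ->]]] := vec3P u; have [x' [y' [z' ->]]] := vec3P v.
have [s [t [r ->]]] := vec3P w.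
by rewrite /det3 !cross_vec3 !dot_vec3; ring.
Qed.

(** A Plucker relation. It will show that two points with the same abscissa are collinear with the
    centre o. *)
Lemma det3_cramer2 a o b u v :
  det3 u o b * det3 a o v - det3 v o b * det3 a o u = det3 a o b * det3 u o v.
Proof.
have [a0 [a1 [a2 ->]]] := vec3P a; have [o0 [o1 [o2 ->]]] := vec3P o.
have [b0 [b1 [b2 ->]]] := vec3P b; have [u0 [u1 [u2 ->]]] := vec3P u.
have [v0 [v1 [v2 ->]]] := vec3P v.
by rewrite /det3 !cross_vec3 !dot_vec3; ring.
Qed.

End CrossProduct.

Section GenericChoice.
Variable K : numFieldType.

Lemma seq_avoid (s : seq K) : exists x, x \notin s.
Proof.
have nz : \prod_(c <- s) ('X - c%:P) != 0 by rewrite prodf_seq_neq0; apply/allP => c _; rewrite polyXsubC_eq0.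
have [|n] := exists_nat_not_root _ nz; first by move=> m n /eqP; rewrite eqr_nat => /eqP.
by rewrite -/(root _ _) root_prod_XsubC; exists n%:R.
Qed.

(** The product of f with the linear forms attached to the members of s is a nonzero polynomial, and
    the field is infinite. *)
Lemma generic_vector (f : {mpoly K[3]}) (s : seq 'cV[K]_3) :
  f != 0 -> 0 \notin s ->
  exists v : 'cV[K]_3, f.@[fun i => v i 0] != 0 /\ {in s, forall u, dot u v != 0}.
Proof.
pose lin (u : 'cV[K]_3) : {mpoly K[3]} := \sum_i u i 0 *: 'X_i.
have linE u (v : 'cV[K]_3) : (lin u).@[fun i => v i 0] = dot u v.
  by rewrite /lin rmorph_sum; apply: eq_bigr => i _; rewrite /= mevalZ mevalXU.
have lin_neq0 u : u != 0 -> lin u != 0.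
  move=> nz; have /cV0Pn[i ui] := nz.
  by apply: contra_neq ui => /(congr1 (meval (fun k => (delta_mx i 0 : 'cV[K]_3) k 0)));
     rewrite linE meval0 /dot (bigD1 i) //= mxE !eqxx mulr1 big1 ?addr0 // => k /negPf nk;
     rewrite mxE nk mulr0.
move=> nz_f s0; have [|v] := @mpoly_nonroot K (f * \prod_(u <- s) lin u).
  rewrite mulf_neq0 // prodf_seq_neq0; apply/allP => u s_u.
  by rewrite lin_neq0 //; apply: contraNneq s0 => <-.
rewrite mevalM rmorph_prod /= mulf_eq0 negb_or prodf_seq_neq0 => /andP[fv /allP sv].
by exists v; split=> // u /sv; rewrite linE.
Qed.

End GenericChoice.

Section PencilBezout.
Variable K : numClosedFieldType.
Implicit Types u v w : 'cV[K]_3.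

Let ev (f : {mpoly K[3]}) (v : 'cV[K]_3) : K := f.@[fun i => v i 0].

Lemma exists_orthogonal w : exists u, u != 0 /\ dot u w = 0.
Proof.
have [x [y [z ->]]] := vec3P w.
have [e|nz] := eqVneq (vec3 y (- x) 0) 0.
  exists (vec3 1 0 0); split.
    by apply/eqP; rewrite vec3_0 => /vec3_inj[/eqP]; rewrite oner_eq0.
  by move: e; rewrite vec3_0 dot_vec3 => /vec3_inj[_ /eqP + _]; rewrite oppr_eq0 => /eqP ->; ring.
by exists (vec3 y (- x) 0); split=> //; rewrite dot_vec3; ring.
Qed.

(** Each listed vector excludes at most one value of c. *)
Lemma generic_combination (f g : {mpoly K[3]}) (s : seq 'cV[K]_3) :
  {in s, forall v, ev f v = 0 -> ev g v != 0} ->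
  exists c, {in s, forall v, ev (f + c *: g) v != 0}.
Proof.
move=> s_fg; have [c s'c] := seq_avoid [seq - ev f v / ev g v | v <- s].
exists c => v s_v; rewrite /ev mevalD mevalZ -!/(ev _ _).
have [g0|nz_g] := eqVneq (ev g v) 0.
  by rewrite g0 mulr0 addr0; apply: contra_eq_neq g0 => /s_fg->.
apply: contraNneq s'c => e; apply/mapP; exists v => //.
by rewrite -(mulfK nz_g c) -[c * _](addKr (ev f v)) e addr0.
Qed.

Lemma line_roots (f : {mpoly K[3]}) e u o : f \is e.-homog -> ev f o != 0 ->
  exists s : seq K, forall z, ev f (u + z *: o) = 0 -> z \in s.
Proof.
move=> fe fo; pose al i : {poly K} := (u i 0)%:P.
pose phi := map_poly (horner_eval 0) (chart o al f).
have phiE z : phi.[z] = ev f (u + z *: o).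
  rewrite -[z in LHS](hornerC z 0) -/(horner_eval 0 z%:P) /phi horner_map /= /horner_eval.
  by rewrite horner_chart; apply: meval_eq => i; rewrite !hornerC !mxE.
have nz_phi : phi != 0.
  apply: contra_neq fo => /(congr1 (fun q : {poly K} => q`_e)); rewrite coef0 coef_map /=.
  by have [_ ->] := has_lead_chart o al fe; rewrite /horner_eval hornerC.
have [s phi_s] := closed_field_poly_normal phi; exists s => z; rewrite -phiE phi_s hornerZ.
move/eqP; rewrite mulf_eq0 lead_coef_eq0 (negPf nz_phi) /=.
by rewrite -/(root _ _) root_prod_XsubC.
Qed.

(** The form f may share components with F or with G, so the member F + c G is adapted to f.
    Components are never discussed: it suffices that f and F + c G have no common zero on one line
    through o. This line is chosen off the base points; f, which does not vanish at o, has finitely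
    many zeros on it, and a general c makes the member nonzero at each of them. *)
Theorem pencil_bezout (I : finType) (p : I -> proj_point K) (m n : I -> nat) (e d : nat)
    (f F G : {mpoly K[3]}) (base : seq 'cV[K]_3) :
  injective p -> f != 0 -> f \is e.-homog -> F \is d.-homog -> G \is d.-homog ->
  (forall v, v != 0 -> ev F v = 0 -> ev G v = 0 -> exists c, exists2 w, w \in base & v = c *: w) ->
  (forall i, ideal_exp (point_ideal (p i)) (m i) f) ->
  (forall i, ideal_exp (point_ideal (p i)) (n i) F) ->
  (forall i, ideal_exp (point_ideal (p i)) (n i) G) ->
  (\sum_i m i * n i <= e * d)%N.
Proof.
move=> inj_p nz_f fe Fd Gd base_FG fm Fn Gn.
pose vec i := point_vec (p i); have nz_vec i : vec i != 0 := point_vec_neq0 (p i).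
have vec_neq i j : i != j -> cross (vec i) (vec j) != 0.
  move=> ne_ij; apply: cross_ne0 => // c; apply: contra_neq ne_ij => e_ij.
  apply/inj_p/val_inj/eqP; rewrite eq_sym eqEdim (eqP (valP (p i))) (eqP (valP (p j))) leqnn.
  by rewrite andbT !point_line -memvE -/(vec j) e_ij memvZ ?memv_line.
pose base' : seq 'cV[K]_3 := [seq w <- base | w != 0]; pose W : seq 'cV[K]_3 := codom vec ++ base'.
have nz_W w : w \in W -> w != 0.
  by rewrite mem_cat => /orP[/codomP[i ->] //|]; rewrite mem_filter => /andP[].
have [perp perpP] : exists perp : 'cV[K]_3 -> 'cV[K]_3, forall w, perp w != 0 /\ dot (perp w) w = 0.
  by have /choice[perp ?] := exists_orthogonal; exists perp.
(* Nonorthogonality to these vectors keeps o off the points of W and off the lines joining two of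
   the p_i; the entry for 0 makes o itself nonzero. *)
pose S : seq 'cV[K]_3 := [seq perp w | w <- 0 :: W] ++
          [seq cross (vec ij.1) (vec ij.2) | ij <- enum {: I * I} & ij.1 != ij.2].
have S'0 : 0 \notin S.
  rewrite mem_cat negb_or; apply/andP; split; apply/mapP => -[w].
    by have [/eqP nz _] := perpP w => _ /esym.
  by rewrite mem_filter => /andP[/vec_neq/eqP nz _] /esym.
have [o [fo So]] := generic_vector nz_f S'0.
have oW w c : w \in 0 :: W -> o != c *: w.
  move=> Ww; apply/eqP => o_w; have /So : perp w \in S by rewrite mem_cat map_f.
  by rewrite o_w dotZr (perpP w).2 mulr0 eqxx.
have crossWo w : w \in W -> cross o w != 0.
  move=> Ww; have nz_w := nz_W _ Ww.
  rewrite crossN oppr_eq0; apply: cross_ne0 => // c; apply: oW; rewrite inE Ww orbT //.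
have [|a [_ Sa]] := @generic_vector K 1 (perp o :: [seq cross o w | w <- W]) (oner_neq0 _).
  rewrite inE negb_or eq_sym (perpP o).1; apply/mapP => -[w /crossWo/eqP nz /esym]; exact: nz.
have det_aow w : w \in W -> det3 a o w != 0.
  by move=> Ww; rewrite det3_rot; apply: Sa; rewrite inE map_f ?orbT.
have nz_o : o != 0 by have := oW 0 0 (mem_head _ _); rewrite scaler0.
have cross_ao : cross a o != 0.
  rewrite crossN oppr_eq0; apply: cross_ne0 => // c; apply/eqP => a_o.
  by have := Sa _ (mem_head _ _); rewrite a_o dotZr (perpP o).2 mulr0 eqxx.
have [|b [_ /(_ _ (mem_head _ _)) det_aob]] := @generic_vector K 1 [:: cross a o] (oner_neq0 _).
  by rewrite inE eq_sym.
rewrite -/(det3 a o b) in det_aob.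
have vecW i : vec i \in W by rewrite mem_cat codom_f.
(* In the frame a, o, b the vector of p_i is scaled to have coefficient 1 on b; x and z are its
   other two coordinates. *)
pose x i := det3 (vec i) o b / det3 a o (vec i).
pose z i := det3 a (vec i) b / det3 a o (vec i).
have p_xz i : b + x i *: a + z i *: o \in val (p i).
  have nz := det_aow _ (vecW i).
  suff -> : b + x i *: a + z i *: o = (det3 a o b / det3 a o (vec i)) *: vec i.
    by rewrite point_line memvZ ?memv_line.
  have -> : (det3 a o b / det3 a o (vec i)) *: vec i =
      (det3 a o (vec i))^-1 *: (det3 a o b *: vec i) by rewrite scalerA mulrC.
  rewrite (cramer3 a o b (vec i)) !scalerDr !scalerA [RHS]addrC.
  by rewrite mulVf // scale1r addrA /x /z ![_ / det3 a o (vec i)]mulrC.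
have inj_x : injective x.
  move=> i j e_ij; apply/eqP; apply: contraT => ne_ij.
  (* Equal abscissae would put o on the line joining the two points, which the choice of o
     excludes. *)
  have := det3_cramer2 a o b (vec i) (vec j).
  have -> : det3 (vec i) o b = x i * det3 a o (vec i) by rewrite divfK ?det_aow.
  have -> : det3 (vec j) o b = x j * det3 a o (vec j) by rewrite divfK ?det_aow.
  rewrite e_ij mulrAC subrr => /esym/eqP; rewrite mulf_eq0 (negPf det_aob) /=.
  rewrite det3_swap det3_rot oppr_eq0.
  suff /So/negPf -> : cross (vec i) (vec j) \in S by [].
  rewrite mem_cat; apply/orP; right; apply/mapP; exists (i, j) => //.
  by rewrite mem_filter ne_ij mem_enum.
(* The plane spanned by b + x0 a and o is the line X = x0; the excluded values are the abscissae of
   the base points. *)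
have [x0 s'x0] := seq_avoid [seq - det3 b o w / det3 a o w | w <- base'].
pose u := b + x0 *: a.
have det_auo z0 : det3 a o (u + z0 *: o) = det3 a o b.
  rewrite /u; have [a0 [a1 [a2 ->]]] := vec3P a; have [o0 [o1 [o2 ->]]] := vec3P o.
  have [b0 [b1 [b2 ->]]] := vec3P b.
  by rewrite /det3 !scale_vec3 !add_vec3 !cross_vec3 !dot_vec3; ring.
have det_uou z0 : det3 u o (u + z0 *: o) = 0 by apply: det3_line.
have det_uow w : det3 u o w = det3 b o w + x0 * det3 a o w.
  rewrite /u; have [a0 [a1 [a2 ->]]] := vec3P a; have [o0 [o1 [o2 ->]]] := vec3P o.
  have [b0 [b1 [b2 ->]]] := vec3P b; have [w0 [w1 [w2 ->]]] := vec3P w.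
  by rewrite /det3 !scale_vec3 !add_vec3 !cross_vec3 !dot_vec3; ring.
have no_base z0 : ev F (u + z0 *: o) = 0 -> ev G (u + z0 *: o) != 0.
  have nz_v : u + z0 *: o != 0.
    apply: contra_neq det_aob; rewrite -(det_auo z0) => ->.
    by rewrite -(scale0r 0) /det3 dotZr mul0r.
  move=> F0; apply/eqP => /(base_FG _ nz_v F0)[c [w base_w v_w]].
  have nz_w : w != 0 by apply: contraNneq nz_v => w0; rewrite v_w w0 scaler0.
  have nz_c : c != 0 by apply: contraNneq nz_v => c0; rewrite v_w c0 scale0r.
  have base'w : w \in base' by rewrite mem_filter nz_w.
  have nz_aow : det3 a o w != 0 by rewrite det_aow // mem_cat base'w orbT.
  have /eqP := det_uou z0; rewrite v_w /det3 dotZr mulf_eq0 (negPf nz_c) /= -/(det3 u o w) det_uow.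
  rewrite addr_eq0 => /eqP ebow; case/negP: s'x0; apply/mapP; exists w => //.
  by rewrite ebow opprK mulfK.
have no_base_o : ev F o = 0 -> ev G o != 0.
  move=> F0; apply/eqP => /(base_FG _ nz_o F0)[c [w base_w o_w]].
  have nz_w : w != 0 by apply: contraNneq nz_o => w0; rewrite o_w w0 scaler0.
  suff /(oW _ c) : w \in 0 :: W by rewrite o_w eqxx.
  by rewrite inE mem_cat mem_filter nz_w base_w !orbT.
have [rs rsP] := line_roots u fe fo.
have [|c cP] := @generic_combination F G (o :: [seq u + r *: o | r <- rs]).
  by move=> v; rewrite inE => /predU1P[->|/mapP[r _ ->]]; [apply: no_base_o|apply: no_base].
have FGd : F + c *: G \is d.-homog by rewrite rpredD ?rpredZ.
apply: (bezout (x0 := x0) fe FGd fo (cP _ (mem_head _ _)) inj_x p_xz fm) => [i|z0 v].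
  have Jl := @point_idealMl K (p i).
  by apply: ideal_expD => //; rewrite -mul_mpolyC; apply: ideal_expMl.
have vE g : g.@[v] = ev g (u + z0 *: o).
  by apply: meval_eq => i; rewrite /v !mxE [x0 * _]mulrC.
rewrite !vE => /rsP rs_z0; apply: cP; rewrite inE.
by apply/orP; right; apply/mapP; exists z0.
Qed.

End PencilBezout.

(** * Icosahedral forms and their orders at the singular points *)

Section TernaryForms.
Variable A : comNzRingType.

(** Coefficients are binary integers because they are far too large for unary numerals; a literal
    unfolds to a ring expression of logarithmic size, which [ring] can normalize. *)
Fixpoint pos_to_ring (p : positive) : A :=
  match p with
  | xH => 1
  | xO q => 2 * pos_to_ring q
  | xI q => 1 + 2 * pos_to_ring q
  end.

Definition Z_to_ring (z : Z) : A :=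
  match z with Z0 => 0 | Zpos p => pos_to_ring p | Zneg p => - pos_to_ring p end.

Definition ternary_eval (s : seq (Z * (nat * nat * nat))) (x y z : A) : A :=
  \sum_(t <- s) Z_to_ring t.1 * (x ^+ t.2.1.1 * y ^+ t.2.1.2 * z ^+ t.2.2).

End TernaryForms.

Lemma rmorph_Z_to_ring (A B : comNzRingType) (phi : {rmorphism A -> B}) z :
  phi (Z_to_ring A z) = Z_to_ring B z.
Proof.
have phiP p : phi (pos_to_ring A p) = pos_to_ring B p.
  by elim: p => [p IHp|p IHp|] /=; rewrite ?(rmorphD, rmorphM, rmorph1, rmorph_nat) ?IHp.
by case: z => [|p|p] /=; rewrite ?rmorph0 ?rmorphN ?phiP.
Qed.

Lemma rmorph_ternary_eval (A B : comNzRingType) (phi : {rmorphism A -> B}) s x y z :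
  phi (ternary_eval s x y z) = ternary_eval s (phi x) (phi y) (phi z).
Proof.
rewrite rmorph_sum; apply: eq_bigr => -[c [[i j] k]] _.
by rewrite !rmorphM !rmorphXn rmorph_Z_to_ring.
Qed.

Lemma pos_to_ring_gt0 (R : numDomainType) p : 0 < pos_to_ring R p.
Proof.
elim: p => [p IHp|p IHp|] /=; last exact: ltr01.
  by rewrite addr_gt0 ?ltr01 // mulr_gt0 ?ltr0n.
by rewrite mulr_gt0 ?ltr0n.
Qed.

(* A term (c, (i, j, k)) stands for c Q^i f^j g^k, where Q, f, g are the invariants of degrees
   2, 6, 10. At the quintuple, triple and double points the orders of vanishing are 10, 6, 4
   for P30, then 2, 6, 6 for C30, and 10, 14, 16 for F80; the coefficients were found by
   solving the corresponding linear conditions. *)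
Definition P30 : seq (Z * (nat * nat * nat)) := [::
    (Zpos 20, (9, 2, 0)); (Zneg 455, (6, 3, 0)); (Zpos 3440, (3, 4, 0));
    (Zneg 8640, (0, 5, 0)); (Zpos 40, (7, 1, 1)); (Zneg 795, (4, 2, 1));
    (Zpos 3600, (1, 3, 1)); (Zpos 4, (5, 0, 2)); (Zneg 325, (2, 1, 2)); (Zneg 25, (0, 0, 3))]%N.

Definition C30 : seq (Z * (nat * nat * nat)) := [::
    (Zpos 2225, (6, 3, 0)); (Zneg 7600, (3, 4, 0)); (Zneg 21600, (0, 5, 0));
    (Zpos 915, (4, 2, 1)); (Zneg 720, (1, 3, 1)); (Zpos 119, (2, 1, 2)); (Zpos 5, (0, 0, 3))]%N.

Definition F80 : seq (Z * (nat * nat * nat)) := [::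
    (Zpos 339168125, (16, 8, 0)); (Zneg 9514800000, (13, 9, 0));
    (Zpos 108624000000, (10, 10, 0)); (Zneg 614553600000, (7, 11, 0));
    (Zpos 1633996800000, (4, 12, 0)); (Zneg 1433272320000, (1, 13, 0));
    (Zpos 359367000, (14, 7, 1)); (Zneg 8437984000, (11, 8, 1)); (Zpos 84962688000, (8, 9, 1));
    (Zneg 353949696000, (5, 10, 1)); (Zpos 352346112000, (2, 11, 1));
    (Zpos 225101100, (12, 6, 2)); (Zneg 2663222400, (9, 7, 2)); (Zpos 29577267200, (6, 8, 2));
    (Zneg 57408307200, (3, 9, 2)); (Zpos 14929920000, (0, 10, 2)); (Zpos 81106280, (10, 5, 3));
    (Zneg 428628480, (7, 6, 3)); (Zpos 4987729920, (4, 7, 3)); (Zneg 2820096000, (1, 8, 3));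
    (Zpos 17156654, (8, 4, 4)); (Zneg 39588992, (5, 5, 4)); (Zpos 394675200, (2, 6, 4));
    (Zpos 2189160, (6, 3, 5)); (Zneg 2067200, (3, 4, 5)); (Zpos 11750400, (0, 5, 5));
    (Zpos 166700, (4, 2, 6)); (Zneg 48000, (1, 3, 6)); (Zpos 7000, (2, 1, 7));
    (Zpos 125, (0, 0, 8))]%N.

Section Invariants.
Variables (A : comNzRingType) (w : A).
Hypothesis w2 : w * w = w + 1.

Definition inv2 (x y z : A) := x ^+ 2 + y ^+ 2 + z ^+ 2.

(* Up to a constant, the product of the planes orthogonal to the axes through the 6 quintuple
   (for [inv10], the 10 triple) points. The constants make the values at the singular points
   rational multiples of powers of [inv2]. *)
Definition inv6 (x y z : A) := (2 * w - 3) *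
  ((y ^+ 2 - w ^+ 2 * z ^+ 2) * (z ^+ 2 - w ^+ 2 * x ^+ 2) * (x ^+ 2 - w ^+ 2 * y ^+ 2)).

Definition inv10 (x y z : A) := (18 * w - 29) *
  ((x ^+ 2 - w ^+ 4 * z ^+ 2) * (y ^+ 2 - w ^+ 4 * x ^+ 2) * (z ^+ 2 - w ^+ 4 * y ^+ 2) *
   ((x + y + z) * (x + y - z) * (x - y + z) * (x - y - z))).

(** These play the part of the local dihedral invariants: they vanish to orders 2 and 5 at the
    quintuple points, and the next two to orders 2 and 3 at the triple points. At the double points
    f and g themselves have order 2. *)
Definition quint2 (Q f : A) := 5 * f - Q ^+ 3.
Definition quint5 (Q f g : A) :=
  25 * (Q * g) - Q ^+ 6 - 5 * Q ^+ 3 * quint2 Q f - 5 * quint2 Q f ^+ 2.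
Definition triple2 (Q f : A) := 27 * f + Q ^+ 3.
Definition triple3 (Q f g : A) := 243 * g - 75 * Q ^+ 5 + 55 * Q ^+ 2 * triple2 Q f.

Variable T : A.

Definition dvdX k x := exists q, x = T ^+ k * q.

Lemma dvdX_ternary_eval a b k s x y z : dvdX a y -> dvdX b z ->
  all (fun t => k <= a * t.2.1.2 + b * t.2.2)%N s -> dvdX k (ternary_eval s x y z).
Proof.
move=> [y' ->] [z' ->]; rewrite /ternary_eval.
elim: s => [|[c [[i j] l]] s IHs] /=; first by exists 0; rewrite big_nil mulr0.
move=> /andP[/subnKC le_k /IHs[q Eq]]; rewrite big_cons Eq /=.
exists (Z_to_ring A c * (x ^+ i * (T ^+ (a * j + b * l - k) * y' ^+ j * z' ^+ l)) + q).
have : T ^+ k * T ^+ (a * j + b * l - k) = T ^+ (a * j) * T ^+ (b * l) by rewrite -!exprD le_k.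
rewrite !exprMn -!exprM mulrDr => E; congr (_ + _); move: (T ^+ (a * j + b * l - k)) E => t E.
transitivity (Z_to_ring A c * x ^+ i * y' ^+ j * z' ^+ l * (T ^+ (a * j) * T ^+ (b * l))); first ring.
by rewrite -E; ring.
Qed.

(** Expansion near the point (1, w, 0), with T l and T m as transverse coordinates. The witnesses
    are the expanded quotients, reduced by w^2 = w + 1; large coefficients are split into thousands
    to keep numerals small. *)
Lemma quint_local l m a : let x := a in let y := w * a + T * l in let z := T * m in
  dvdX 2 (quint2 (inv2 x y z) (inv6 x y z)) /\
  dvdX 5 (quint5 (inv2 x y z) (inv6 x y z) (inv10 x y z)).
Proof.
move=> x y z; rewrite /quint5 /quint2 /inv2 /inv6 /inv10 /x /y /z; split.
  exists (
    - (16 + 8 * w) * a ^+ 4 * l ^+ 2 - (40 + 40 * w) * a ^+ 4 * m ^+ 2 - (32 * w) * a ^+ 3 * l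
    ^+ 3 * T - (32 + 96 * w) * a ^+ 3 * l * m ^+ 2 * T - (18 + 10 * w) * a ^+ 2 * l ^+ 4 * T ^+
    2 - (44 + 48 * w) * a ^+ 2 * l ^+ 2 * m ^+ 2 * T ^+ 2 + (4 + 2 * w) * a ^+ 2 * m ^+ 4 * T ^+
    2 - (6 * w) * a * l ^+ 5 * T ^+ 3 - (20 + 12 * w) * a * l ^+ 3 * m ^+ 2 * T ^+ 3 + (10 + 4 *
    w) * a * l * m ^+ 4 * T ^+ 3 - l ^+ 6 * T ^+ 4 + (2 - 5 * w) * l ^+ 4 * m ^+ 2 * T ^+ 4 - (3
    - 5 * w) * l ^+ 2 * m ^+ 4 * T ^+ 4 - m ^+ 6 * T ^+ 4).
  ring: w2.
exists (
    - (512 + 256 * w) * a ^+ 7 * l ^+ 5 + ((12 * 1000 + 800) + (12 * 1000 + 800) * w) * a ^+ 7 *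
    l ^+ 3 * m ^+ 2 - ((19 * 1000 + 200) + (25 * 1000 + 600) * w) * a ^+ 7 * l * m ^+ 4 + (320 -
    (1 * 1000 + 792) * w) * a ^+ 6 * l ^+ 6 * T + ((19 * 1000 + 840) + (54 * 1000 + 720) * w) *
    a ^+ 6 * l ^+ 4 * m ^+ 2 * T - ((40 * 1000 + 0) + (84 * 1000 + 800) * w) * a ^+ 6 * l ^+ 2 *
    m ^+ 4 * T + ((4 * 1000 + 800) + (6 * 1000 + 400) * w) * a ^+ 6 * m ^+ 6 * T - ((2 * 1000 +
    496) + 320 * w) * a ^+ 5 * l ^+ 7 * T ^+ 2 + ((53 * 1000 + 184) + (59 * 1000 + 520) * w) * a
    ^+ 5 * l ^+ 5 * m ^+ 2 * T ^+ 2 - ((75 * 1000 + 520) + (90 * 1000 + 560) * w) * a ^+ 5 * l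
    ^+ 3 * m ^+ 4 * T ^+ 2 + ((11 * 1000 + 200) + (20 * 1000 + 800) * w) * a ^+ 5 * l * m ^+ 6 *
    T ^+ 2 + (800 - (1 * 1000 + 680) * w) * a ^+ 4 * l ^+ 8 * T ^+ 3 + ((23 * 1000 + 680) + (55
    * 1000 + 680) * w) * a ^+ 4 * l ^+ 6 * m ^+ 2 * T ^+ 3 - ((31 * 1000 + 840) + (76 * 1000 +
    800) * w) * a ^+ 4 * l ^+ 4 * m ^+ 4 * T ^+ 3 + ((14 * 1000 + 80) + (23 * 1000 + 40) * w) *
    a ^+ 4 * l ^+ 2 * m ^+ 6 * T ^+ 3 - ((1 * 1000 + 200) + (1 * 1000 + 200) * w) * a ^+ 4 * m
    ^+ 8 * T ^+ 3 - 720 * a ^+ 3 * l ^+ 9 * T ^+ 4 + ((17 * 1000 + 280) + (21 * 1000 + 120) * w)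
    * a ^+ 3 * l ^+ 7 * m ^+ 2 * T ^+ 4 - ((23 * 1000 + 840) + (27 * 1000 + 40) * w) * a ^+ 3 *
    l ^+ 5 * m ^+ 4 * T ^+ 4 + ((9 * 1000 + 600) + (12 * 1000 + 160) * w) * a ^+ 3 * l ^+ 3 * m
    ^+ 6 * T ^+ 4 - (160 + (2 * 1000 + 480) * w) * a ^+ 3 * l * m ^+ 8 * T ^+ 4 + (28 - 116 * w)
    * a ^+ 2 * l ^+ 10 * T ^+ 5 + ((3 * 1000 + 300) + (6 * 1000 + 480) * w) * a ^+ 2 * l ^+ 8 *
    m ^+ 2 * T ^+ 5 - ((4 * 1000 + 80) + (8 * 1000 + 920) * w) * a ^+ 2 * l ^+ 6 * m ^+ 4 * T ^+
    5 + ((2 * 1000 + 440) + (4 * 1000 + 200) * w) * a ^+ 2 * l ^+ 4 * m ^+ 6 * T ^+ 5 - ((1 *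
    1000 + 620) + 240 * w) * a ^+ 2 * l ^+ 2 * m ^+ 8 * T ^+ 5 + (88 + 44 * w) * a ^+ 2 * m ^+
    10 * T ^+ 5 - (12 * w) * a * l ^+ 11 * T ^+ 6 + (500 + 940 * w) * a * l ^+ 9 * m ^+ 2 * T ^+
    6 - (600 + (1 * 1000 + 520) * w) * a * l ^+ 7 * m ^+ 4 * T ^+ 6 + ((1 * 1000 + 80) * w) * a
    * l ^+ 5 * m ^+ 6 * T ^+ 6 + (300 - 460 * w) * a * l ^+ 3 * m ^+ 8 * T ^+ 6 - (100 - 88 * w)
    * a * l * m ^+ 10 * T ^+ 6 - l ^+ 12 * T ^+ 7 + (44 + 50 * w) * l ^+ 10 * m ^+ 2 * T ^+ 7 -
    (115 + 75 * w) * l ^+ 8 * m ^+ 4 * T ^+ 7 + 180 * l ^+ 6 * m ^+ 6 * T ^+ 7 - (190 - 75 * w)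
    * l ^+ 4 * m ^+ 8 * T ^+ 7 + (94 - 50 * w) * l ^+ 2 * m ^+ 10 * T ^+ 7 - m ^+ 12 * T ^+ 7).
ring: w2.
Qed.

(** The point is (1, 0, w^2), proportional to the listed triple point (w - 1, 0, w). *)
Lemma triple_local l m a : let x := a in let y := T * l in let z := w ^+ 2 * a + T * m in
  dvdX 2 (triple2 (inv2 x y z) (inv6 x y z)) /\
  dvdX 3 (triple3 (inv2 x y z) (inv6 x y z) (inv10 x y z)).
Proof.
move=> x y z; rewrite /triple3 /triple2 /inv2 /inv6 /inv10 /x /y /z; split.
  exists (
    (432 + 648 * w) * a ^+ 4 * l ^+ 2 + (72 + 72 * w) * a ^+ 4 * m ^+ 2 + (720 + (1 * 1000 +
    296) * w) * a ^+ 3 * l ^+ 2 * m * T + (112 + 64 * w) * a ^+ 3 * m ^+ 3 * T - (18 + 18 * w) *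
    a ^+ 2 * l ^+ 4 * T ^+ 2 + (420 + 864 * w) * a ^+ 2 * l ^+ 2 * m ^+ 2 * T ^+ 2 + (60 + 18 *
    w) * a ^+ 2 * m ^+ 4 * T ^+ 2 + (6 - 48 * w) * a * l ^+ 4 * m * T ^+ 3 + (120 + 228 * w) * a
    * l ^+ 2 * m ^+ 3 * T ^+ 3 + (6 + 6 * w) * a * m ^+ 5 * T ^+ 3 + l ^+ 6 * T ^+ 4 + (30 - 27
    * w) * l ^+ 4 * m ^+ 2 * T ^+ 4 + (3 + 27 * w) * l ^+ 2 * m ^+ 4 * T ^+ 4 + m ^+ 6 * T ^+ 4).
  ring: w2.
exists (
    ((912 * 1000 + 384) + ((1 * 1000 + 492) * 1000 + 992) * w) * a ^+ 7 * l ^+ 2 * m - ((36 *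
    1000 + 864) + (64 * 1000 + 512) * w) * a ^+ 7 * m ^+ 3 + ((648 * 1000 + 0) + ((1 * 1000 +
    36) * 1000 + 800) * w) * a ^+ 6 * l ^+ 4 * T + (((2 * 1000 + 301) * 1000 + 696) + ((3 * 1000
    + 742) * 1000 + 848) * w) * a ^+ 6 * l ^+ 2 * m ^+ 2 * T - ((71 * 1000 + 616) + (136 * 1000
    + 128) * w) * a ^+ 6 * m ^+ 4 * T + (((1 * 1000 + 351) * 1000 + 296) + ((2 * 1000 + 170) *
    1000 + 368) * w) * a ^+ 5 * l ^+ 4 * m * T ^+ 2 + (((2 * 1000 + 477) * 1000 + 568) + ((4 *
    1000 + 11) * 1000 + 264) * w) * a ^+ 5 * l ^+ 2 * m ^+ 3 * T ^+ 2 - ((56 * 1000 + 704) +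
    (122 * 1000 + 752) * w) * a ^+ 5 * m ^+ 5 * T ^+ 2 - ((66 * 1000 + 240) + (99 * 1000 + 360)
    * w) * a ^+ 4 * l ^+ 6 * T ^+ 3 + (((1 * 1000 + 208) * 1000 + 160) + ((1 * 1000 + 925) *
    1000 + 280) * w) * a ^+ 4 * l ^+ 4 * m ^+ 2 * T ^+ 3 + (((1 * 1000 + 449) * 1000 + 440) +
    ((2 * 1000 + 382) * 1000 + 720) * w) * a ^+ 4 * l ^+ 2 * m ^+ 4 * T ^+ 3 - ((23 * 1000 +
    680) + (60 * 1000 + 960) * w) * a ^+ 4 * m ^+ 6 * T ^+ 3 - ((83 * 1000 + 424) + (117 * 1000
    + 792) * w) * a ^+ 3 * l ^+ 6 * m * T ^+ 4 + ((586 * 1000 + 720) + (928 * 1000 + 960) * w) *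
    a ^+ 3 * l ^+ 4 * m ^+ 3 * T ^+ 4 + ((489 * 1000 + 728) + (847 * 1000 + 904) * w) * a ^+ 3 *
    l ^+ 2 * m ^+ 5 * T ^+ 4 - ((5 * 1000 + 24) + (18 * 1000 + 272) * w) * a ^+ 3 * m ^+ 7 * T
    ^+ 4 + ((1 * 1000 + 860) + (1 * 1000 + 860) * w) * a ^+ 2 * l ^+ 8 * T ^+ 5 - ((42 * 1000 +
    544) + (51 * 1000 + 552) * w) * a ^+ 2 * l ^+ 6 * m ^+ 2 * T ^+ 5 + ((162 * 1000 + 960) +
    (256 * 1000 + 680) * w) * a ^+ 2 * l ^+ 4 * m ^+ 4 * T ^+ 5 + ((96 * 1000 + 816) + (179 *
    1000 + 88) * w) * a ^+ 2 * l ^+ 2 * m ^+ 6 * T ^+ 5 - (172 + (3 * 1000 + 456) * w) * a ^+ 2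
    * m ^+ 8 * T ^+ 5 + ((1 * 1000 + 744) + 232 * w) * a * l ^+ 8 * m * T ^+ 6 - ((1 * 1000 +
    664) + (16 * 1000 + 352) * w) * a * l ^+ 6 * m ^+ 3 * T ^+ 6 + ((19 * 1000 + 536) + (41 *
    1000 + 568) * w) * a * l ^+ 4 * m ^+ 5 * T ^+ 6 + ((13 * 1000 + 24) + (19 * 1000 + 72) * w)
    * a * l ^+ 2 * m ^+ 7 * T ^+ 6 - (200 + 200 * w) * a * m ^+ 9 * T ^+ 6 - 20 * l ^+ 10 * T ^+
    7 + ((1 * 1000 + 628) - 756 * w) * l ^+ 8 * m ^+ 2 * T ^+ 7 + ((3 * 1000 + 256) - (3 * 1000
    + 672) * w) * l ^+ 6 * m ^+ 4 * T ^+ 7 - (416 - (3 * 1000 + 672) * w) * l ^+ 4 * m ^+ 6 * T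
    ^+ 7 + (872 + 756 * w) * l ^+ 2 * m ^+ 8 * T ^+ 7 - 20 * m ^+ 10 * T ^+ 7).
ring: w2.
Qed.

(** At (0, 0, 1) one quadratic factor of each product involves x and y only, and it provides the
    T^2. *)
Lemma double_local l m a : let x := T * l in let y := T * m in
  dvdX 2 (inv6 x y a) /\ dvdX 2 (inv10 x y a).
Proof.
move=> x y; rewrite /inv6 /inv10 /x /y; split.
  by exists ((2 * w - 3) * (((T * m) ^+ 2 - w ^+ 2 * a ^+ 2) * (a ^+ 2 - w ^+ 2 * (T * l) ^+ 2) *
    (l ^+ 2 - w ^+ 2 * m ^+ 2))); ring.
exists ((18 * w - 29) * (((T * l) ^+ 2 - w ^+ 4 * a ^+ 2) * (m ^+ 2 - w ^+ 4 * l ^+ 2) *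
  (a ^+ 2 - w ^+ 4 * (T * m) ^+ 2) *
  ((T * l + T * m + a) * (T * l + T * m - a) * (T * l - T * m + a) * (T * l - T * m - a)))).
ring.
Qed.

Variables Q f g : A.

(** Solving for f and g in terms of [quint2] and [quint5] introduces denominators 5 and 25 Q; the
    factor 5^4 Q^3 clears them, P30 being cubic in g. Every monomial of s, with exponents j and k of
    the local invariants, satisfies 2 j + 5 k >= 10. *)
Lemma P30_quint : dvdX 2 (quint2 Q f) -> dvdX 5 (quint5 Q f g) ->
  dvdX 10 (Z_to_ring A (Zpos 625) * Q ^+ 3 * ternary_eval P30 Q f g).
Proof.
move=> u v; pose s : seq (Z * (nat * nat * nat)) := [::
    (Zneg 1, (0, 0, 3)); (Zneg 15, (0, 2, 2)); (Zneg 75, (0, 4, 1)); (Zneg 125, (0, 6, 0));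
    (Zneg 80, (3, 1, 2)); (Zneg 80, (3, 3, 1)); (Zneg 128, (3, 5, 0)); (Zneg 64, (6, 0, 2))]%N.
suff -> : Z_to_ring A (Zpos 625) * Q ^+ 3 * ternary_eval P30 Q f g =
    ternary_eval s Q (quint2 Q f) (quint5 Q f g) by apply: dvdX_ternary_eval u v _.
by rewrite /ternary_eval /s /P30 !big_cons !big_nil /= /quint5 /quint2; ring.
Qed.

(** No power of Q is inverted here: the denominators are 27 and 243, and 3^15 = 243^3 clears
    them. *)
Lemma P30_triple : dvdX 2 (triple2 Q f) -> dvdX 3 (triple3 Q f g) ->
  dvdX 6 (Z_to_ring A (Zpos 14348907) * ternary_eval P30 Q f g).
Proof.
move=> u v; pose s : seq (Z * (nat * nat * nat)) := [::
    (Zneg 25, (0, 0, 3)); (Zneg 8640, (0, 5, 0)); (Zpos 10800, (1, 3, 1));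
    (Zpos 1200, (2, 1, 2)); (Zneg 457920, (3, 4, 0)); (Zneg 1920, (4, 2, 1));
    (Zneg 1728, (5, 0, 2)); (Zpos 655360, (6, 3, 0))]%N.
suff -> : Z_to_ring A (Zpos 14348907) * ternary_eval P30 Q f g =
    ternary_eval s Q (triple2 Q f) (triple3 Q f g) by apply: dvdX_ternary_eval u v _.
by rewrite /ternary_eval /s /P30 !big_cons !big_nil /= /triple3 /triple2; ring.
Qed.

Lemma P30_double : dvdX 2 f -> dvdX 2 g -> dvdX 4 (ternary_eval P30 Q f g).
Proof. by move=> u v; apply: dvdX_ternary_eval u v _. Qed.

Lemma C30_quint : dvdX 2 (quint2 Q f) -> dvdX 5 (quint5 Q f g) ->
  dvdX 2 (Z_to_ring A (Zpos 3125) * Q ^+ 3 * ternary_eval C30 Q f g).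
Proof.
move=> u v; pose s : seq (Z * (nat * nat * nat)) := [::
    (Zpos 1, (0, 0, 3)); (Zpos 15, (0, 2, 2)); (Zpos 75, (0, 4, 1)); (Zpos 125, (0, 6, 0));
    (Zpos 134, (3, 1, 2)); (Zpos 620, (3, 3, 1)); (Zneg 21850, (3, 5, 0));
    (Zpos 122, (6, 0, 2)); (Zpos 4900, (6, 2, 1)); (Zneg 128150, (6, 4, 0));
    (Zpos 8448, (9, 1, 1)); (Zneg 255680, (9, 3, 0)); (Zpos 4096, (12, 0, 1));
    (Zneg 215040, (12, 2, 0)); (Zneg 65536, (15, 1, 0))]%N.
suff -> : Z_to_ring A (Zpos 3125) * Q ^+ 3 * ternary_eval C30 Q f g =
    ternary_eval s Q (quint2 Q f) (quint5 Q f g) by apply: dvdX_ternary_eval u v _.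
by rewrite /ternary_eval /s /C30 !big_cons !big_nil /= /quint5 /quint2; ring.
Qed.

Lemma C30_triple : dvdX 2 (triple2 Q f) -> dvdX 3 (triple3 Q f g) ->
  dvdX 6 (Z_to_ring A (Zpos 14348907) * ternary_eval C30 Q f g).
Proof.
move=> u v; pose s : seq (Z * (nat * nat * nat)) := [::
    (Zpos 5, (0, 0, 3)); (Zneg 21600, (0, 5, 0)); (Zneg 2160, (1, 3, 1));
    (Zpos 246, (2, 1, 2)); (Zpos 21600, (3, 4, 0)); (Zpos 8160, (4, 2, 1));
    (Zpos 54, (5, 0, 2)); (Zpos 40000, (6, 3, 0))]%N.
suff -> : Z_to_ring A (Zpos 14348907) * ternary_eval C30 Q f g =
    ternary_eval s Q (triple2 Q f) (triple3 Q f g) by apply: dvdX_ternary_eval u v _.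
by rewrite /ternary_eval /s /C30 !big_cons !big_nil /= /triple3 /triple2; ring.
Qed.

Lemma C30_double : dvdX 2 f -> dvdX 2 g -> dvdX 6 (ternary_eval C30 Q f g).
Proof. by move=> u v; apply: dvdX_ternary_eval u v _. Qed.

(** F80 has degree 8 in g, whence the multiplier Q^8; the numerical factor is 5^13. *)
Lemma F80_quint : dvdX 2 (quint2 Q f) -> dvdX 5 (quint5 Q f g) ->
  dvdX 10 (Z_to_ring A (Zpos 1220703125) * Q ^+ 8 * ternary_eval F80 Q f g).
Proof.
move=> u v; pose s : seq (Z * (nat * nat * nat)) := [::
    (Zpos 1, (0, 0, 8)); (Zpos 40, (0, 2, 7)); (Zpos 700, (0, 4, 6)); (Zpos 7000, (0, 6, 5));
    (Zpos 43750, (0, 8, 4)); (Zpos 175000, (0, 10, 3)); (Zpos 437500, (0, 12, 2));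
    (Zpos 625000, (0, 14, 1)); (Zpos 390625, (0, 16, 0)); (Zpos 320, (3, 1, 7));
    (Zpos 9280, (3, 3, 6)); (Zpos 580416, (3, 5, 5)); (Zpos 12430400, (3, 7, 4));
    (Zpos 119704000, (3, 9, 3)); (Zpos 590520000, (3, 11, 2)); (Zpos 1467800000, (3, 13, 1));
    (Zpos 1463800000, (3, 15, 0)); (Zpos 288, (6, 0, 7)); (Zpos 48160, (6, 2, 6));
    (Zpos 3172640, (6, 4, 5)); (Zpos 153201440, (6, 6, 4)); (Zpos 1820949600, (6, 8, 3));
    (Zpos 10853212000, (6, 10, 2)); (Zpos 39518620000, (6, 12, 1));
    (Zpos 67315100000, (6, 14, 0)); (Zpos 72960, (9, 1, 6)); (Zpos 8394240, (9, 3, 5));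
    (Zpos 666563328, (9, 5, 4)); (Zpos 13586887680, (9, 7, 3)); (Zpos 77618860800, (9, 9, 2));
    (Zpos 447795648000, (9, 11, 1)); (Zpos 172085280000, (9, 13, 0)); (Zpos 33408, (12, 0, 6));
    (Zpos 11992320, (12, 2, 5)); (Zpos 1511039360, (12, 4, 4)); (Zpos 53807183360, (12, 6, 3));
    (Zpos 378579260800, (12, 8, 2)); (Zpos 2263168544000, (12, 10, 1));
    (Zneg 956362480000, (12, 12, 0)); (Zpos 8637440, (15, 1, 5));
    (Zpos 2016680960, (15, 3, 4)); (Zpos 125253302272, (15, 5, 3));
    (Zpos 1323921111040, (15, 7, 2)); (Zpos 6292576025600, (15, 9, 1));
    (Zneg 6177905792000, (15, 11, 0)); (Zpos 2440192, (18, 0, 5));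
    (Zpos 1611596800, (18, 2, 4)); (Zpos 182452541440, (18, 4, 3));
    (Zpos 3187199805440, (18, 6, 2)); (Zpos 10692806732800, (18, 8, 1));
    (Zneg 15461072768000, (18, 10, 0)); (Zpos 717045760, (21, 1, 4));
    (Zpos 169832202240, (21, 3, 3)); (Zpos 5206223863808, (21, 5, 2));
    (Zpos 11611719024640, (21, 7, 1)); (Zneg 21981049651200, (21, 9, 0));
    (Zpos 136839168, (24, 0, 4)); (Zpos 98846638080, (24, 2, 3));
    (Zpos 5755527823360, (24, 4, 2)); (Zpos 8092448194560, (24, 6, 1));
    (Zneg 19241002598400, (24, 8, 0)); (Zpos 32967229440, (27, 1, 3));
    (Zpos 4252143452160, (27, 3, 2)); (Zpos 3491372204032, (27, 5, 1));
    (Zneg 10323356549120, (27, 7, 0)); (Zpos 4831838208, (30, 0, 3));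
    (Zpos 2017963540480, (30, 2, 2)); (Zpos 842887331840, (30, 4, 1));
    (Zneg 3129957416960, (30, 6, 0)); (Zpos 558345748480, (33, 1, 2));
    (Zpos 85899345920, (33, 3, 1)); (Zneg 412316860416, (33, 5, 0));
    (Zpos 68719476736, (36, 0, 2))]%N.
suff -> : Z_to_ring A (Zpos 1220703125) * Q ^+ 8 * ternary_eval F80 Q f g =
    ternary_eval s Q (quint2 Q f) (quint5 Q f g) by apply: dvdX_ternary_eval u v _.
by rewrite /ternary_eval /s /F80 !big_cons !big_nil /= /quint5 /quint2; ring.
Qed.

(** The multiplier is 3^40 = 243^8, and the weights 2 j + 3 k of the new monomials are all at least
    14. *)
Lemma F80_triple : dvdX 2 (triple2 Q f) -> dvdX 3 (triple3 Q f g) ->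
  dvdX 14 (Z_to_ring A (Zpos 12157665459056928801) * ternary_eval F80 Q f g).
Proof.
move=> u v; pose s : seq (Z * (nat * nat * nat)) := [::
    (Zpos 125, (0, 0, 8)); (Zpos 11750400, (0, 5, 5)); (Zpos 14929920000, (0, 10, 2));
    (Zneg 144000, (1, 3, 6)); (Zneg 8460288000, (1, 8, 3)); (Zneg 4299816960000, (1, 13, 0));
    (Zpos 8000, (2, 1, 7)); (Zpos 320716800, (2, 6, 4)); (Zpos 1528823808000, (2, 11, 1));
    (Zneg 67046400, (3, 4, 5)); (Zneg 303375974400, (3, 9, 2)); (Zpos 267200, (4, 2, 6));
    (Zpos 45681131520, (4, 7, 3)); (Zpos 59003043840000, (4, 12, 0)); (Zpos 12000, (5, 0, 7));
    (Zneg 1554425856, (5, 5, 4)); (Zneg 8504082432000, (5, 10, 1));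
    (Zpos 110858240, (6, 3, 5)); (Zpos 1372203417600, (6, 8, 2)); (Zpos 1017600, (7, 1, 6));
    (Zneg 87431086080, (7, 6, 3)); (Zneg 236808437760000, (7, 11, 0));
    (Zpos 1720999424, (8, 4, 4)); (Zpos 20497563648000, (8, 9, 1)); (Zneg 67576320, (9, 2, 5));
    (Zneg 2424641126400, (9, 7, 2)); (Zpos 259200, (10, 0, 6)); (Zpos 46441349120, (10, 5, 3));
    (Zpos 453595299840000, (10, 10, 0)); (Zneg 872411136, (11, 3, 4));
    (Zneg 23544594432000, (11, 8, 1)); (Zpos 79211520, (12, 1, 5));
    (Zpos 1544593817600, (12, 6, 2)); (Zpos 6587473920, (13, 4, 3));
    (Zneg 458095656960000, (13, 9, 0)); (Zpos 2035943424, (14, 2, 4));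
    (Zpos 7872708608000, (14, 7, 1)); (Zneg 11197440, (15, 0, 5));
    (Zneg 235177574400, (15, 5, 2)); (Zpos 19581419520, (16, 3, 3));
    (Zpos 221262848000000, (16, 8, 0)); (Zneg 250822656, (17, 1, 4));
    (Zpos 3429580800000, (17, 6, 1)); (Zpos 255467520000, (18, 4, 2));
    (Zneg 31457280000000, (19, 7, 0))]%N.
suff -> : Z_to_ring A (Zpos 12157665459056928801) * ternary_eval F80 Q f g =
    ternary_eval s Q (triple2 Q f) (triple3 Q f g) by apply: dvdX_ternary_eval u v _.
by rewrite /ternary_eval /s /F80 !big_cons !big_nil /= /triple3 /triple2; ring.
Qed.

Lemma F80_double : dvdX 2 f -> dvdX 2 g -> dvdX 16 (ternary_eval F80 Q f g).
Proof. by move=> u v; apply: dvdX_ternary_eval u v _. Qed.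

End Invariants.

Lemma rmorph_inv2 (A B : comNzRingType) (phi : {rmorphism A -> B}) x y z :
  phi (inv2 x y z) = inv2 (phi x) (phi y) (phi z).
Proof. by rewrite /inv2 !rmorphD !rmorphXn. Qed.

Lemma rmorph_inv6 (A B : comNzRingType) (phi : {rmorphism A -> B}) w x y z :
  phi (inv6 w x y z) = inv6 (phi w) (phi x) (phi y) (phi z).
Proof. by rewrite /inv6 !(rmorph_nat, rmorphXn, rmorphB, rmorphM, rmorphD). Qed.

Lemma rmorph_inv10 (A B : comNzRingType) (phi : {rmorphism A -> B}) w x y z :
  phi (inv10 w x y z) = inv10 (phi w) (phi x) (phi y) (phi z).
Proof. by rewrite /inv10 !(rmorph_nat, rmorphXn, rmorphB, rmorphM, rmorphD). Qed.

(** * Symmetries of the invariants, carrying the local expansions to all the points *)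

Section Symmetries.
Variables (A : comNzRingType) (w h : A).
Hypotheses (w2 : w * w = w + 1) (h2 : 2 * h = 1).

Lemma inv2_rot x y z : inv2 y z x = inv2 x y z :> A.
Proof. by rewrite /inv2; ring. Qed.

Lemma inv6_rot x y z : inv6 w y z x = inv6 w x y z.
Proof. by rewrite /inv6; ring. Qed.

Lemma inv10_rot x y z : inv10 w y z x = inv10 w x y z.
Proof. by rewrite /inv10; ring. Qed.

Lemma inv2N x y z : inv2 (- x) y z = inv2 x y z :> A.
Proof. by rewrite /inv2; ring. Qed.

Lemma inv6N x y z : inv6 w (- x) y z = inv6 w x y z.
Proof. by rewrite /inv6; ring. Qed.

Lemma inv10N x y z : inv10 w (- x) y z = inv10 w x y z.
Proof. by rewrite /inv10; ring. Qed.

(* h = 1/2, and (w, 1, w - 1) has norm 4. *)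
Definition refl_coef x y z := h * (w * x + y + (w - 1) * z).

Lemma inv_refl x y z (c := refl_coef x y z) :
  [/\ inv2 (x - c * w) (y - c) (z - c * (w - 1)) = inv2 x y z,
      inv6 w (x - c * w) (y - c) (z - c * (w - 1)) = inv6 w x y z &
      inv10 w (x - c * w) (y - c) (z - c * (w - 1)) = inv10 w x y z].
Proof.
have e : 2 * c = w * x + y + (w - 1) * z by rewrite /c /refl_coef mulrA h2 mul1r.
(* Eliminating y, rather than expanding c, keeps the factor h out of the identities. *)
have -> : y = 2 * c - w * x - (w - 1) * z by rewrite e; ring.
move: c e => c _; rewrite /inv2 /inv6 /inv10; split; ring: w2.
Qed.

End Symmetries.

Section PointLists.
Variables (A : nzRingType) (w : A).

Definition quintuple_points : seq (A * A * A) :=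
  [:: (1, w, 0); (1, - w, 0); (0, 1, w); (0, 1, - w); (w, 0, 1); (- w, 0, 1)].

Definition triple_points : seq (A * A * A) :=
  [:: (1, 1, 1); (-1, 1, 1); (1, -1, 1); (1, 1, -1);
      (w, w - 1, 0); (- w, w - 1, 0); (0, w, w - 1); (0, - w, w - 1);
      (w - 1, 0, w); (w - 1, 0, - w)].

Definition double_points : seq (A * A * A) :=
  [:: (1, 0, 0); (0, 1, 0); (0, 0, 1);
      (w, 1, w - 1); (- w, 1, w - 1); (w, -1, w - 1); (w, 1, 1 - w);
      (w - 1, w, 1); (w - 1, - w, 1); (w - 1, w, -1); (1 - w, w, 1);
      (1, w - 1, w); (1, w - 1, - w); (-1, w - 1, w); (1, 1 - w, w)].

End PointLists.

Section MapPoints.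
Variables (A B : nzRingType) (phi : {rmorphism A -> B}) (w : A).
Let map3 (P : A * A * A) := (phi P.1.1, phi P.1.2, phi P.2).

Lemma map_quintuple_points P : P \in quintuple_points w -> map3 P \in quintuple_points (phi w).
Proof.
move/(map_f map3); congr (_ \in _).
by rewrite /quintuple_points /map3 /= !(rmorph0, rmorph1, rmorphN).
Qed.

Lemma map_triple_points P : P \in triple_points w -> map3 P \in triple_points (phi w).
Proof.
move/(map_f map3); congr (_ \in _).
by rewrite /triple_points /map3 /= !(rmorph0, rmorph1, rmorphN, rmorphB).
Qed.

Lemma map_double_points P : P \in double_points w -> map3 P \in double_points (phi w).
Proof.
move/(map_f map3); congr (_ \in _).
by rewrite /double_points /map3 /= !(rmorph0, rmorph1, rmorphN, rmorphB).
Qed.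

End MapPoints.

Section LocalConditions.
Variables (A : comNzRingType) (w h T : A).
Hypotheses (w2 : w * w = w + 1) (h2 : 2 * h = 1).

Definition local_quint Q f g := dvdX T 2 (quint2 Q f) /\ dvdX T 5 (quint5 Q f g).
Definition local_triple Q f g := dvdX T 2 (triple2 Q f) /\ dvdX T 3 (triple3 Q f g).
Definition local_double (Q f g : A) := dvdX T 2 f /\ dvdX T 2 g.

Definition holds_at (P : A -> A -> A -> Prop) x y z := P (inv2 x y z) (inv6 w x y z) (inv10 w x y z).
Variable P : A -> A -> A -> Prop.

Lemma holds_at_rot x y z : holds_at P y z x -> holds_at P x y z.
Proof. by rewrite /holds_at inv2_rot inv6_rot inv10_rot. Qed.

Lemma holds_atN x y z : holds_at P (- x) y z -> holds_at P x y z.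
Proof. by rewrite /holds_at inv2N inv6N inv10N. Qed.

Lemma holds_at_refl x y z c : c = refl_coef w h x y z ->
  holds_at P (x - c * w) (y - c) (z - c * (w - 1)) -> holds_at P x y z.
Proof. by move=> ->; rewrite /holds_at; have [-> -> ->] := inv_refl w2 h2 x y z. Qed.

End LocalConditions.

Section NearPoints.
Variables (A : comNzRingType) (w h T : A).
Hypotheses (w2 : w * w = w + 1) (h2 : 2 * h = 1).

(* The coordinates of points congruent to p modulo T, up to a scalar. *)
Definition near (p : A * A * A) x y z := exists lam v1 v2 v3,
  [/\ x = lam * p.1.1 + T * v1, y = lam * p.1.2 + T * v2 & z = lam * p.2 + T * v3].

Definition local_on P p := forall x y z, near p x y z -> holds_at w P x y z.

Lemma local_on_rot P a b c : local_on P (b, c, a) -> local_on P (a, b, c).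
Proof.
move=> H x y z [lam [v1 [v2 [v3 [-> -> ->]]]]]; apply: holds_at_rot; apply: H; rewrite /near.
by exists lam, v2, v3, v1.
Qed.

Lemma local_onN P a b c : local_on P (a, b, c) -> local_on P (- a, b, c).
Proof.
move=> H x y z [lam [v1 [v2 [v3 [-> -> ->]]]]]; apply: holds_atN; apply: H; rewrite /near.
by exists lam, (- v1), v2, v3; split=> //=; ring.
Qed.

Lemma local_onN2 P a b c : local_on P (a, b, c) -> local_on P (a, - b, c).
Proof. by move=> H; apply: local_on_rot; apply: local_onN; do 2!apply: local_on_rot. Qed.

Lemma local_onN3 P a b c : local_on P (a, b, c) -> local_on P (a, b, - c).
Proof. by move=> H; do 2!apply: local_on_rot; apply: local_onN; apply: local_on_rot. Qed.

Lemma local_on_refl P a b c (r := refl_coef w h a b c) :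
  local_on P (a - r * w, b - r, c - r * (w - 1)) -> local_on P (a, b, c).
Proof.
move=> H x y z [lam [v1 [v2 [v3 [-> -> ->]]]]]; apply: (holds_at_refl w2 h2 (erefl _)).
pose s := refl_coef w h v1 v2 v3.
apply: H; exists lam, (v1 - s * w), (v2 - s), (v3 - s * (w - 1)).
by rewrite /s /r /refl_coef /=; split; ring.
Qed.

Lemma local_on_scale P k a b c : local_on P (a, b, c) -> local_on P (k * a, k * b, k * c).
Proof.
move=> H x y z [lam [v1 [v2 [v3 [-> -> ->]]]]]; apply: H; exists (lam * k), v1, v2, v3.
by rewrite /= !mulrA.
Qed.

Lemma local_on_quintuple p : p \in quintuple_points w -> local_on (local_quint T) p.
Proof.
have base : local_on (local_quint T) (1, w, 0).
  move=> x y z [lam [v1 [v2 [v3 /= [-> -> ->]]]]]; rewrite /holds_at.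
  (* The deviation of the first coordinate is absorbed into the scalar, which leaves two transverse
     coordinates. *)
  have := quint_local w2 T (v2 - w * v1) v3 (lam + T * v1); cbv zeta.
  have -> : w * (lam + T * v1) + T * (v2 - w * v1) = lam * w + T * v2 by ring.
  by rewrite mulr1 mulr0 add0r.
have base1 : local_on (local_quint T) (0, 1, w) by apply: local_on_rot.
have base2 : local_on (local_quint T) (w, 0, 1) by apply: local_on_rot.
rewrite !inE; do 5?[case/orP] => /eqP -> //.
- exact: local_onN2.
- exact: local_onN3.
- exact: local_onN.
Qed.

Lemma local_on_triple p : p \in triple_points w -> local_on (local_triple T) p.
Proof.
have base3 : local_on (local_triple T) (w - 1, 0, w).
  have -> : (w - 1, 0, w) = ((w - 1) * 1, (w - 1) * 0, (w - 1) * w ^+ 2).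
    by congr (_, _, _); ring: w2.
  apply: local_on_scale.
  move=> x y z [lam [v1 [v2 [v3 /= [-> -> ->]]]]]; rewrite /holds_at.
  have := triple_local w2 T v2 (v3 - w ^+ 2 * v1) (lam + T * v1); cbv zeta.
  have -> : w ^+ 2 * (lam + T * v1) + T * (v3 - w ^+ 2 * v1) = lam * w ^+ 2 + T * v3 by ring.
  by rewrite mulr1 mulr0 add0r.
have base1 : local_on (local_triple T) (w, w - 1, 0) by apply: local_on_rot.
have base2 : local_on (local_triple T) (0, w, w - 1) by apply: local_on_rot.
have base : local_on (local_triple T) (1, 1, 1).
  (* The oblique reflection sends (1, 1, 1) to the opposite of (w, w - 1, 0), a point already
     treated. *)
  apply: local_on_refl; have -> : refl_coef w h 1 1 1 = w.
    by rewrite /refl_coef; ring: h2.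
  have -> : (1 - w * w, 1 - w, 1 - w * (w - 1)) = (-1 * w, -1 * (w - 1), -1 * 0).
    by congr (_, _, _); ring: w2.
  exact: local_on_scale.
rewrite !inE; do 9?[case/orP] => /eqP -> //.
- exact: local_onN.
- exact: local_onN2.
- exact: local_onN3.
- exact: local_onN.
- exact: local_onN2.
- exact: local_onN3.
Qed.

Lemma local_on_double p : p \in double_points w -> local_on (local_double T) p.
Proof.
have base3 : local_on (local_double T) (0, 0, 1).
  move=> x y z [lam [v1 [v2 [v3 /= [-> -> ->]]]]]; rewrite /holds_at.
  by have := double_local w T v1 v2 (lam + T * v3); rewrite !mulr0 !add0r mulr1.
have base1 : local_on (local_double T) (1, 0, 0) by apply: local_on_rot.
have base2 : local_on (local_double T) (0, 1, 0) by apply: local_on_rot.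
have gen1 : local_on (local_double T) (w - 1, w, 1).
  (* The oblique reflection sends (w - 1, w, 1) to -2 times the first basis vector. *)
  apply: local_on_refl; have -> : refl_coef w h (w - 1) w 1 = w.
    rewrite /refl_coef; have -> : w * (w - 1) + w + (w - 1) * 1 = 2 * w by ring: w2.
    by rewrite mulrCA mulrA h2 mul1r.
  have -> : (w - 1 - w * w, w - w, 1 - w * (w - 1)) = (- 2 * 1, - 2 * 0, - 2 * 0).
    by congr (_, _, _); ring: w2.
  exact: local_on_scale.
have gen2 : local_on (local_double T) (w, 1, w - 1) by do 2!apply: local_on_rot.
have gen3 : local_on (local_double T) (1, w - 1, w) by apply: local_on_rot.
rewrite !inE; do 14?[case/orP] => /eqP -> //;
  rewrite -?[1 - w]opprB; by [apply: local_onN|apply: local_onN2|apply: local_onN3].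
Qed.

End NearPoints.

(** A factor with nonzero constant coefficient is cancelled one coefficient at a time. This removes
    the multipliers, constants and powers of Q, from the identities above. *)
Lemma poly_dvdXn_cancel (R : idomainType) (h q r : {poly R}) m :
  h`_0 != 0 -> h * q = 'X^m * r -> exists r', q = 'X^m * r'.
Proof.
move=> nz_h hq; exists (drop_poly m q); rewrite -[LHS](poly_take_drop m) [_ * 'X^m]mulrC.
suff -> : take_poly m q = 0 by rewrite add0r.
apply/polyP => k; rewrite coef0 coef_take_poly; case: ltnP => // lt_km.
elim/ltn_ind: k lt_km => k IHk lt_km.
have : (h * q)`_k = 0 by rewrite hq coefXnM lt_km.
rewrite coefM (bigD1 ord0) //= subn0 big1 => [|[[|i] lti] //= _].
  by rewrite addr0 => /eqP; rewrite mulf_eq0 (negPf nz_h) => /eqP.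
by rewrite IHk ?mulr0 //; lia.
Qed.

(** * Orders and degrees of the icosahedral forms *)

Section Membership.
Variables (K : numClosedFieldType) (w : K).
Hypothesis w2 : w * w = w + 1.
Local Notation Pol := {mpoly K[3]}.

Definition coord3 k : Pol := 'X_(inord k).
Definition ico2 : Pol := inv2 (coord3 0) (coord3 1) (coord3 2).
Definition ico6 : Pol := inv6 w%:MP (coord3 0) (coord3 1) (coord3 2).
Definition ico10 : Pol := inv10 w%:MP (coord3 0) (coord3 1) (coord3 2).
Definition ico_form s : Pol := ternary_eval s ico2 ico6 ico10.

Definition vec_of (P : K * K * K) : 'cV[K]_3 := vec3 P.1.1 P.1.2 P.2.

Section AtPoint.
Variables (p : proj_point K) (j : 'I_3).
Hypothesis pj : point_vec p j 0 != 0.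
Let S : {rmorphism Pol -> {poly Pol}} := pencil_expansion p j.

Lemma meval_pencil0 f : ((S f)`_0).@[fun i => point_vec p i 0] = f.@[fun i => point_vec p i 0].
Proof.
rewrite -horner_coef0.
pose phi := meval (fun i => point_vec p i 0) \o horner_eval 0 \o S.
apply: (@eq_mpoly_rmorph _ _ _ phi (meval _)) => [c|i] /=; rewrite /horner_eval.
  by rewrite pencil_expansionC hornerC.
rewrite pencil_expansionX /pencil_var hornerD hornerZ hornerX hornerC mulr0 addr0.
by rewrite !mevalZ !mevalXU mulVf // mulr1.
Qed.

Lemma ideal_exp_cancel m h f : h.@[fun i => point_vec p i 0] != 0 ->
  (exists q, S (h * f) = 'X^m * q) -> ideal_exp (point_ideal p) m f.
Proof.
move=> nz_h [q]; rewrite rmorphM => Sq; apply: (ideal_exp_pencil pj).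
apply: poly_dvdXn_cancel Sq; apply: contra_neq nz_h => h0.
by rewrite -meval_pencil0 h0 meval0.
Qed.

Let iota : {rmorphism K -> {poly Pol}} := polyC \o @mpolyC 3 K.
Let W := iota w.
Let pt P := (iota P.1.1, iota P.1.2, iota P.2).

(** The expansion at p sends the coordinate vector to a multiple of P plus T times a vector, which
    is what the local lemmas assume, with T the polynomial variable. *)
Lemma pencil_near c P : point_vec p = c *: vec_of P ->
  near 'X (pt P) (S (coord3 0)) (S (coord3 1)) (S (coord3 2)).
Proof.
move=> p_P; pose l : Pol := (point_vec p j 0)^-1 *: 'X_j.
pose r k : Pol := coord3 k - point_vec p (inord k) 0 *: l.
exists ((c *: l)%:P), (r 0)%:P, (r 1)%:P, (r 2)%:P.
have E k t : point_vec p (inord k) 0 = c * t -> S (coord3 k) = (c *: l)%:P * iota t + 'X * (r k)%:P.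
  move=> pk; rewrite /= pencil_expansionX /pencil_var -/l; congr (_ + _).
    by rewrite -polyCM pk [in RHS]mulrC mul_mpolyC [t *: _]scalerA [c * t]mulrC.
  by rewrite -mul_polyC mulrC.
by split; apply: E; rewrite p_P mxE; congr (_ * _); rewrite /vec_of mxE inordK.
Qed.

Let W2 : W * W = W + 1.
Proof. by rewrite -rmorphM w2 rmorphD rmorph1. Qed.

Let h2 : 2 * iota 2^-1 = 1.
Proof. by rewrite -[X in X * _](rmorph_nat iota) -rmorphM divff ?rmorph1 // pnatr_eq0. Qed.

Let SW : S w%:MP = W.
Proof. exact: pencil_expansionC. Qed.

Let S_local c P Q : point_vec p = c *: vec_of P -> local_on W 'X Q (pt P) ->
  Q (S ico2) (S ico6) (S ico10).
Proof.
move=> /pencil_near + loc => /loc.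
by rewrite /holds_at -SW -rmorph_inv2 -rmorph_inv6 -rmorph_inv10.
Qed.

Lemma ideal_exp_quintuple c P m s (den : positive) k :
  P \in quintuple_points w -> point_vec p = c *: vec_of P ->
  (forall A T Q f g, dvdX T 2 (quint2 Q f) -> dvdX T 5 (quint5 Q f g) ->
     @dvdX A T m (Z_to_ring A (Zpos den) * Q ^+ k * ternary_eval s Q f g)) ->
  ideal_exp (point_ideal p) m (ico_form s).
Proof.
move=> P5 pP order; apply: (ideal_exp_cancel (h := Z_to_ring Pol (Zpos den) * ico2 ^+ k)).
  rewrite mevalM rmorph_Z_to_ring rmorphXn rmorph_inv2 /= !mevalXU mulf_neq0 //.
    by rewrite gt_eqF // pos_to_ring_gt0.
  have nz_c : c != 0 by apply: contraNneq pj => c0; rewrite pP c0 scale0r mxE.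
  (* This is the value of Q at the listed quintuple points; its norm is 5. *)
  have nz_w : w + 2 != 0.
    apply/eqP => e; have : 5 = (w + 2) * (3 - w) by ring: w2.
    by move=> /eqP; rewrite e mul0r pnatr_eq0.
  suff E : inv2 P.1.1 P.1.2 P.2 = w + 2.
    rewrite expf_neq0 // pP.
    have -> x y z : inv2 ((c *: vec_of P) x 0) ((c *: vec_of P) y 0) ((c *: vec_of P) z 0) =
      c ^+ 2 * inv2 (vec_of P x 0) (vec_of P y 0) (vec_of P z 0).
      by rewrite /inv2 !mxE; ring.
    by rewrite !vec3_inord //= E mulf_neq0 ?expf_neq0.
  by move: P5; rewrite !inE; do 5?[case/orP] => /eqP ->; rewrite /inv2 /=; ring: w2.
have [|u v] := S_local pP (P := P) (Q := local_quint 'X).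
  exact: (local_on_quintuple W2 (map_quintuple_points iota P5)).
rewrite rmorphM [X in X * _]rmorphM rmorphXn rmorph_Z_to_ring rmorph_ternary_eval; exact: order.
Qed.

Lemma ideal_exp_triple c P m s (den : positive) :
  P \in triple_points w -> point_vec p = c *: vec_of P ->
  (forall A T Q f g, dvdX T 2 (triple2 Q f) -> dvdX T 3 (triple3 Q f g) ->
     @dvdX A T m (Z_to_ring A (Zpos den) * ternary_eval s Q f g)) ->
  ideal_exp (point_ideal p) m (ico_form s).
Proof.
move=> P3 pP order; apply: (ideal_exp_cancel (h := Z_to_ring Pol (Zpos den))).
  by rewrite rmorph_Z_to_ring gt_eqF // pos_to_ring_gt0.
have [|u v] := S_local pP (P := P) (Q := local_triple 'X).
  exact: (local_on_triple W2 h2 (map_triple_points iota P3)).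
rewrite rmorphM rmorph_Z_to_ring rmorph_ternary_eval; exact: order.
Qed.

Lemma local_at_double c P : P \in double_points w -> point_vec p = c *: vec_of P ->
  local_double 'X (S ico2) (S ico6) (S ico10).
Proof.
move=> P2 pP; apply: S_local pP _.
exact: (local_on_double W2 h2 (map_double_points iota P2)).
Qed.

Lemma ideal_exp_double c P m s : P \in double_points w -> point_vec p = c *: vec_of P ->
  (forall A T Q f g, dvdX T 2 f -> dvdX T 2 g -> @dvdX A T m (ternary_eval s Q f g)) ->
  ideal_exp (point_ideal p) m (ico_form s).
Proof.
move=> P2 pP order; apply: (ideal_exp_pencil pj).
have [u v] := local_at_double P2 pP.
have [q Eq] := order _ _ (S ico2) _ _ u v; exists q.
by rewrite -Eq; exact: (rmorph_ternary_eval S).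
Qed.

Lemma ideal_exp_double6 c P : P \in double_points w -> point_vec p = c *: vec_of P ->
  ideal_exp (point_ideal p) 2 ico6.
Proof.
by move=> P2 /(local_at_double P2)[[q Eq] _]; apply: (ideal_exp_pencil pj); exists q.
Qed.

End AtPoint.

Definition at_point (L : seq (K * K * K)) (p : proj_point K) :=
  exists c, exists2 P, P \in L & point_vec p = c *: vec_of P.

Definition ico110 := ico_form P30 * ico_form F80.
Definition ico240 := ico_form F80 ^+ 3.
(** The exponents reproduce the orders of [ico240]: 2 * 10 + 5 * 2 = 30 at quintuple points, 2 * 6 +
    5 * 6 = 42 at triple points, and 2 * 4 + 5 * 2 + 5 * 6 = 48 at double points, where [ico6]
    contributes order 2. *)
Definition ico240' := ico_form P30 ^+ 2 * (ico6 ^+ 5 * ico_form C30 ^+ 5).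

Lemma point_vec_coord (p : proj_point K) : exists j, point_vec p j 0 != 0.
Proof. by have /cV0Pn[j] := point_vec_neq0 p; exists j. Qed.

Lemma ideal_exp_at_quintuple p : at_point (quintuple_points w) p ->
  [/\ ideal_exp (point_ideal p) 20 ico110, ideal_exp (point_ideal p) 30 ico240 &
      ideal_exp (point_ideal p) 30 ico240'].
Proof.
move=> [c [P P5 pP]]; have [j pj] := point_vec_coord p.
have Jl := @point_idealMl K p.
have A30 := ideal_exp_quintuple pj P5 pP P30_quint.
have B30 := ideal_exp_quintuple pj P5 pP C30_quint.
have A80 := ideal_exp_quintuple pj P5 pP F80_quint.
split; first exact: (ideal_expM Jl A30 A80); first exact: (ideal_expX Jl 3 A80).
apply: (ideal_expM Jl (ideal_expX Jl 2 A30)); apply: ideal_expMl => //.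
exact: (ideal_expX Jl 5 B30).
Qed.

Lemma ideal_exp_at_triple p : at_point (triple_points w) p ->
  [/\ ideal_exp (point_ideal p) 20 ico110, ideal_exp (point_ideal p) 42 ico240 &
      ideal_exp (point_ideal p) 42 ico240'].
Proof.
move=> [c [P P3 pP]]; have [j pj] := point_vec_coord p.
have Jl := @point_idealMl K p.
have A30 := ideal_exp_triple pj P3 pP P30_triple.
have B30 := ideal_exp_triple pj P3 pP C30_triple.
have A80 := ideal_exp_triple pj P3 pP F80_triple.
split; first exact: (ideal_expM Jl A30 A80); first exact: (ideal_expX Jl 3 A80).
apply: (ideal_expM Jl (ideal_expX Jl 2 A30)); apply: ideal_expMl => //.
exact: (ideal_expX Jl 5 B30).
Qed.

Lemma ideal_exp_at_double p : at_point (double_points w) p ->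
  [/\ ideal_exp (point_ideal p) 20 ico110, ideal_exp (point_ideal p) 48 ico240 &
      ideal_exp (point_ideal p) 48 ico240'].
Proof.
move=> [c [P P2 pP]]; have [j pj] := point_vec_coord p.
have Jl := @point_idealMl K p.
have A30 := ideal_exp_double pj P2 pP P30_double.
have B30 := ideal_exp_double pj P2 pP C30_double.
have A80 := ideal_exp_double pj P2 pP F80_double.
have A6 := ideal_exp_double6 pj P2 pP.
split; first exact: (ideal_expM Jl A30 A80); first exact: (ideal_expX Jl 3 A80).
apply: (ideal_expM Jl (ideal_expX Jl 2 A30)).
exact: (ideal_expM Jl (ideal_expX Jl 5 A6) (ideal_expX Jl 5 B30)).
Qed.

Lemma coord_homog k : coord3 k \is 1.-homog.
Proof. by rewrite dhomogX; apply/eqP/mdeg1. Qed.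

Lemma homog_const (c : K) d (f : Pol) : f \is d.-homog -> c%:MP * f \is d.-homog.
Proof. by move=> fd; rewrite mul_mpolyC rpredZ. Qed.

Lemma ico2_homog : ico2 \is 2.-homog.
Proof.
have sq k : coord3 k ^+ 2 \is 2.-homog by apply: (dhomogMn 2 (coord_homog k)).
by rewrite /ico2 /inv2 !rpredD ?sq.
Qed.

Let quadric_homog a k l : coord3 k ^+ 2 - (a : K)%:MP * coord3 l ^+ 2 \is 2.-homog.
Proof.
by rewrite rpredB ?homog_const //; apply: (dhomogMn 2 (coord_homog _)).
Qed.

Lemma ico6_homog : ico6 \is 6.-homog.
Proof.
have -> : ico6 = (2 * w - 3)%:MP * ((coord3 1 ^+ 2 - (w ^+ 2)%:MP * coord3 2 ^+ 2) *
    (coord3 2 ^+ 2 - (w ^+ 2)%:MP * coord3 0 ^+ 2) * (coord3 0 ^+ 2 - (w ^+ 2)%:MP * coord3 1 ^+ 2)).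
  by rewrite mpolyCB mpolyCM !mpolyC_nat (rmorphXn (@mpolyC 3 K)).
by apply: homog_const; apply: (@dhomogM _ _ _ 4 _ 2); first apply: (@dhomogM _ _ _ 2 _ 2).
Qed.

Lemma ico10_homog : ico10 \is 10.-homog.
Proof.
have -> : ico10 = (18 * w - 29)%:MP * ((coord3 0 ^+ 2 - (w ^+ 4)%:MP * coord3 2 ^+ 2) *
    (coord3 1 ^+ 2 - (w ^+ 4)%:MP * coord3 0 ^+ 2) * (coord3 2 ^+ 2 - (w ^+ 4)%:MP * coord3 1 ^+ 2) *
   ((coord3 0 + coord3 1 + coord3 2) * (coord3 0 + coord3 1 - coord3 2) *
    (coord3 0 - coord3 1 + coord3 2) * (coord3 0 - coord3 1 - coord3 2))).
  by rewrite mpolyCB mpolyCM !mpolyC_nat (rmorphXn (@mpolyC 3 K)).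
have lin := coord_homog.
apply: homog_const; apply: (@dhomogM _ _ _ 6 _ 4).
  by apply: (@dhomogM _ _ _ 4 _ 2); first apply: (@dhomogM _ _ _ 2 _ 2).
apply: (@dhomogM _ _ _ 3 _ 1); last by rewrite !rpredB ?lin.
apply: (@dhomogM _ _ _ 2 _ 1); last by rewrite rpredD ?rpredB ?lin.
by apply: (@dhomogM _ _ _ 1 _ 1); rewrite ?rpredB ?rpredD ?lin.
Qed.

Lemma ico_form_homog s d :
  all (fun t => 2 * t.2.1.1 + 6 * t.2.1.2 + 10 * t.2.2 == d)%N s -> ico_form s \is d.-homog.
Proof.
rewrite /ico_form /ternary_eval; elim: s => [|[c [[i j] k]] s IHs] /=.
  by rewrite big_nil rpred0.
case/andP=> /eqP e_d /IHs sd; rewrite big_cons /= rpredD // -e_d.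
rewrite -(rmorph_Z_to_ring (@mpolyC 3 K)); apply: homog_const.
by do !apply: dhomogM; apply: dhomogMn; [exact: ico2_homog|exact: ico6_homog|exact: ico10_homog].
Qed.

Lemma ico110_homog : ico110 \is 110.-homog.
Proof. by apply: (@dhomogM _ _ _ 30 _ 80); apply: ico_form_homog. Qed.

Lemma ico240_homog : ico240 \is 240.-homog.
Proof. exact: (dhomogMn 3 (ico_form_homog (d := 80) (s := F80) _)). Qed.

Lemma ico240'_homog : ico240' \is 240.-homog.
Proof.
apply: (@dhomogM _ _ _ 60 _ 180).
  exact: (dhomogMn 2 (ico_form_homog (d := 30) (s := P30) _)).
apply: (@dhomogM _ _ _ 30 _ 150); first exact: (dhomogMn 5 ico6_homog).
exact: (dhomogMn 5 (ico_form_homog (d := 30) (s := C30) _)).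
Qed.

End Membership.

(** * Finiteness of the base locus *)

Section BaseLocus.
Variables (K : numClosedFieldType) (w : K).
Hypothesis w2 : w * w = w + 1.

Lemma finite_roots (q : {poly K}) : q != 0 -> exists s : seq K, forall z, q.[z] = 0 -> z \in s.
Proof.
move=> nz_q; have [s q_s] := closed_field_poly_normal q; exists s => z /eqP.
by rewrite q_s hornerZ mulf_eq0 lead_coef_eq0 (negPf nz_q) -/(root _ _) root_prod_XsubC.
Qed.

Lemma ternary_eval_scale s d (t Q f g : K) :
  all (fun m => 2 * m.2.1.1 + 6 * m.2.1.2 + 10 * m.2.2 == d)%N s ->
  ternary_eval s (t ^+ 2 * Q) (t ^+ 6 * f) (t ^+ 10 * g) = t ^+ d * ternary_eval s Q f g.
Proof.
rewrite /ternary_eval; elim: s => [|[c [[i j] k]] s IHs] /=; first by rewrite !big_nil mulr0.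
case/andP=> /eqP e_d /IHs IH; rewrite !big_cons IH /= mulrDr -e_d; congr (_ + _).
have E a (y : K) n : (t ^+ a * y) ^+ n = t ^+ (a * n) * y ^+ n by rewrite exprMn exprM.
by rewrite !E !exprD; ring.
Qed.

(* For Q = x^2 + y^2 + z^2, f = inv6 and g = inv10, the six numbers (x + w y)^2, (x - w y)^2
   and their cyclic images are the roots of this polynomial in r^2. *)
Definition hexad (Q f g r : K) : K :=
  5 * r ^+ 12 - (20 + 10 * w) * Q * r ^+ 10 + (35 + 35 * w) * Q ^+ 2 * r ^+ 8
  - (30 + 40 * w) * (Q ^+ 3 + f) * r ^+ 6 + (10 + 15 * w) * (Q ^+ 4 + 6 * Q * f) * r ^+ 4
  - (7 + 11 * w) * (5 * Q ^+ 2 * f + g) * r ^+ 2 + (25 + 40 * w) * f ^+ 2.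

Lemma hexad_inv x y z : hexad (inv2 x y z) (inv6 w x y z) (inv10 w x y z) (x + w * y) = 0.
Proof. by rewrite /hexad /inv2 /inv6 /inv10; ring: w2. Qed.

Lemma hexad_finite f g : exists s : seq K, forall r, hexad 1 f g r = 0 -> r \in s.
Proof.
pose q : {poly K} := 5 *: 'X^12 - (20 + 10 * w) *: 'X^10 + (35 + 35 * w) *: 'X^8
  - ((30 + 40 * w) * (1 + f)) *: 'X^6 + ((10 + 15 * w) * (1 + 6 * f)) *: 'X^4
  - ((7 + 11 * w) * (5 * f + g)) *: 'X^2 + ((25 + 40 * w) * f ^+ 2)%:P.
have [|s sP] := @finite_roots q.
  apply/eqP => /(congr1 (fun q : {poly K} => q`_12)); rewrite /q !coefE /=.
  by rewrite !(mulr0, mulr1, subr0, addr0) => /eqP; rewrite pnatr_eq0.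
exists s => r r0; apply: sP; rewrite -r0 /q /hexad !(hornerD, hornerN, hornerZ, hornerXn, hornerC); ring.
Qed.

Lemma Z_to_ring_neq0 q : Z_to_ring K (Zpos q) != 0.
Proof. by rewrite gt_eqF // pos_to_ring_gt0. Qed.

(** For Q = 0 the three forms are, up to powers of g, binary forms in f^5 and g^3. A relation
    between f^5 and g^3 turns F80 into a nonzero multiple of g^2 f^10, so f or g vanishes, and the
    relation then kills the other one. *)
Lemma F80_at_infinity (f g : K) : ternary_eval F80 0 f g = 0 ->
  ternary_eval P30 0 f g = 0 \/ f = 0 \/ ternary_eval C30 0 f g = 0 -> f = 0 /\ g = 0.
Proof.
have -> : ternary_eval F80 0 f g =
    g ^+ 2 * (Z_to_ring K (Zpos 125) * (g ^+ 3) ^+ 2 + Z_to_ring K (Zpos 11750400) * f ^+ 5 * g ^+ 3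
      + Z_to_ring K (Zpos 14929920000) * (f ^+ 5) ^+ 2).
  by rewrite /ternary_eval /F80 !big_cons !big_nil /=; ring.
have -> : ternary_eval P30 0 f g = -5 * (Z_to_ring K (Zpos 1728) * f ^+ 5 + 5 * g ^+ 3).
  by rewrite /ternary_eval /P30 !big_cons !big_nil /=; ring.
have -> : ternary_eval C30 0 f g = 5 * (g ^+ 3 - Z_to_ring K (Zpos 4320) * f ^+ 5).
  by rewrite /ternary_eval /C30 !big_cons !big_nil /=; ring.
have nzP := Z_to_ring_neq0.
have nz5 : (5 : K) != 0 by rewrite pnatr_eq0.
have expf0 x k : x ^+ k.+1 = 0 -> x = 0 :> K by move=> /eqP; rewrite expf_eq0 => /eqP.
have both (a b : K) k l : a != 0 -> b != 0 -> a * f ^+ k.+1 = b * g ^+ l.+1 -> f = 0 \/ g = 0 -> f = 0 /\ g = 0.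
  move=> nz_a nz_b e [z|z]; move: e; rewrite z expr0n mulr0 => /esym/eqP.
    by rewrite mulf_eq0 (negPf nz_b) /= => /eqP/expf0.
  by rewrite eq_sym mulf_eq0 (negPf nz_a) /= => /eqP/expf0.
have one (N : K) : N != 0 -> g ^+ 2 * (N * (f ^+ 5) ^+ 2) = 0 -> f = 0 \/ g = 0.
  by move=> nz_N /eqP; rewrite mulf_eq0 [N * _ == 0]mulf_eq0 (negPf nz_N) /= !expf_eq0 /=;
    case/orP=> /eqP; [right|left].
move=> F0; case=> [/eqP|[f0|/eqP]].
- rewrite mulf_eq0 oppr_eq0 (negPf nz5) /= => /eqP e.
  apply: (both (Z_to_ring K (Zpos 1728)) (-5) 4%N 2%N) => //; rewrite ?oppr_eq0 //.
    by apply/eqP; rewrite -subr_eq0 mulNr opprK e.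
  (* Substituting 5 g^3 = - 1728 f^5 in the bracket leaves this multiple of f^10. *)
  apply: (one _ (nzP 10883911680%positive)); rewrite -[RHS]F0; congr (_ * _).
  transitivity (Z_to_ring K (Zpos 10883911680) * (f ^+ 5) ^+ 2 +
    (25 * g ^+ 3 + Z_to_ring K (Zpos 2341440) * f ^+ 5) * (Z_to_ring K (Zpos 1728) * f ^+ 5 + 5 * g ^+ 3)).
    by rewrite e; ring.
  by rewrite /=; ring.
- split=> //; move: F0; rewrite f0.
  have -> : forall a b c : K, g ^+ 2 * (a * (g ^+ 3) ^+ 2 + b * 0 ^+ 5 * g ^+ 3 + c * (0 ^+ 5) ^+ 2) =
    a * g ^+ 8 by move=> a b c; ring.
  move: (Z_to_ring K _) (nzP 125%positive) => N nz_N /eqP.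
  by rewrite mulf_eq0 (negPf nz_N) => /eqP/expf0.
rewrite mulf_eq0 (negPf nz5) /= subr_eq0 => /eqP e.
apply: (both (Z_to_ring K (Zpos 4320)) 1 4%N 2%N); rewrite ?oner_eq0 // ?mul1r //.
apply: (one _ (nzP 68024448000%positive)).
by rewrite -[RHS]F0 e; congr (_ * _); rewrite /=; ring.
Qed.

Lemma F80_affine_B (Y : K) : ternary_eval F80 1 0 Y = 0 -> Y = 0.
Proof.
have -> : ternary_eval F80 1 0 Y = Z_to_ring K (Zpos 125) * Y ^+ 8.
  by rewrite /ternary_eval /F80 !big_cons !big_nil /=; ring.
move: (Z_to_ring K _) (Z_to_ring_neq0 125) => N nz_N /eqP.
by rewrite mulf_eq0 (negPf nz_N) expf_eq0 => /eqP.
Qed.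

(** The curve has a triple point at the origin: on the line Y = s X, division by X^3 leaves a
    quadratic equation in X. Its discriminant becomes a square once a square root r of a linear
    function of s is adjoined. *)
Lemma C30_parametrization (X Y : K) : ternary_eval C30 1 X Y = 0 -> X != 0 ->
  exists r, X = (5 * r ^+ 3 - 6 * r ^+ 2 - 16) / 432 /\ Y = X * ((5 * r ^+ 2 - 50) / 6).
Proof.
move=> C0 nz_X; pose r := sqrtC ((6 * (Y / X) + 50) / 5).
have Y6 : 6 * Y = (5 * r ^+ 2 - 50) * X by rewrite sqrtCK; field.
have E : 216 * ternary_eval C30 1 X Y = - 25 * X ^+ 3 *
    ((432 * X - 5 * r ^+ 3 + 6 * r ^+ 2 + 16) * (432 * X + 5 * r ^+ 3 + 6 * r ^+ 2 + 16)).
  transitivity (216 * (2225 * X ^+ 3 - (7 * 1000 + 600) * X ^+ 4 - (21 * 1000 + 600) * X ^+ 5)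
      + 36 * (915 * X ^+ 2 - 720 * X ^+ 3) * (6 * Y) + 6 * 119 * X * (6 * Y) ^+ 2 + 5 * (6 * Y) ^+ 3).
    by rewrite /ternary_eval /C30 !big_cons !big_nil /=; ring.
  by rewrite Y6; ring.
have YX s : s ^+ 2 = r ^+ 2 -> Y = X * ((5 * s ^+ 2 - 50) / 6).
  by move=> ->; rewrite mulrA [X * _]mulrC -Y6; field.
have nz : - 25 * X ^+ 3 != 0 by rewrite mulf_neq0 ?oppr_eq0 ?pnatr_eq0 ?expf_neq0.
move/eqP: E; rewrite C0 mulr0 eq_sym mulf_eq0 (negPf nz) mulf_eq0 /=.
have rX s : 432 * X - 5 * s ^+ 3 + 6 * s ^+ 2 + 16 = 0 -> X = (5 * s ^+ 3 - 6 * s ^+ 2 - 16) / 432.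
  move=> e; have -> : 5 * s ^+ 3 - 6 * s ^+ 2 - 16 = 432 * X; last by field.
  by apply/eqP; rewrite eq_sym -subr_eq0 -[X in _ == X]e; apply/eqP; ring.
case/orP=> /eqP e; first by exists r; split; [exact: rX|exact: YX].
exists (- r); split; last by apply: YX; rewrite sqrrN.
by apply: rX; rewrite -[RHS]e; ring.
Qed.

(** For given X the cubic equation in s has three roots. The product of the B(s_i) - 25 Y is
    symmetric in them, hence a polynomial in X and Y, and it equals 625 P30; on the curve one factor
    vanishes. *)
Lemma P30_parametrization (X Y : K) : ternary_eval P30 1 X Y = 0 ->
  exists s, X = (s ^+ 3 - 2 * s ^+ 2 + 1) / 5 /\
    Y = (1 - 10 * s ^+ 2 + 5 * s ^+ 3 + 20 * s ^+ 4 - 12 * s ^+ 5) / 25.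
Proof.
move=> P0; pose q : {poly K} := 'X^3 - 2 *: 'X^2 + (1 - 5 * X)%:P.
have qE z : q.[z] = z ^+ 3 - 2 * z ^+ 2 + 1 - 5 * X.
  by rewrite /q !(hornerD, hornerN, hornerZ, hornerXn, hornerC); ring.
have q3 : q`_3 = 1 by rewrite /q !coefE /=; ring.
have szq : size q = 4%N.
  apply/eqP; rewrite eqn_leq; apply/andP; split; last first.
    by rewrite ltnNge; apply/negP => /leq_sizeP/(_ 3%N (leqnn _))/eqP; rewrite q3 oner_eq0.
  apply/leq_sizeP => k k4; rewrite /q !coefE.
  by case: k k4 => [|[|[|[|k]]]] //= _; rewrite ?mulr0 ?subr0 ?addr0.
have [rs q_rs] := closed_field_poly_normal q.
have lead_q : lead_coef q = 1 by rewrite /lead_coef szq.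
have : size rs = 3%N.
  have := congr1 (fun q : {poly K} => size q) q_rs.
  by rewrite lead_q scale1r size_prod_XsubC szq => -[].
move: q_rs; rewrite lead_q scale1r; case: rs => [|s1 [|s2 [|s3 []]]] // q_rs _.
have e z : z ^+ 3 - 2 * z ^+ 2 + 1 - 5 * X = (z - s1) * (z - s2) * (z - s3).
  by rewrite -qE q_rs !big_cons big_nil mulr1 !hornerM !hornerXsubC mulrA.
have nz2 : (2 : K) != 0 by rewrite pnatr_eq0.
(* The values at 0, 1 and -1 yield Vieta's relations; [rel] then lets [ring] reduce s1^2 and verify
   the symmetric identity. *)
have [/eqP e0 [/eqP e1 /eqP eN1]] := (e 0, (e 1, e (-1))).
rewrite -subr_eq0 in e0; rewrite -subr_eq0 in e1; rewrite -subr_eq0 in eN1.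
move/eqP: e0 => e0; move/eqP: e1 => e1; move/eqP: eN1 => eN1.
have X5 : 5 * X = 1 + s1 * s2 * s3 by apply: subr0_eq; rewrite -[RHS]oppr0 -e0; ring.
have s3E : s3 = 2 - s1 - s2.
  apply: subr0_eq; apply: (mulfI nz2); rewrite mulr0.
  transitivity (0 + 0 - 2 * 0 : K); last by ring.
  by rewrite -{1}e1 -{1}eN1 -e0; ring.
have rel : s1 * s1 = 2 * s1 + 2 * s2 - s1 * s2 - s2 * s2.
  apply: subr0_eq; apply: (mulfI nz2); rewrite mulr0.
  transitivity (0 - 0 : K); last by ring.
  by rewrite -{1}e1 -eN1 s3E; ring.
pose B (s : K) := 1 - 10 * s ^+ 2 + 5 * s ^+ 3 + 20 * s ^+ 4 - 12 * s ^+ 5.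
have E : 625 * ternary_eval P30 1 X Y = (B s1 - 25 * Y) * (B s2 - 25 * Y) * (B s3 - 25 * Y).
  transitivity (500 * (5 * X) ^+ 2 - 2275 * (5 * X) ^+ 3 + 3440 * (5 * X) ^+ 4 - 1728 * (5 * X) ^+ 5
    + (200 * (5 * X) - 795 * (5 * X) ^+ 2 + 720 * (5 * X) ^+ 3) * (25 * Y)
    + (4 - 65 * (5 * X)) * (25 * Y) ^+ 2 - (25 * Y) ^+ 3).
    by rewrite /ternary_eval /P30 !big_cons !big_nil /=; ring.
  by rewrite X5 s3E /B; ring: rel.
move/eqP: E; rewrite P0 mulr0 eq_sym !mulf_eq0 -orbA => roots.
have X_root s : (s - s1) * (s - s2) * (s - s3) = 0 -> X = (s ^+ 3 - 2 * s ^+ 2 + 1) / 5.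
  by rewrite -e => /subr0_eq ->; rewrite mulrC mulKf // pnatr_eq0.
have Y_root t : B t - 25 * Y = 0 -> Y = B t / 25.
  by move=> /subr0_eq ->; rewrite mulrC mulKf // pnatr_eq0.
have X1 := X_root s1; have X2 := X_root s2; have X3 := X_root s3.
move: X1 X2 X3; rewrite !subrr !(mul0r, mulr0) => /(_ erefl) X1 /(_ erefl) X2 /(_ erefl) X3.
case/or3P: roots => /eqP/Y_root b; first by exists s1.
  by exists s2.
by exists s3.
Qed.

Lemma affine_base_finite : exists s : seq (K * K), forall X Y,
  ternary_eval F80 1 X Y = 0 ->
  ternary_eval P30 1 X Y = 0 \/ X = 0 \/ ternary_eval C30 1 X Y = 0 -> (X, Y) \in s.
Proof.
pose x1 : {poly K} := 5^-1 *: ('X^3 - 2 *: 'X^2 + 1).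
pose y1 : {poly K} := 25^-1 *: (1 - 10 *: 'X^2 + 5 *: 'X^3 + 20 *: 'X^4 - 12 *: 'X^5).
pose x2 : {poly K} := 432^-1 *: (5 *: 'X^3 - 6 *: 'X^2 - 16%:P).
pose y2 : {poly K} := x2 * (6^-1 *: (5 *: 'X^2 - 50%:P)).
have hE := (hornerD, hornerN, hornerZ, hornerXn, hornerC).
have x1E t : x1.[t] = (t ^+ 3 - 2 * t ^+ 2 + 1) / 5 by rewrite /x1 -polyC1 !hE mulrC.
have y1E t : y1.[t] = (1 - 10 * t ^+ 2 + 5 * t ^+ 3 + 20 * t ^+ 4 - 12 * t ^+ 5) / 25.
  by rewrite /y1 -polyC1 !hE mulrC.
have x2E t : x2.[t] = (5 * t ^+ 3 - 6 * t ^+ 2 - 16) / 432 by rewrite /x2 !hE mulrC.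
have y2E t : y2.[t] = x2.[t] * ((5 * t ^+ 2 - 50) / 6) by rewrite /y2 hornerM !hE [6^-1 * _]mulrC.
have evalE x y t : (ternary_eval F80 1 x y).[t] = ternary_eval F80 1 x.[t] y.[t].
  by rewrite -!/(horner_eval t _) rmorph_ternary_eval rmorph1.
have nz1 : ternary_eval F80 1 x1 y1 != 0.
  suff nz : (ternary_eval F80 1 x1 y1).[1] != 0 by apply: contra_neq nz => ->; rewrite horner0.
  (* The parameter 1 gives the point (0, 4/25), and F80 restricted to X = 0 is 125 Y^8. *)
  rewrite evalE x1E y1E !expr1n; have -> : (1 - 2 * 1 + 1) / 5 = 0 :> K by rewrite mulr1 addrAC subrr mul0r.
  apply/eqP => /F80_affine_B; have -> : (1 - 10 * 1 + 5 * 1 + 20 * 1 - 12 * 1) / 25 = 4 / 25 :> K by congr (_ / _); ring.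
  by move/eqP; rewrite mulf_eq0 invr_eq0 !pnatr_eq0.
have nz2 : ternary_eval F80 1 x2 y2 != 0.
  suff nz : (ternary_eval F80 1 x2 y2).[- 4] != 0 by apply: contra_neq nz => ->; rewrite horner0.
  (* The parameter -4 gives the integral point (-1, -5), where F80 is a positive integer. *)
  rewrite evalE y2E x2E; have -> : (5 * (- 4) ^+ 3 - 6 * (- 4) ^+ 2 - 16) / 432 = -1 :> K by field.
  have -> : -1 * ((5 * (- 4) ^+ 2 - 50) / 6) = -5 :> K by field.
  have -> : ternary_eval F80 1 (-1) (-5) = Z_to_ring K (Zpos 11796480000000).
    by rewrite /ternary_eval /F80 !big_cons !big_nil /=; ring.
  exact: Z_to_ring_neq0.
have [[s1 s1P] [s2 s2P]] := (finite_roots nz1, finite_roots nz2).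
exists ((0, 0) :: [seq (x1.[t], y1.[t]) | t <- s1] ++ [seq (x2.[t], y2.[t]) | t <- s2]).
move=> X Y F0; rewrite inE mem_cat.
case=> [/P30_parametrization[t [Xt Yt]]|XC].
  apply/orP; right; apply/orP; left; rewrite {1}Xt {1}Yt -x1E -y1E; apply: map_f.
  by apply: s1P; rewrite evalE x1E y1E -Xt -Yt.
have [X0|nz_X] := eqVneq X 0.
  by move: F0; rewrite X0 => /F80_affine_B ->; rewrite eqxx.
case: XC => [X0|/C30_parametrization/(_ nz_X)[t [Xt Yt]]]; first by rewrite X0 eqxx in nz_X.
apply/orP; right; apply/orP; right.
have [X2 Y2] : X = x2.[t] /\ Y = y2.[t] by rewrite y2E x2E -Xt.
by rewrite X2 Y2; apply: map_f; apply: s2P; rewrite evalE -X2 -Y2.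
Qed.

(** Once Q is scaled to 1, a common zero has one of finitely many pairs (f, g), and [hexad] leaves
    finitely many values for x + w y, y + w z and z + w x, which determine the vector. If Q = 0, all
    three invariants vanish and the same polynomial forces the vector to be zero. *)
Lemma base_locus_finite : exists base : seq 'cV[K]_3, forall v : 'cV[K]_3, v != 0 ->
  (ico240 w).@[fun i => v i 0] = 0 -> (ico240' w).@[fun i => v i 0] = 0 ->
  exists c, exists2 u, u \in base & v = c *: u.
Proof.
have [FG FGP] := affine_base_finite.
have /choice[roots rootsP] : forall fg : K * K, exists s : seq K,
    forall r, hexad 1 fg.1 fg.2 r = 0 -> r \in s by move=> fg; apply: hexad_finite.
pose R := flatten [seq roots fg | fg <- FG].
(* The inverse of the circulant system, up to its determinant 1 + w^3 = 2 w^2. *)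
pose mk (r : K * (K * K)) := vec3 (r.1 - w * r.2.1 + w ^+ 2 * r.2.2)
  (r.2.1 - w * r.2.2 + w ^+ 2 * r.1) (r.2.2 - w * r.1 + w ^+ 2 * r.2.1).
exists [seq mk r | r <- [seq (a, bc) | a <- R, bc <- [seq (b, c) | b <- R, c <- R]]] => v.
have [x [y [z ->]]] := vec3P v => nz_v.
have mevalE : forall s, (ico_form w s).@[fun i => vec3 x y z i 0] =
    ternary_eval s (inv2 x y z) (inv6 w x y z) (inv10 w x y z).
  move=> s; rewrite rmorph_ternary_eval rmorph_inv2 rmorph_inv6 rmorph_inv10 /=.
  by rewrite mevalC !mevalXU !vec3_inord.
have meval6 : (ico6 w).@[fun i => vec3 x y z i 0] = inv6 w x y z.
  by rewrite rmorph_inv6 /= mevalC !mevalXU !vec3_inord.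
have -> : (ico240 w).@[fun i => vec3 x y z i 0] =
    ternary_eval F80 (inv2 x y z) (inv6 w x y z) (inv10 w x y z) ^+ 3 by rewrite rmorphXn /= mevalE.
have -> : (ico240' w).@[fun i => vec3 x y z i 0] =
    ternary_eval P30 (inv2 x y z) (inv6 w x y z) (inv10 w x y z) ^+ 2 * (inv6 w x y z ^+ 5 *
    ternary_eval C30 (inv2 x y z) (inv6 w x y z) (inv10 w x y z) ^+ 5).
  by rewrite rmorphM [X in _ * X]rmorphM !rmorphXn /= meval6 !mevalE.
move=> /eqP F0 /eqP G0.
have {}F0 : ternary_eval F80 (inv2 x y z) (inv6 w x y z) (inv10 w x y z) = 0.
  by move: F0; rewrite expf_eq0 => /eqP.
have {}G0 : ternary_eval P30 (inv2 x y z) (inv6 w x y z) (inv10 w x y z) = 0 \/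
    inv6 w x y z = 0 \/ ternary_eval C30 (inv2 x y z) (inv6 w x y z) (inv10 w x y z) = 0.
  move: G0; rewrite mulf_eq0 [_ ^+ 5 * _ == 0]mulf_eq0 !expf_eq0 /=.
  by case/or3P => /eqP; [left|right; left|right; right].
have nz_w : w != 0 by apply/eqP => w0; move/eqP: w2; rewrite w0 mul0r add0r eq_sym oner_eq0.
have nz2w : 2 * w ^+ 2 != 0 by rewrite mulf_neq0 ?expf_neq0 // pnatr_eq0.
have solve a b c : 2 * w ^+ 2 * a = a + w * b - w * (b + w * c) + w ^+ 2 * (c + w * a).
  by ring: w2.
have [Q0|nz_Q] := eqVneq (inv2 x y z) 0.
  rewrite Q0 in F0 G0; have [f0 g0] := F80_at_infinity F0 G0.
  have r0 a b c : inv2 a b c = inv2 x y z -> inv6 w a b c = inv6 w x y z ->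
      inv10 w a b c = inv10 w x y z -> a + w * b = 0.
    move=> eQ ef eg; have := hexad_inv a b c; rewrite eQ ef eg Q0 f0 g0 /hexad => e.
    have /eqP : 5 * (a + w * b) ^+ 12 = 0 by rewrite -[RHS]e; ring.
    by rewrite mulf_eq0 pnatr_eq0 expf_eq0 => /eqP.
  have r1 := r0 x y z erefl erefl erefl.
  have r2 := r0 y z x (inv2_rot x y z) (inv6_rot w x y z) (inv10_rot w x y z).
  have r3 : z + w * x = 0.
    exact: (r0 z x y (etrans (inv2_rot y z x) (inv2_rot x y z))
      (etrans (inv6_rot w y z x) (inv6_rot w x y z)) (etrans (inv10_rot w y z x) (inv10_rot w x y z))).
  case/eqP: nz_v; rewrite vec3_0; congr vec3; apply: (mulfI nz2w);
    by rewrite ?(solve x y z) ?(solve y z x) ?(solve z x y) r1 r2 r3 !mulr0 subr0 addr0.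
pose t := sqrtC (inv2 x y z); have t2 : t ^+ 2 = inv2 x y z := sqrtCK _.
have nz_t : t != 0 by rewrite sqrtC_eq0.
move: F0 G0 nz_v {mevalE meval6}.
have [-> -> ->] : [/\ x = t * (x / t), y = t * (y / t) & z = t * (z / t)] by split; field.
have Q1 : inv2 (x / t) (y / t) (z / t) = 1.
  have -> : inv2 (x / t) (y / t) (z / t) = inv2 x y z / t ^+ 2 by rewrite /inv2; field.
  by rewrite t2 divff.
move: (x / t) (y / t) (z / t) Q1 => x' y' z' Q1.
have -> : inv2 (t * x') (t * y') (t * z') = t ^+ 2 * 1 by rewrite -Q1 /inv2; ring.
have -> : inv6 w (t * x') (t * y') (t * z') = t ^+ 6 * inv6 w x' y' z' by rewrite /inv6; ring.
have -> : inv10 w (t * x') (t * y') (t * z') = t ^+ 10 * inv10 w x' y' z' by rewrite /inv10; ring.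
rewrite (@ternary_eval_scale F80 80) // (@ternary_eval_scale P30 30) // (@ternary_eval_scale C30 30) //.
have tk k (a : K) : t ^+ k * a = 0 -> a = 0.
  by move/eqP; rewrite mulf_eq0 expf_eq0 (negPf nz_t) andbF => /eqP.
move=> /tk F0 G0 _; have {}G0 : ternary_eval P30 1 (inv6 w x' y' z') (inv10 w x' y' z') = 0 \/
    inv6 w x' y' z' = 0 \/ ternary_eval C30 1 (inv6 w x' y' z') (inv10 w x' y' z') = 0.
  by case: G0 => [/tk|[/tk|/tk]]; [left|right; left|right; right].
have FG_fg := FGP _ _ F0 G0.
have R_r a b c : inv2 a b c = inv2 x' y' z' -> inv6 w a b c = inv6 w x' y' z' ->
    inv10 w a b c = inv10 w x' y' z' -> a + w * b \in R.
  move=> eQ ef eg; apply/flatten_mapP; exists (inv6 w x' y' z', inv10 w x' y' z') => //.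
  by apply: rootsP; have := hexad_inv a b c; rewrite eQ ef eg Q1.
have r1 := R_r x' y' z' erefl erefl erefl.
have r2 := R_r y' z' x' (inv2_rot x' y' z') (inv6_rot w x' y' z') (inv10_rot w x' y' z').
have r3 : z' + w * x' \in R.
  exact: (R_r z' x' y' (etrans (inv2_rot y' z' x') (inv2_rot x' y' z'))
    (etrans (inv6_rot w y' z' x') (inv6_rot w x' y' z')) (etrans (inv10_rot w y' z' x') (inv10_rot w x' y' z'))).
exists (t / (2 * w ^+ 2)), (mk (x' + w * y', (y' + w * z', z' + w * x'))).
  by apply: map_f; apply: allpairs_f => //; apply: allpairs_f.
rewrite /mk scale_vec3 /= -(solve x' y' z') -(solve y' z' x') -(solve z' x' y').
by congr vec3; rewrite mulrA divfK.
Qed.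

End BaseLocus.

(** * Exact arithmetic with icosahedral matrices *)

Lemma Z_to_ringE (A : comNzRingType) (z : Z) : Z_to_ring A z = (int_of_Z z)%:~R.
Proof.
have posE p : pos_to_ring A p = (int_of_Z (Zpos p))%:~R.
  elim: p => [p IHp|p IHp|]; last by [].
    have -> : Zpos (xI p) = 1 + 2 * Zpos p :> Z by [].
    by rewrite [LHS]/= IHp !(rmorphD, rmorphM).
  have -> : Zpos (xO p) = 2 * Zpos p :> Z by [].
  by rewrite [LHS]/= IHp !(rmorphD, rmorphM).
case: z => [|p|p]; [by [] | exact: posE|].
have -> : Zneg p = - Zpos p :> Z by [].
by rewrite !rmorphN /= posE.
Qed.

(* (a, b) encodes a + b w with w^2 = w + 1. *)
Definition zw := (Z * Z)%type.
Definition vecZ := (zw * zw * zw)%type.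
Definition matZ := (vecZ * vecZ * vecZ)%type.

Definition zw_add (x y : zw) : zw := (Z.add x.1 y.1, Z.add x.2 y.2).
Definition zw_opp (x : zw) : zw := (Z.opp x.1, Z.opp x.2).
Definition zw_mul (x y : zw) : zw :=
  (Z.add (Z.mul x.1 y.1) (Z.mul x.2 y.2),
   Z.add (Z.mul x.1 y.2) (Z.add (Z.mul x.2 y.1) (Z.mul x.2 y.2))).
(** The product of a + b w with its conjugate (a + b) - b w. A nonzero norm certifies, by integer
    computation, that the value in K is nonzero. *)
Definition zw_norm (x : zw) : Z := Z.sub (Z.add (Z.mul x.1 x.1) (Z.mul x.1 x.2)) (Z.mul x.2 x.2).
Definition zw_isunit (x : zw) : bool := ~~ Z.eqb (zw_norm x) Z0.
Definition zw_is0 (x : zw) : bool := Z.eqb x.1 Z0 && Z.eqb x.2 Z0.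

Definition vecZ_add (u v : vecZ) : vecZ :=
  (zw_add u.1.1 v.1.1, zw_add u.1.2 v.1.2, zw_add u.2 v.2).
Definition vecZ_scale (a : zw) (u : vecZ) : vecZ :=
  (zw_mul a u.1.1, zw_mul a u.1.2, zw_mul a u.2).
Definition vecZ_dot (u v : vecZ) : zw :=
  zw_add (zw_add (zw_mul u.1.1 v.1.1) (zw_mul u.1.2 v.1.2)) (zw_mul u.2 v.2).
Definition vecZ_cross (u v : vecZ) : vecZ :=
  let sub x y := zw_add x (zw_opp y) in
  (sub (zw_mul u.1.2 v.2) (zw_mul u.2 v.1.2), sub (zw_mul u.2 v.1.1) (zw_mul u.1.1 v.2),
   sub (zw_mul u.1.1 v.1.2) (zw_mul u.1.2 v.1.1)).
Definition vecZ_nonzero (u : vecZ) := [|| zw_isunit u.1.1, zw_isunit u.1.2 | zw_isunit u.2].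
Definition vecZ_is0 (u : vecZ) := [&& zw_is0 u.1.1, zw_is0 u.1.2 & zw_is0 u.2].

Definition matZ_row (u : vecZ) (B : matZ) : vecZ :=
  vecZ_add (vecZ_add (vecZ_scale u.1.1 B.1.1) (vecZ_scale u.1.2 B.1.2)) (vecZ_scale u.2 B.2).
Definition matZ_mul (A B : matZ) : matZ :=
  (matZ_row A.1.1 B, matZ_row A.1.2 B, matZ_row A.2 B).

Section Interpretation.
Variables (K : numFieldType) (w : K).
Hypothesis w2 : w * w = w + 1.

Definition zw_val (x : zw) : K := Z_to_ring K x.1 + Z_to_ring K x.2 * w.

Let ZD x y : Z_to_ring K (Z.add x y) = Z_to_ring K x + Z_to_ring K y.
Proof. by rewrite !Z_to_ringE -rmorphD; congr _%:~R; apply: (rmorphD int_of_Z). Qed.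

Let ZM x y : Z_to_ring K (Z.mul x y) = Z_to_ring K x * Z_to_ring K y.
Proof. by rewrite !Z_to_ringE -rmorphM; congr _%:~R; apply: (rmorphM int_of_Z). Qed.

Let ZN x : Z_to_ring K (Z.opp x) = - Z_to_ring K x.
Proof. by rewrite !Z_to_ringE -rmorphN; congr _%:~R; apply: (rmorphN int_of_Z). Qed.

Lemma zw_valD x y : zw_val (zw_add x y) = zw_val x + zw_val y.
Proof. by rewrite /zw_val /= !ZD; ring. Qed.

Lemma zw_valN x : zw_val (zw_opp x) = - zw_val x.
Proof. by rewrite /zw_val /= !ZN; ring. Qed.

Lemma zw_valM x y : zw_val (zw_mul x y) = zw_val x * zw_val y.
Proof. by rewrite /zw_val /= !(ZD, ZM); ring: w2. Qed.

Lemma zw_is0P x : zw_is0 x -> zw_val x = 0.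
Proof. by case: x => a b /andP[/Z.eqb_eq/= -> /Z.eqb_eq/= ->]; rewrite /zw_val /=; ring. Qed.

Lemma zw_isunitP x : zw_isunit x -> zw_val x != 0.
Proof.
move=> nz; apply/eqP => x0; have : Z_to_ring K (zw_norm x) = 0.
  transitivity (zw_val x * zw_val (Z.add x.1 x.2, Z.opp x.2)); last by rewrite x0 mul0r.
  by rewrite /zw_val /zw_norm /= -Z.add_opp_r !(ZD, ZN, ZM); ring: w2.
move: nz; rewrite /zw_isunit; case: (zw_norm x) => [|p|p] //= _ /eqP; rewrite ?oppr_eq0;
  by rewrite gt_eqF // pos_to_ring_gt0.
Qed.

Definition vecZ_val (u : vecZ) : 'cV[K]_3 := vec3 (zw_val u.1.1) (zw_val u.1.2) (zw_val u.2).

Lemma vecZ_val_dot u v : dot (vecZ_val u) (vecZ_val v) = zw_val (vecZ_dot u v).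
Proof. by rewrite dot_vec3 /vecZ_dot !(zw_valD, zw_valM). Qed.

Lemma vecZ_val_cross u v : cross (vecZ_val u) (vecZ_val v) = vecZ_val (vecZ_cross u v).
Proof. by rewrite cross_vec3 /vecZ_val /= !(zw_valD, zw_valN, zw_valM). Qed.

Lemma vecZ_val_add u v : vecZ_val (vecZ_add u v) = vecZ_val u + vecZ_val v.
Proof. by rewrite add_vec3 /vecZ_val /= !zw_valD. Qed.

Lemma vecZ_val_scale a u : vecZ_val (vecZ_scale a u) = zw_val a *: vecZ_val u.
Proof. by rewrite scale_vec3 /vecZ_val /= !zw_valM. Qed.

Lemma vecZ_nonzeroP u : vecZ_nonzero u -> vecZ_val u != 0.
Proof.
move=> nz; apply/eqP; rewrite /vecZ_val vec3_0 => /vec3_inj[e1 e2 e3].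
by case/or3P: nz => /zw_isunitP/eqP.
Qed.

Lemma vecZ_is0P u : vecZ_is0 u -> vecZ_val u = 0.
Proof.
by case/and3P=> /zw_is0P e1 /zw_is0P e2 /zw_is0P e3; rewrite /vecZ_val e1 e2 e3 -vec3_0.
Qed.

Definition rows3 (u v w : 'cV[K]_3) : 'M[K]_3 := \matrix_(i, j) ([:: u; v; w]`_i) j 0.

Lemma mul_rows3 u1 u2 u3 v :
  rows3 u1 u2 u3 *m v = vec3 (dot u1 v) (dot u2 v) (dot u3 v).
Proof.
by apply/colP => -[[|[|[|//]]] lti]; rewrite !mxE /dot; apply: eq_bigr => j _; rewrite mxE.
Qed.

Definition matZ_val (A : matZ) : 'M[K]_3 :=
  rows3 (vecZ_val A.1.1) (vecZ_val A.1.2) (vecZ_val A.2).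

Lemma matZ_val_mul A B : matZ_val A *m matZ_val B = matZ_val (matZ_mul A B).
Proof.
have rowE u : vecZ_val (matZ_row u B) = zw_val u.1.1 *: vecZ_val B.1.1 +
    zw_val u.1.2 *: vecZ_val B.1.2 + zw_val u.2 *: vecZ_val B.2.
  by rewrite /matZ_row !vecZ_val_add !vecZ_val_scale.
apply/matrixP => -[[|[|[|//]]] lti] j; rewrite [RHS]mxE /= rowE !mxE !big_ord_recl big_ord0 !mxE;
  by rewrite /= addr0 addrA.
Qed.

End Interpretation.

(* Elements g of the group are encoded by the matrix 2 g, which has entries in Z[w]. *)
Definition matZ_map (h : zw -> zw) (A : matZ) : matZ :=
  let r (u : vecZ) := (h u.1.1, h u.1.2, h u.2) in (r A.1.1, r A.1.2, r A.2).
Definition matZ_half := matZ_map (fun x => (Z.div2 x.1, Z.div2 x.2)).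
Definition matZ_double := matZ_map (zw_mul (Zpos 2, Z0)).

Definition matZ_scalar2 : matZ :=
  let two : zw := (Zpos 2, Z0) in let z : zw := (Z0, Z0) in ((two, z, z), (z, two, z), (z, z, two)).

(* The reflection of normal n, when n has norm 4. *)
Definition matZ_refl (n : vecZ) : matZ :=
  let row e x := vecZ_add e (vecZ_scale (zw_opp x) n) in
  (row matZ_scalar2.1.1 n.1.1, row matZ_scalar2.1.2 n.1.2, row matZ_scalar2.2 n.2).

Definition axisX : vecZ := ((Zpos 2, Z0), (Z0, Z0), (Z0, Z0)).
Definition axisY : vecZ := ((Z0, Z0), (Zpos 2, Z0), (Z0, Z0)).
Definition axisZ : vecZ := ((Z0, Z0), (Z0, Z0), (Zpos 2, Z0)).
Definition oblique : vecZ := ((Z0, Zpos 1), (Zpos 1, Z0), (Zneg 1, Zpos 1)).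

Definition generatorsZ : seq matZ := [seq matZ_refl n | n <- [:: axisX; axisY; oblique]].

Definition normals : seq vecZ :=
  let sgn (n : vecZ) : seq vecZ :=
    [:: n; (zw_opp n.1.1, n.1.2, n.2); (n.1.1, zw_opp n.1.2, n.2); (n.1.1, n.1.2, zw_opp n.2)] in
  let rot (n : vecZ) : vecZ := (n.2, n.1.1, n.1.2) in
  [:: axisX; axisY; axisZ] ++ sgn oblique ++ sgn (rot oblique) ++ sgn (rot (rot oblique)).

(** A product of two encodings is 4 times a group element; it is halved, after a test that halving
    is exact. Each round treats words one letter longer. *)
Fixpoint group_closure (k : nat) (seen front : seq matZ) : seq matZ :=
  if k is k'.+1 then
    let prods := [seq matZ_mul s A | s <- generatorsZ, A <- front] in
    let new := [seq B <- undup (map matZ_half [seq M <- prods | matZ_double (matZ_half M) == M])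
               | B \notin seen] in
    group_closure k' (new ++ seen) new
  else seen.

(** The generators are simple reflections of type H3: their products two by two have orders 2, 3 and
    5. The longest element has length 15, hence the 15 rounds. *)
Definition group_list : seq matZ :=
  Eval vm_compute in group_closure 15 [:: matZ_scalar2] [:: matZ_scalar2].

Lemma group_listE : group_list = group_closure 15 [:: matZ_scalar2] [:: matZ_scalar2].
Proof. by vm_compute. Qed.

Lemma group_list_closed : all (fun s => all (fun A =>
  let M := matZ_mul s A in (matZ_double (matZ_half M) == M) && (matZ_half M \in group_list))
  group_list) generatorsZ.
Proof. by vm_compute. Qed.

Lemma normals_in_group : all (fun n => matZ_refl n \in group_list) normals.
Proof. by vm_compute. Qed.

(** If A encodes g, two independent rows of A - 2 = 2 (g - 1) bound the dimension of the fixed space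
    of g by 1. *)
Definition cross_rows (A : matZ) : bool :=
  let sub e u := vecZ_add u (vecZ_scale (Zneg 1, Z0) e) in
  let b1 := sub matZ_scalar2.1.1 A.1.1 in
  let b2 := sub matZ_scalar2.1.2 A.1.2 in
  let b3 := sub matZ_scalar2.2 A.2 in
  [|| vecZ_nonzero (vecZ_cross b1 b2), vecZ_nonzero (vecZ_cross b1 b3) |
      vecZ_nonzero (vecZ_cross b2 b3)].

Lemma group_list_classification : all (fun A =>
  [|| A == matZ_scalar2, has (fun n => A == matZ_refl n) normals | cross_rows A]) group_list.
Proof. by vm_compute. Qed.

Lemma matZ_refl_oblique (K : numFieldType) (w : K) : w * w = w + 1 ->
  2^-1 *: matZ_val w (matZ_refl oblique) = (-1 / 2) *: \matrix_(i < 3, j < 3)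
    (nth [::] [:: [:: w - 1; w; 1]; [:: w; -1; w - 1]; [:: 1; w - 1; - w]] i)`_j.
Proof.
move=> w2; have nz2 : (2 : K) != 0 by rewrite pnatr_eq0.
apply/matrixP => -[[|[|[|//]]] lti] -[[|[|[|//]]] ltj]; rewrite ?mxE /= ?mxE /zw_val /=;
  apply: (mulfI nz2); rewrite mulVKf // mulrA mulrCA divff // mulr1; ring: w2.
Qed.

Section IcosahedralGroup.
Variable R : realType.
Local Notation C := R[i].
Let w : C := omega R.

Lemma omega2 : omega R * omega R = omega R + 1.
Proof.
have s5 : Num.sqrt 5 * Num.sqrt 5 = 5 :> R by rewrite -expr2 sqr_sqrtr ?ler0n.
have E : (1 + Num.sqrt 5) / 2 * ((1 + Num.sqrt 5) / 2) = (1 + Num.sqrt 5) / 2 + 1 :> R.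
  by field: s5.
by rewrite /omega -(rmorphM (real_complex R)) E rmorphD rmorph1.
Qed.

Definition group_val (A : matZ) : 'M[C]_3 := 2^-1 *: matZ_val w A.

Lemma nz2 : (2 : C) != 0. Proof. by rewrite pnatr_eq0. Qed.

Lemma matZ_val_double A : matZ_val w (matZ_double A) = 2 *: matZ_val w A.
Proof.
have e2 : zw_val w (Zpos 2, Z0) = 2 by rewrite /zw_val /=; ring.
by apply/matrixP => -[[|[|[|//]]] lti] -[[|[|[|//]]] ltj]; rewrite ?mxE /= ?mxE /= (zw_valM omega2) e2.
Qed.

Lemma group_val_mul A B M : matZ_mul A B = M -> matZ_double (matZ_half M) = M ->
  group_val A *m group_val B = group_val (matZ_half M).
Proof.
move=> AB M2; rewrite /group_val -scalemxAl -scalemxAr (matZ_val_mul omega2) AB.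
have -> : matZ_val w M = 2 *: matZ_val w (matZ_half M) by rewrite -matZ_val_double M2.
by rewrite !scalerA mulfVK ?nz2.
Qed.

Lemma group_val_one : group_val matZ_scalar2 = 1%:M.
Proof.
by apply/matrixP => -[[|[|[|//]]] lti] -[[|[|[|//]]] ltj]; rewrite ?mxE /= ?mxE /zw_val /=; field.
Qed.

Lemma generators_val : @icosahedral_generators R = [set group_val s | s in [set` generatorsZ]].
Proof.
have gX : group_val (matZ_refl axisX) = mx3 [:: [:: -1; 0; 0]; [:: 0; 1; 0]; [:: 0; 0; 1]].
  by apply/matrixP => -[[|[|[|//]]] lti] -[[|[|[|//]]] ltj]; rewrite ?mxE /= ?mxE /zw_val /=; field.
have gY : group_val (matZ_refl axisY) = mx3 [:: [:: 1; 0; 0]; [:: 0; -1; 0]; [:: 0; 0; 1]].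
  by apply/matrixP => -[[|[|[|//]]] lti] -[[|[|[|//]]] ltj]; rewrite ?mxE /= ?mxE /zw_val /=; field.
have gO : group_val (matZ_refl oblique) = (-1 / 2) *: mx3 [:: [:: w - 1; w; 1]; [:: w; -1; w - 1]; [:: 1; w - 1; - w]].
  exact: matZ_refl_oblique omega2.
apply/seteqP; split => g /=; rewrite /icosahedral_generators /=.
  case=> [[->|->]|->]; [exists (matZ_refl axisX)|exists (matZ_refl axisY)|exists (matZ_refl oblique)];
    by rewrite ?inE ?eqxx ?orbT // -?gX -?gY -?gO.
by case=> s; rewrite !inE => /or3P[]/eqP -> <-; rewrite ?gX ?gY ?gO; [left; left|left; right|right].
Qed.

Definition all_generated (s : seq matZ) := forall A, A \in s -> icosahedral_group (group_val A).

Lemma group_closure_generated k seen front : all_generated seen -> all_generated front ->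
  all_generated (group_closure k seen front).
Proof.
elim: k seen front => [|k IHk] seen front Gs Gf; cbn [group_closure]; first exact: Gs.
set new := [seq B <- _ | _].
have Gn : all_generated new.
  move=> B; rewrite mem_filter => /andP[_]; rewrite mem_undup => /mapP[M + ->].
  rewrite mem_filter => /andP[/eqP M2 /allpairsP[[s A] /= [gen_s fA MsA]]].
  rewrite -(group_val_mul (esym MsA) M2); apply: GeneratedMul (Gf A fA).
  by apply: GeneratedGen; rewrite generators_val; exists s.
by apply: IHk => // A; rewrite mem_cat => /orP[/Gn|/Gs].
Qed.

Lemma group_list_in : all_generated group_list.
Proof.
have G1 : all_generated [:: matZ_scalar2].
  by move=> B; rewrite inE => /eqP ->; rewrite group_val_one; apply: GeneratedOne.
by rewrite group_listE; apply: group_closure_generated.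
Qed.

End IcosahedralGroup.

(** * Mirror lines *)

Lemma generated_mulmx_stable (K : fieldType) (n : nat) (X : set 'M[K]_n) (s : seq 'M[K]_n) g :
  (forall h, X h -> h \in unitmx /\ {in s, forall A, h *m A \in s}) ->
  generated_subgroup X g -> g \in unitmx /\ {in s, forall A, g *m A \in s}.
Proof.
move=> Xs; elim=> [h /Xs //||g1 g2 _ [u1 s1] _ [u2 s2]|h _ [uh sh]].
- by rewrite unitmx1; split=> // A sA; rewrite mul1mx.
- by rewrite unitmx_mul u1 u2; split=> // A sA; rewrite -mulmxA; apply/s1/s2.
rewrite unitmx_inv uh; split=> // A sA.
(* Multiplication by h is injective on a finite stable list, so it permutes the list and its inverse
   preserves it. *)
have inj_h : injective (fun B : 'M[K]_n => h *m B) := can_inj (mulKmx uh).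
pose s' := [seq h *m B | B <- undup s].
have uniq_s' : uniq s' by rewrite map_inj_uniq // undup_uniq.
have sub_s' : {subset s' <= undup s}.
  by move=> _ /mapP[B + ->]; rewrite !mem_undup; apply: sh.
have [|_ s'E] := uniq_min_size uniq_s' sub_s'; first by rewrite size_map.
have : A \in s' by rewrite s'E mem_undup.
by case/mapP=> B; rewrite mem_undup => sB ->; rewrite mulKmx.
Qed.

Section Planes.
Variable K : closedFieldType.
Implicit Types (l : proj_line K) (n v : 'cV[K]_3).

Definition is_plane l n := forall v, (v \in val l) = (dot n v == 0).

Lemma dim_le1 (U : {vspace 'cV[K]_3}) u : (forall v, v \in U -> exists c, v = c *: u) -> (\dim U <= 1)%N.
Proof.
move=> Uu; have : (U <= <[u]>)%VS by apply/subvP => v /Uu[c ->]; rewrite memvZ ?memv_line.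
by move/dimvS/leq_trans; apply; rewrite dim_vline leq_b1.
Qed.

Lemma cross_annihilator n1 n2 v : cross n1 n2 != 0 -> dot n1 v = 0 -> dot n2 v = 0 ->
  exists c, v = c *: cross n1 n2.
Proof.
move=> nz d1 d2; apply: cross0_scale nz _; move: d1 d2.
have [a1 [b1 [c1 ->]]] := vec3P n1; have [a2 [b2 [c2 ->]]] := vec3P n2.
have [x [y [z ->]]] := vec3P v; rewrite !cross_vec3 !dot_vec3 vec3_0 => d1 d2.
congr vec3.
- transitivity (a2 * (a1 * x + b1 * y + c1 * z) - a1 * (a2 * x + b2 * y + c2 * z)); first ring.
  by rewrite d1 d2; ring.
- transitivity (b2 * (a1 * x + b1 * y + c1 * z) - b1 * (a2 * x + b2 * y + c2 * z)); first ring.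
  by rewrite d1 d2; ring.
transitivity (c2 * (a1 * x + b1 * y + c1 * z) - c1 * (a2 * x + b2 * y + c2 * z)); first ring.
by rewrite d1 d2; ring.
Qed.

Lemma plane_exists n : n != 0 -> exists l, is_plane l n.
Proof.
move=> nz_n; pose f := linfun (mulmx n^T : 'cV[K]_3 -> 'cV[K]_1).
have fE v : f v = (dot n v)%:M.
  rewrite lfunE /=; apply/matrixP => i j; rewrite !ord1 !mxE mulr1n /dot.
  by apply: eq_bigr => k _; rewrite mxE.
have kerE v : (v \in lker f) = (dot n v == 0).
  by rewrite memv_ker fE; apply/eqP/eqP => [/matrixP/(_ 0 0)|->]; rewrite ?raddf0 // !mxE mulr1n.
have dim_ker : \dim (lker f) == 2%N.
  have := limg_ker_dim f fullv; rewrite capfv !dimvf !dim_matrix => dimE.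
  suff img1 : \dim (f @: fullv) = 1%N by move: dimE; rewrite img1 addn1 => -[->].
  apply/eqP; rewrite eqn_leq (leq_trans (dimvS (subvf _))) ?dimvf ?dim_matrix //=.
  rewrite lt0n dimv_eq0; have /cV0Pn[i ni] := nz_n.
  apply: contra_neq ni => img0; have : f (delta_mx i 0) \in (f @: fullv)%VS by rewrite memv_img ?memvf.
  rewrite img0 memv0 -memv_ker kerE /dot (bigD1 i) //= mxE !eqxx mulr1 big1 ?addr0 => [/eqP //|k /negPf nk].
  by rewrite mxE nk mulr0.
by exists (exist _ (lker f) dim_ker).
Qed.

Lemma is_plane_inj l l' n : is_plane l n -> is_plane l' n -> l = l'.
Proof. by move=> ln l'n; apply/val_inj/vspaceP => v; rewrite ln l'n. Qed.

(** All vectors [cross n e] lie in the plane; their orthogonality to n', for e a basis vector, is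
    the vanishing of a coordinate of [cross n n']. *)
Lemma is_plane_cross l n n' : is_plane l n -> is_plane l n' -> cross n n' = 0.
Proof.
move=> ln ln'; apply/eqP; apply: contraT => /cV0Pn[i nz].
pose e : 'cV[K]_3 := delta_mx i 0.
have : cross n e \in val l by rewrite ln dotC dot_crossl.
rewrite ln' -[dot _ _]/(dot n' (cross n e)) dotC -/(det3 n e n') det3_rot det3_rot.
have eE k : e k 0 = (k == i)%:R by rewrite mxE eqxx andbT.
rewrite det3_swap oppr_eq0 /det3 /dot (bigD1 i) //= eE eqxx mulr1 big1 ?addr0 ?(negPf nz) //.
by move=> k /negPf nk; rewrite eE nk mulr0.
Qed.

End Planes.

Section MirrorLines.
Variable R : realType.
Local Notation C := R[i].
Let w : C := omega R.
Let w2 : w * w = w + 1 := omega2 R.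

Lemma generatorsZ_involutive :
  all (fun s => let M := matZ_mul s s in
    (matZ_double (matZ_half M) == M) && (matZ_half M == matZ_scalar2)) generatorsZ.
Proof. by vm_compute. Qed.

Lemma icosahedral_group_list g : icosahedral_group (R := R) g ->
  exists2 A, A \in group_list & g = group_val R A.
Proof.
move/(@generated_mulmx_stable _ _ _ (map (group_val R) group_list)) => -[h|_ gs].
  rewrite generators_val => -[s gen_s <-].
  have /andP[/eqP M2 /eqP M1] := allP generatorsZ_involutive s gen_s; split.
    by have [] := mulmx1_unit (etrans (group_val_mul R (erefl _) M2) (etrans (congr1 _ M1) (group_val_one R))).
  move=> B /mapP[A GA ->{B}].
  have /allP/(_ A GA)/andP[/eqP N2 GN] := allP group_list_closed s gen_s.
  by rewrite (group_val_mul R (erefl _) N2) map_f.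
have /mapP[A GA gA] : g \in map (group_val R) group_list.
  (* The list contains the identity and is stable under left multiplication by g, so it contains
     g. *)
  rewrite -[g]mulmx1 -(group_val_one R); apply: gs; apply: map_f.
  by vm_compute.
by exists A.
Qed.

Lemma group_val_refl n (nv := vecZ_val w n) v :
  group_val R (matZ_refl n) *m v = v - (2^-1 * dot nv v) *: nv.
Proof.
have nz2 := nz2 R.
have two : zw_val w (Zpos 2, Z0) = 2 by rewrite /zw_val /=; ring.
have zero : zw_val w (Z0, Z0) = 0 by rewrite /zw_val /=; ring.
rewrite /group_val -scalemxAl mul_rows3 /matZ_refl /=.
rewrite !(vecZ_val_add, vecZ_val_scale w2) !(zw_valN) /vecZ_val /= two zero -/nv.
have [x [y [z ->]]] := vec3P v; rewrite /nv /vecZ_val !(scale_vec3, add_vec3, dot_vec3).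
by rewrite sub_vec3; congr vec3; field; rewrite ?nz2.
Qed.


Lemma normals_nonzero : all vecZ_nonzero normals.
Proof. by vm_compute. Qed.

Let normal_neq0 n : n \in normals -> vecZ_val w n != 0.
Proof. by move/(allP normals_nonzero)/(vecZ_nonzeroP w2). Qed.

Let fixedE g v : (v \in fixedSpace (linfun (mulmx g : 'cV[C]_3 -> 'cV[C]_3))) = (g *m v == v).
Proof. by apply/fixedSpaceP/eqP; rewrite lfunE. Qed.

Let fixed_reflE n v : n \in normals ->
  (group_val R (matZ_refl n) *m v == v) = (dot (vecZ_val w n) v == 0).
Proof.
move=> /normal_neq0 nz_n; rewrite group_val_refl -subr_eq0 addrAC subrr add0r oppr_eq0.
by rewrite scaler_eq0 (negPf nz_n) orbF mulf_eq0 invr_eq0 (negPf (nz2 R)).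
Qed.

Let cross_rows_fixed A : cross_rows A -> (\dim (fixedSpace (linfun
  (mulmx (group_val R A) : 'cV[C]_3 -> 'cV[C]_3))) <= 1)%N.
Proof.
pose sub e u := vecZ_add u (vecZ_scale (Zneg 1, Z0) e).
have subE e u v : dot (vecZ_val w (sub e u)) v = dot (vecZ_val w u) v - dot (vecZ_val w e) v.
  have m1 : zw_val w (Zneg 1, Z0) = -1 by rewrite /zw_val /=; ring.
  rewrite vecZ_val_add (vecZ_val_scale w2) m1 /dot -sumrB.
  by apply: eq_bigr => i _; rewrite !mxE; ring.
have two : zw_val w (Zpos 2, Z0) = 2 by rewrite /zw_val /=; ring.
have zero : zw_val w (Z0, Z0) = 0 by rewrite /zw_val /=; ring.
have ann b1 b2 : vecZ_nonzero (vecZ_cross b1 b2) ->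
    (forall v, v \in fixedSpace (linfun (mulmx (group_val R A) : 'cV[C]_3 -> 'cV[C]_3)) ->
      dot (vecZ_val w b1) v = 0 /\ dot (vecZ_val w b2) v = 0) ->
    (\dim (fixedSpace (linfun (mulmx (group_val R A) : 'cV[C]_3 -> 'cV[C]_3))) <= 1)%N.
  move=> /(vecZ_nonzeroP w2); rewrite -(vecZ_val_cross w2) => nz fix_b.
  by apply: dim_le1 => v /fix_b[d1 d2]; apply: cross_annihilator nz d1 d2.
have fix_rows v : v \in fixedSpace (linfun (mulmx (group_val R A) : 'cV[C]_3 -> 'cV[C]_3)) ->
    [/\ dot (vecZ_val w (sub matZ_scalar2.1.1 A.1.1)) v = 0,
        dot (vecZ_val w (sub matZ_scalar2.1.2 A.1.2)) v = 0 &
        dot (vecZ_val w (sub matZ_scalar2.2 A.2)) v = 0].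
  rewrite fixedE /group_val -scalemxAl mul_rows3 => /eqP/(congr1 ( *:%R 2)).
  have [e1 e2 e3] : [/\ vecZ_val w matZ_scalar2.1.1 = vec3 2 0 0,
      vecZ_val w matZ_scalar2.1.2 = vec3 0 2 0 & vecZ_val w matZ_scalar2.2 = vec3 0 0 2].
    by rewrite /vecZ_val -two -zero.
  rewrite scalerA divff ?(nz2 R) // scale1r !subE e1 e2 e3.
  have [x [y [z ->]]] := vec3P v; rewrite scale_vec3 => /vec3_inj[-> -> ->].
  by rewrite !dot_vec3; split; ring.
by case/or3P=> nz; apply: ann nz _ => v /fix_rows[].
Qed.

Lemma mirror_lineP l : icosahedral_lines (R := R) l <->
  exists2 n, n \in normals & is_plane l (vecZ_val w n).
Proof.
split=> [[g /icosahedral_group_list[A GA ->] lE]|[n Nn ln]].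
  case/or3P: (allP group_list_classification A GA) => [/eqP A1|/hasP[n Nn /eqP An]|/cross_rows_fixed].
  - have : val l = fullv.
      by apply/vspaceP => v; rewrite lE A1 group_val_one fixedE mul1mx eqxx memvf.
    by move/(congr1 (fun U : {vspace _} => \dim U)); rewrite (eqP (valP l)) dimvf dim_matrix.
  - by exists n => // v; rewrite lE An fixedE fixed_reflE.
  by rewrite -lE (eqP (valP l)).
exists (group_val R (matZ_refl n)); first by apply/group_list_in/(allP normals_in_group).
by apply/vspaceP => v; rewrite fixedE fixed_reflE // ln.
Qed.

End MirrorLines.

(** * Singular points *)

Definition quintupleZ : seq vecZ :=
  let o : zw := (Z0, Z0) in let i : zw := (Zpos 1, Z0) in
  let w : zw := (Z0, Zpos 1) in let w' : zw := (Z0, Zneg 1) in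
  [:: (i, w, o); (i, w', o); (o, i, w); (o, i, w'); (w, o, i); (w', o, i)].

Definition tripleZ : seq vecZ :=
  let o : zw := (Z0, Z0) in let i : zw := (Zpos 1, Z0) in let i' : zw := (Zneg 1, Z0) in
  let w : zw := (Z0, Zpos 1) in let w' : zw := (Z0, Zneg 1) in
  let v : zw := (Zneg 1, Zpos 1) in
  [:: (i, i, i); (i', i, i); (i, i', i); (i, i, i'); (w, v, o); (w', v, o); (o, w, v); (o, w', v);
      (v, o, w); (v, o, w')].

Definition doubleZ : seq vecZ :=
  let o : zw := (Z0, Z0) in let i : zw := (Zpos 1, Z0) in let i' : zw := (Zneg 1, Z0) in
  let w : zw := (Z0, Zpos 1) in let w' : zw := (Z0, Zneg 1) in
  let v : zw := (Zneg 1, Zpos 1) in let v' : zw := (Zpos 1, Zneg 1) in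
  [:: (i, o, o); (o, i, o); (o, o, i); (w, i, v); (w', i, v); (w, i', v); (w, i, v');
      (v, w, i); (v, w', i); (v, w, i'); (v', w, i); (i, v, w); (i, v, w'); (i', v, w); (i, v', w)].

Definition pointsZ := quintupleZ ++ tripleZ ++ doubleZ.

Definition normals_at (P : vecZ) : seq vecZ := [seq n <- normals | zw_is0 (vecZ_dot n P)].

Lemma pointsZ_nonzero : all vecZ_nonzero pointsZ.
Proof. by vm_compute. Qed.

Lemma pointsZ_distinct : pairwise (fun P Q => vecZ_nonzero (vecZ_cross P Q)) pointsZ.
Proof. by vm_compute. Qed.

Lemma normals_distinct : pairwise (fun n m => vecZ_nonzero (vecZ_cross n m)) normals.
Proof. by vm_compute. Qed.

(** Any two mirrors meet at a listed point, so no singular point is missed. *)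
Lemma normals_meet : pairwise (fun n m =>
  has (fun P => vecZ_is0 (vecZ_cross P (vecZ_cross n m))) pointsZ) normals.
Proof. by vm_compute. Qed.

(** The zero test and the norm test are one-sided certificates; since one of them always succeeds,
    orthogonality in K becomes computable. *)
Lemma normals_dot : all (fun P => all (fun n =>
  let d := vecZ_dot n P in zw_is0 d || zw_isunit d) normals) pointsZ.
Proof. by vm_compute. Qed.

Lemma normals_at_quintuple : all (fun P => size (normals_at P) == 5%N) quintupleZ.
Proof. by vm_compute. Qed.

Lemma normals_at_triple : all (fun P => size (normals_at P) == 3%N) tripleZ.
Proof. by vm_compute. Qed.

Lemma normals_at_double : all (fun P => size (normals_at P) == 2%N) doubleZ.
Proof. by vm_compute. Qed.

Lemma pairwise_neq (T : eqType) (r : rel T) s x y : pairwise r s -> x \in s -> y \in s -> x != y ->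
  r x y || r y x.
Proof.
move=> rs sx sy neq; have := neq; rewrite -(nth_index x sx) -(nth_index x sy) => {}neq.
have [ltxy|ltyx|eqxy] := ltngtP (index x s) (index y s); last by rewrite eqxy eqxx in neq.
  by rewrite (pairwiseP x rs) ?inE ?index_mem.
by rewrite orbC (pairwiseP x rs) ?inE ?index_mem.
Qed.

Section PointVectors.
Variables (K : numClosedFieldType) (w : K).
Hypothesis w2 : w * w = w + 1.

Lemma point_val_neq0 P : P \in pointsZ -> vecZ_val w P != 0.
Proof. by move/(allP pointsZ_nonzero)/(vecZ_nonzeroP w2). Qed.

Lemma normal_val_neq0 n : n \in normals -> vecZ_val w n != 0.
Proof. by move/(allP normals_nonzero)/(vecZ_nonzeroP w2). Qed.

Lemma crossvv (u : 'cV[K]_3) c : cross u (c *: u) = 0.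
Proof.
by have [x [y [z ->]]] := vec3P u; rewrite scale_vec3 cross_vec3 vec3_0; congr vec3; ring.
Qed.

Lemma crossZr (u v : 'cV[K]_3) c : cross u (c *: v) = c *: cross u v.
Proof.
have [x [y [z ->]]] := vec3P u; have [x' [y' [z' ->]]] := vec3P v.
by rewrite !(scale_vec3, cross_vec3); congr vec3; ring.
Qed.

Lemma cross_pairwise s P Q : pairwise (fun P Q => vecZ_nonzero (vecZ_cross P Q)) s ->
  P \in s -> Q \in s -> P != Q -> cross (vecZ_val w P) (vecZ_val w Q) != 0.
Proof.
move=> s_dist sP sQ /(pairwise_neq s_dist sP sQ)/orP[] /(vecZ_nonzeroP w2).
  by rewrite (vecZ_val_cross w2).
by rewrite [cross (vecZ_val w P) _]crossN oppr_eq0 (vecZ_val_cross w2).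
Qed.

Lemma normals_meetP n m : n \in normals -> m \in normals -> n != m ->
  exists2 P, P \in pointsZ & cross (vecZ_val w P) (cross (vecZ_val w n) (vecZ_val w m)) = 0.
Proof.
move=> Nn Nm /(pairwise_neq normals_meet Nn Nm)/orP[] /hasP[P PP P0]; exists P => //;
  have := vecZ_is0P w P0; rewrite -!(vecZ_val_cross w2) // => E.
by rewrite [cross (vecZ_val w n) _]crossN -scaleN1r crossZr E scaler0.
Qed.

Lemma point_val_dot n P : P \in pointsZ -> n \in normals ->
  (dot (vecZ_val w n) (vecZ_val w P) == 0) = (n \in normals_at P).
Proof.
move=> PP Nn; rewrite (vecZ_val_dot w2) mem_filter Nn andbT.
have /orP[z|nz] := allP (allP normals_dot P PP) n Nn.
  by rewrite z (zw_is0P w z) eqxx.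
have := zw_isunitP w2 nz; case: (boolP (zw_is0 _)) => [/(zw_is0P w) ->|_ /negPf //].
by rewrite eqxx.
Qed.

End PointVectors.

Local Open Scope card_scope.

Section Points.
Variable R : realType.
Local Notation C := R[i].
Let w : C := omega R.
Let w2 : w * w = w + 1 := omega2 R.

Definition lies_at (p : proj_point C) (P : vecZ) := val p = <[vecZ_val w P]>%VS.

Let point_neq0 := point_val_neq0 w2.
Let normal_neq0 := normal_val_neq0 w2.
Let cross_normals n m := @cross_pairwise C w w2 normals n m normals_distinct.
Let cross_points P Q := @cross_pairwise C w w2 pointsZ P Q pointsZ_distinct.

Lemma lies_at_inj p P Q : P \in pointsZ -> Q \in pointsZ -> lies_at p P -> lies_at p Q -> P = Q.
Proof.
move=> PP PQ pP pQ; apply/eqP; apply: contraT => /(cross_points PP PQ)/eqP; case.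
have : vecZ_val w Q \in <[vecZ_val w P]>%VS by rewrite -pP pQ memv_line.
by case/vlineP => c ->; rewrite crossvv.
Qed.

Lemma lies_at_exists P : P \in pointsZ -> exists p, lies_at p P.
Proof.
move=> /point_neq0 nz_P; have d1 : \dim <[vecZ_val w P]> == 1%N by rewrite dim_vline nz_P.
by exists (exist _ <[vecZ_val w P]>%VS d1).
Qed.

Lemma on_plane p P n l : P \in pointsZ -> lies_at p P -> n \in normals ->
  is_plane l (vecZ_val w n) -> on_line p l <-> n \in normals_at P.
Proof.
by move=> PP pP Nn ln; rewrite /on_line pP -memvE ln (point_val_dot w2 PP Nn).
Qed.

Lemma lines_through_normals p P : P \in pointsZ -> lies_at p P ->
  exists2 s : seq (proj_line C), uniq s /\ size s = size (normals_at P) &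
    lines_through p = [set l | l \in s].
Proof.
move=> PP pP; have : forall n, exists l, vecZ_val w n != 0 -> is_plane l (vecZ_val w n).
  move=> n; have [->|/plane_exists[l ln]] := eqVneq (vecZ_val w n) 0; last by exists l.
  (* The choice function is total, so a vanishing vector is given an arbitrary line. *)
  have /normal_neq0/plane_exists[l _] : axisX \in normals by [].
  by exists l => /eqP.
case/choice=> pl plP; have plN n : n \in normals -> is_plane (pl n) (vecZ_val w n).
  by move/normal_neq0/plP.
have sub_N : {subset normals_at P <= normals} by apply: mem_subseq; apply: filter_subseq.
have uniq_N : uniq (normals_at P) by rewrite filter_uniq.
exists (map pl (normals_at P)); [split|].
- rewrite map_inj_in_uniq // => n m /sub_N Nn /sub_N Nm eq_pl.
  apply/eqP; apply: contraT => /(cross_normals Nn Nm)/eqP; case.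
  by apply: (@is_plane_cross _ (pl n)); [apply: plN | rewrite eq_pl; apply: plN].
- by rewrite size_map.
apply/seteqP; split=> [l [/mirror_lineP[n Nn ln] pl_l]|l /mapP[n Pn ->]] /=.
  apply/mapP; exists n; first exact/(on_plane PP pP Nn ln).
  by apply: (is_plane_inj ln); apply: plN.
have Nn := sub_N _ Pn; split; last exact/(on_plane PP pP Nn (plN _ Nn)).
by apply/mirror_lineP; exists n => //; apply: plN.
Qed.

Lemma lines_through_card p P : P \in pointsZ -> lies_at p P ->
  lines_through p #= `I_(size (normals_at P)).
Proof.
move=> PP pP; have [s [us <-] ->] := lines_through_normals PP pP.
have -> : [set l | l \in s] = [set` [fset l in s]%fset].
  by apply/seteqP; split=> l; rewrite /= inE.
by apply/card_eq_fsetP; rewrite card_fseq undup_id.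
Qed.

Lemma normals_at_gt1 P : P \in pointsZ -> (1 < size (normals_at P))%N.
Proof.
rewrite !mem_cat => /or3P[/(allP normals_at_quintuple)|/(allP normals_at_triple)|
  /(allP normals_at_double)] /eqP -> //.
Qed.

Lemma singular_pointP p : singular_points p <-> exists2 P, P \in pointsZ & lies_at p P.
Proof.
split=> [[l1 [l2 [[/mirror_lineP[n Nn ln] pl1] [/mirror_lineP[m Nm lm] pl2] neq]]]|[P PP pP]].
  have nm : n != m by apply: contra_neq neq => nm; apply: (is_plane_inj ln); rewrite nm.
  have [P PP P0] := normals_meetP w2 Nn Nm nm.
  have nz_nm := cross_normals Nn Nm nm.
  have [c' nmE] := cross0_scale (point_neq0 PP) P0.
  have [c pE] : exists c, point_vec p = c *: cross (vecZ_val w n) (vecZ_val w m).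
    apply: (cross_annihilator nz_nm); apply/eqP; [rewrite -ln | rewrite -lm];
      by [apply: (subvP pl1); rewrite memv_pick | apply: (subvP pl2); rewrite memv_pick].
  exists P => //; rewrite /lies_at point_line; apply/eqP.
  rewrite eqEdim !dim_vline point_vec_neq0 leq_b1 andbT -memvE.
  by apply/vlineP; exists (c * c'); rewrite -scalerA -nmE.
have [s [us ss] sE] := lines_through_normals PP pP.
have := normals_at_gt1 PP; rewrite -ss; case: s us sE {ss} => [|l1 [|l2 s]] //= /andP[].
rewrite inE negb_or => /andP[neq _] _ lE _; exists l1, l2.
by rewrite lE /= !inE !eqxx orbT.
Qed.

(** This is what makes [fset_set] return the actual singular points in [singular_fset]. *)
Lemma finite_singular : finite_set (@singular_points R).
Proof.
have : forall P, exists p, P \in pointsZ -> lies_at p P.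
  move=> P; have [/lies_at_exists[p pP]|_] := boolP (P \in pointsZ); first by exists p.
  have /lies_at_exists[p _] : nth axisX pointsZ 0 \in pointsZ by [].
  by exists p.
case/choice=> pt ptP; apply: (@sub_finite_set _ _ [set` [fset pt P | P in pointsZ]%fset]) => //.
move=> p /singular_pointP[P PP pP]; apply/imfsetP; exists P => //=.
by apply: val_inj; rewrite pP (ptP P PP).
Qed.

End Points.

(** * Nefness and the Waldschmidt constant *)

Lemma ternary_eval_00 (A : comNzRingType) s (z : A) :
  ternary_eval s 0 0 z =
  \sum_(t <- [seq t <- s | t.2.1 == (0, 0)%N]) Z_to_ring A t.1 * z ^+ t.2.2.
Proof.
rewrite big_filter [RHS]big_mkcond; apply: eq_bigr => -[c [[[|i] [|j]] k]] _ /=;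
  by rewrite ?expr0 ?(expr0n _ _.+1) /= ?mul1r // !(mulr0, mul0r).
Qed.

Section PointTriples.
Variables (K : numClosedFieldType) (w : K).
Hypothesis w2 : w * w = w + 1.

Definition triple_val (u : vecZ) : K * K * K := (zw_val w u.1.1, zw_val w u.1.2, zw_val w u.2).

Let zwE : ((zw_val w (Z0, Z0) = 0) * (zw_val w (Zpos 1, Z0) = 1) * (zw_val w (Zneg 1, Z0) = -1) *
  (zw_val w (Z0, Zpos 1) = w) * (zw_val w (Z0, Zneg 1) = - w) *
  (zw_val w (Zneg 1, Zpos 1) = w - 1) * (zw_val w (Zpos 1, Zneg 1) = 1 - w))%type.
Proof. by do !split; rewrite /zw_val /=; ring. Qed.

Lemma quintupleZ_val : map triple_val quintupleZ = quintuple_points w.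
Proof. by rewrite /quintupleZ !map_cons /triple_val ![(_, _).1]/= ![(_, _).2]/= !zwE. Qed.

Lemma tripleZ_val : map triple_val tripleZ = triple_points w.
Proof. by rewrite /tripleZ !map_cons /triple_val ![(_, _).1]/= ![(_, _).2]/= !zwE. Qed.

Lemma doubleZ_val : map triple_val doubleZ = double_points w.
Proof. by rewrite /doubleZ !map_cons /triple_val ![(_, _).1]/= ![(_, _).2]/= !zwE. Qed.

(* At a common zero of the invariants of degrees 2 and 6, P30 and F80 are powers of the
   invariant of degree 10, which does not vanish there. *)
Lemma ico110_neq0 : ico110 w != 0.
Proof.
(* The vector (w, 1, z) kills the factor x^2 - w^2 y^2 of the sextic, and z is chosen to kill Q. *)
pose z := sqrtC (- (w + 2)); pose v : 'I_3 -> K := fun i => vec3 w 1 z i 0.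
have zz : z ^+ 2 = - (w + 2) by rewrite sqrtCK.
have coordE k : (k < 3)%N -> (coord3 K k).@[v] = [:: w; 1; z]`_k.
  by move=> ltk; rewrite /coord3 mevalXU /v vec3_inord.
pose g := inv10 w w 1 z.
have nz_g : g != 0.
  (* Only z^2 enters the value, so it lies in Z[w], and its norm is computed to be nonzero. *)
  have -> : g = zw_val w (foldr zw_mul (Zpos 4, Z0) [:: (Zneg 29, Zpos 18); (Zpos 8, Zpos 12);
      (Zneg 4, Zneg 8); (Zneg 4, Zneg 4); (Zpos 4, Zpos 4)]).
    rewrite !(zw_valM w2) /zw_val /= /g /inv10.
    transitivity ((18 * w - 29) * ((w ^+ 2 - w ^+ 4 * z ^+ 2) * (1 - w ^+ 6) * (z ^+ 2 - w ^+ 4) *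
      (((w + 1) ^+ 2 - z ^+ 2) * ((w - 1) ^+ 2 - z ^+ 2)))); first by ring.
    by rewrite zz; ring: w2.
  by apply: (zw_isunitP w2); vm_compute.
have formE s : (ico_form w s).@[v] = ternary_eval s 0 0 g.
  rewrite /ico_form (rmorph_ternary_eval (meval v)); congr ternary_eval.
  - by rewrite /ico2 /inv2 !rmorphD !rmorphXn /= !coordE //= zz; ring: w2.
  - by rewrite /ico6 /inv6 !(rmorph_nat, rmorphXn, rmorphB, rmorphM) /= !mevalC !coordE //=; ring: w2.
  by rewrite /ico10 /inv10 !(rmorph_nat, rmorphXn, rmorphB, rmorphM, rmorphD) /= !mevalC !coordE.
have Zn0 c k : c <> Z0 -> Z_to_ring K c * g ^+ k != 0.
  by case: c => // q _; rewrite mulf_neq0 ?expf_neq0 //= ?oppr_eq0; apply: Z_to_ring_neq0 q.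
apply/eqP => /(congr1 (meval v)); rewrite meval0 mevalM !formE !ternary_eval_00.
have -> : [seq t <- P30 | t.2.1 == (0, 0)%N] = [:: (Zneg 25, (0, 0, 3))]%N by [].
have -> : [seq t <- F80 | t.2.1 == (0, 0)%N] = [:: (Zpos 125, (0, 0, 8))]%N by [].
by rewrite !big_seq1 => /eqP; apply/negP/mulf_neq0; apply: Zn0.
Qed.

End PointTriples.

(* D = 40 H - \sum_p weight(k_p) E_p, with k_p lines through p. *)
Definition weight (k : nat) : nat := if k == 5 then 5 else if k == 3 then 7 else 8.

Lemma sum_weights : (\sum_(P <- pointsZ) weight (size (normals_at P)) = 220)%N.
Proof. by rewrite unlock; vm_compute. Qed.

Section Conditions.
Variable R : realType.
Local Notation C := R[i].
Let w : C := omega R.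
Let w2 : w * w = w + 1 := omega2 R.

Lemma point_conditions p P : P \in pointsZ -> lies_at p P ->
  [/\ ideal_exp (point_ideal p) 20 (ico110 w),
      ideal_exp (point_ideal p) (6 * weight (size (normals_at P))) (ico240 w) &
      ideal_exp (point_ideal p) (6 * weight (size (normals_at P))) (ico240' w)].
Proof.
move=> PP pP; have at_tr L : P \in L -> at_point (map (triple_val w) L) p.
  move=> LP; have : point_vec p \in val p by rewrite memv_pick.
  rewrite pP => /vlineP[c pE]; exists c; exists (triple_val w P) => //.
  exact: map_f.
move: PP; rewrite !mem_cat => /or3P[] LP; have := at_tr _ LP.
- rewrite (quintupleZ_val w) (eqP (allP normals_at_quintuple _ LP)) => /(ideal_exp_at_quintuple w2).
  by case.
- rewrite (tripleZ_val w) (eqP (allP normals_at_triple _ LP)) => /(ideal_exp_at_triple w2).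
  by case.
rewrite (doubleZ_val w) (eqP (allP normals_at_double _ LP)) => /(ideal_exp_at_double w2).
by case.
Qed.

(** The pencil consists of sections of 6 D, so Bezout's inequality is divided by 6. *)
Lemma conditions_degree (I : finType) (p : I -> proj_point C) (P : I -> vecZ) (m : I -> nat) e f :
  injective p -> (forall i, P i \in pointsZ /\ lies_at (p i) (P i)) ->
  f != 0 -> f \is e.-homog -> (forall i, ideal_exp (point_ideal (p i)) (m i) f) ->
  (\sum_i m i * weight (size (normals_at (P i))) <= 40 * e)%N.
Proof.
move=> inj_p pP nz_f fe fm; have [base baseP] := base_locus_finite w2.
pose n i := (6 * weight (size (normals_at (P i))))%N.
have bound : (\sum_i m i * n i <= e * 240)%N.
  apply: (pencil_bezout inj_p nz_f fe (ico240_homog w) (ico240'_homog w) baseP fm) => i;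
    by have [/point_conditions PP /PP[]] := pP i.
have : (6 * (\sum_i m i * weight (size (normals_at (P i)))) <= 6 * (40 * e))%N.
  rewrite big_distrr /= mulnCA (_ : (40 * (6 * e) = e * 240)%N); last by lia.
  by apply: leq_trans bound; apply: leq_sum => i _; rewrite /n mulnCA.
by rewrite leq_mul2l.
Qed.

Local Open Scope card_scope.

Lemma singular_fsetP p : p \in singular_fset R <-> exists2 P, P \in pointsZ & lies_at p P.
Proof. by rewrite /singular_fset in_fset_set ?inE; [exact: singular_pointP|exact: finite_singular]. Qed.

Local Notation X := (singular_fset R).

Let coef (q : X) (D : Pic X) : int := D.2 q.

Let coef_additive q : {morph coef q : D E / D + E}.
Proof. by move=> D E; rewrite /coef /= ffunE. Qed.

Let coefMn q D k : coef q (D *+ k) = coef q D *+ k.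
Proof. by elim: k => [|k IHk]; rewrite ?mulr0n /coef ?ffunE // !mulrS -IHk /coef /= ffunE. Qed.

Let coefN q D : coef q (- D) = - coef q D.
Proof. by rewrite /coef /= ffunE. Qed.

Let coef_sum q (r : pred X) (F : X -> Pic X) : coef q (\sum_(p | r p) F p) = \sum_(p | r p) coef q (F p).
Proof. by apply: (big_morph _ (coef_additive q)); rewrite /coef ffunE. Qed.

Let coef_exceptional q p : coef q (exceptional p) = (q == p)%:R.
Proof. by rewrite /coef ffunE. Qed.

Let coef_hyperplane q : coef q (hyperplane X) = 0.
Proof. by rewrite /coef ffunE. Qed.

Let degMn (D : Pic X) k : (D *+ k).1 = D.1 *+ k.
Proof. by elim: k => // k IHk; rewrite !mulrS -IHk. Qed.

Let deg_sum (r : pred X) (F : X -> Pic X) : (\sum_(p | r p) F p).1 = \sum_(p | r p) (F p).1.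
Proof. exact: (big_morph (fun D : Pic X => D.1) (fun D E => erefl) erefl). Qed.

Lemma divisor_D_deg : (divisor_D R).1 = 40.
Proof.
rewrite /divisor_D /exceptional_sum /= !degMn !deg_sum !big1 //.
Qed.

Lemma divisor_D_coef q P : P \in pointsZ -> lies_at (val q) P ->
  (divisor_D R).2 q = - (weight (size (normals_at P)))%:Z.
Proof.
move=> PP qP; rewrite -/(coef q _) /divisor_D 3!coef_additive !coefN !coefMn coef_hyperplane mul0rn add0r.
have excE k : coef q (exceptional_sum R k) = (k == size (normals_at P))%:R.
  rewrite /exceptional_sum coef_sum big_mkcond (bigD1 q) //= big1 ?addr0 => [|p /negPf np].
    rewrite (card_eql (lines_through_card PP qP)) coef_exceptional eqxx eq_sym.
    by rewrite (sameP card_eq_II eqP); case: eqP.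
  by rewrite coef_exceptional eq_sym np if_same.
rewrite !excE; move: PP; rewrite !mem_cat => /or3P[] LP.
- by rewrite (eqP (allP normals_at_quintuple _ LP)).
- by rewrite (eqP (allP normals_at_triple _ LP)).
by rewrite (eqP (allP normals_at_double _ LP)).
Qed.

Lemma divisor_D_nef : nef (divisor_D R).
Proof.
have /choice[P PP] : forall q : X, exists P, P \in pointsZ /\ lies_at (val q) P.
  by move=> q; have /singular_fsetP[P PP qP] := valP q; exists P.
have coefE q : (divisor_D R).2 q = - (weight (size (normals_at (P q))))%:Z.
  by have [Pq qP] := PP q; apply: divisor_D_coef.
case=> [q|C0]; rewrite /intersection divisor_D_deg.
  have excE p : (exceptional q).2 p = (p == q)%:R by apply: coef_exceptional.
  rewrite mulr0 sub0r (bigD1 q) // big1 => [|p /negPf np]; last by rewrite excE np mulr0.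
  by rewrite excE eqxx mulr1 coefE [X in - X]addr0 opprK.
have degE : (curve_class (StrictTransform X C0)).1 = (curve_deg C0)%:Z.
  by rewrite /= degMn deg_sum big1 ?subr0 ?natz // => p _; rewrite degMn mul0rn.
have multE q : (curve_class (StrictTransform X C0)).2 q = - (multiplicity C0 (val q))%:Z.
  rewrite -/(coef q _) /= coef_additive coefN coefMn coef_hyperplane mul0rn add0r coef_sum.
  rewrite (bigD1 q) // big1 => [|p /negPf np]; rewrite coefMn coef_exceptional.
    by rewrite eqxx [X in - X]addr0 -natz.
  by rewrite eq_sym np mul0rn.
rewrite degE (eq_bigr (fun q => (multiplicity C0 (val q) * weight (size (normals_at (P q))))%N%:Z)).
  rewrite -(big_morph Posz PoszD erefl) subr_ge0 -PoszM lez_nat.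
  apply: (conditions_degree val_inj PP (curve_neq0 C0) (curve_homog C0)) => q.
  (* If the order were undefined, its default value 0 would ask for membership in the zeroth power,
     which is the whole ring. *)
  by rewrite /multiplicity; case: xgetP => // m _ [].
by move=> q _; rewrite coefE multE mulrNN mulrC PoszM.
Qed.

Lemma symbolic_power_degree m t : has_form_of_degree (symbolic_power (@singular_points R) m) t ->
  (11 * m <= 2 * t)%N.
Proof.
move=> [f [nz_f ft fm]].
have PP (i : 'I_(size pointsZ)) : nth axisX pointsZ i \in pointsZ by apply: mem_nth.
have /choice[pt ptP] : forall i : 'I_(size pointsZ), exists p, lies_at (R := R) p (nth axisX pointsZ i).
  by move=> i; apply: lies_at_exists.
have inj_pt : injective pt.
  move=> i j eq_pt; apply/val_inj/eqP; rewrite /= -(nth_uniq axisX _ _ (_ : uniq pointsZ)) //.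
  apply/eqP; apply: (lies_at_inj (PP i) (PP j) (ptP i)); rewrite eq_pt; exact: ptP.
have := conditions_degree inj_pt (fun i => conj (PP i) (ptP i)) nz_f ft (m := fun=> m).
have -> : (\sum_(i < size pointsZ) m * weight (size (normals_at (nth axisX pointsZ i))) = m * 220)%N.
  by rewrite -big_distrr -sum_weights (big_nth axisX) big_mkord.
move=> bound; suff : (m * 220 <= 40 * t)%N by lia.
by apply: bound => i; apply: fm; apply/singular_pointP; exists (nth axisX pointsZ i).
Qed.

Lemma symbolic_power_form m : has_form_of_degree (symbolic_power (@singular_points R) m)
  (110 * (m %/ 20).+1).
Proof.
exists (ico110 w ^+ (m %/ 20).+1); split.
- by rewrite expf_neq0 // ico110_neq0.
- exact: (dhomogMn _ (ico110_homog w)).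
move=> p /singular_pointP[P PP pP]; have [A _ _] := point_conditions PP pP.
have Jl := @point_idealMl C p.
apply: (ideal_exp_leq Jl _ (ideal_expX Jl (m %/ 20).+1 A)).
by rewrite mulnC; have := ltn_ceil m (isT : (0 < 20)%N); rewrite mulnC; lia.
Qed.

(** Nonzero forms of positive degree exist, so [alpha] is a true minimum. The slack 220 = 2 * 110
    comes from rounding m / 20 up. *)
Lemma alpha_bounds m : (11 * m <= 2 * alpha (symbolic_power (@singular_points R) m) <= 11 * m + 220)%N.
Proof.
pose J := symbolic_power (@singular_points R) m.
have [t [t_gt0 Jt t_min]] : exists t, [/\ (0 < t)%N, has_form_of_degree J t &
    forall u, (0 < u)%N -> has_form_of_degree J u -> (t <= u)%N].
  have ex : exists t, (0 < t)%N && `[< has_form_of_degree J t >].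
    by exists (110 * (m %/ 20).+1)%N; rewrite muln_gt0 /=; apply/asboolP; apply: symbolic_power_form.
  exists (ex_minn ex); case: ex_minnP => t /andP[t_gt0 /asboolP Jt] t_min; split=> // u u_gt0 Ju.
  by apply: t_min; rewrite u_gt0; apply/asboolP.
rewrite /alpha; case: xgetP => [a _ [a_gt0 Ja a_min]|no_t]; last by case: (no_t t).
rewrite (symbolic_power_degree Ja) /=.
have := a_min _ _ (symbolic_power_form m); rewrite muln_gt0 /= => /(_ isT).
by have := leq_divM m 20; lia.
Qed.

End Conditions.

(** Since d a(m) - c m lies between 0 and b, the error is at most b / (d m). *)
Lemma cvg_linear_growth (R : realType) (a : nat -> nat) (c d b : nat) : (0 < d)%N ->
  (forall m, c * m <= d * a m <= c * m + b)%N ->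
  ((a m)%:R / m%:R : R) @[m --> \oo] --> (c%:R / d%:R : R).
Proof.
move=> d_gt0 a_bnd; apply/cvgrPdist_le => e e_gt0; near=> m.
have m_gt0 : (0 : R) < m%:R by near: m; apply: nbhs_infty_gtr.
have d0 : (0 : R) < d%:R by rewrite ltr0n.
have bm : b%:R / (d%:R * e) <= m%:R by near: m; apply: nbhs_infty_ger.
have /andP[lo hi] := a_bnd m.
have {}lo : c%:R * m%:R <= d%:R * (a m)%:R :> R by rewrite -!natrM ler_nat.
have {}hi : d%:R * (a m)%:R <= c%:R * m%:R + b%:R :> R by rewrite -!natrM -natrD ler_nat.
have -> : c%:R / d%:R - (a m)%:R / m%:R = - ((d%:R * (a m)%:R - c%:R * m%:R) / (d%:R * m%:R)) :> R.
  by field; rewrite !gt_eqF.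
rewrite normrN ger0_norm; last by rewrite divr_ge0 ?mulr_ge0 ?subr_ge0 // ltW.
rewrite ler_pdivrMr ?mulr_gt0 //; rewrite ler_pdivrMr ?mulr_gt0 // in bm.
have -> : e * (d%:R * m%:R) = m%:R * (d%:R * e) by ring.
by apply: le_trans bm; rewrite lerBlDl.
Unshelve. all: by end_near. Qed.

Theorem theorem4p4 (R : realType) :
  nef (divisor_D R) /\
  ((alpha (symbolic_power (@singular_points R) m))%:R / m%:R : R)
    @[m --> \oo] --> (11 / 2 : R).
Proof.
split; first exact: divisor_D_nef.
exact: (@cvg_linear_growth R _ 11 2 220 isT (alpha_bounds R)).
Qed.
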